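(* Let $d\ge 1$ be an integer and let $\delta\in(0,1)$, $\gamma>0$ and $\epsilon\in(0,1)$ be fixed. Suppose that $r_n=\gamma_n n^{-(1-\delta)/d}$, where $\gamma_n/\gamma\to 1$ as $n\to\infty$. Then there exists a constant $c$, depending on $\delta$ and $d$ only, such that the random Bluetooth graph $\Gamma_n(r_n,c)$ is connected with high probability, i.e. $\lim_{n\to\infty}\mathbf{P}(\Gamma_n(r_n,c)\text{ is connected})=1$. Moreover, setting $$f(x)=\left\lceil\sqrt{\frac{1+x^2+8\sqrt{x}+\epsilon}{x-2x^2\log_2(1/x)}}\,\right\rceil ,$$ one may take $c=k_1+k_2+k_3+1$, where $$k_1=\begin{cases} f(\delta) & \text{if } \delta\in(0,1/5],\\ f(1/5) & \text{if } \delta\in(1/5,1),\end{cases}\qquad k_2=\left\lceil\frac{8(1+\epsilon)v_d(2\sqrt d)^d}{1-\epsilon}\right\rceil,\qquad k_3=\left\lceil\sqrt{4(1+\epsilon)v_d/\alpha_d}\,\right\rceil,$$ $v_d$ is the volume of the Euclidean ball of radius $1$ in $\mathbb{R}^d$, and $\alpha_d=(1-\epsilon)/(2(2\sqrt d)^d)$.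
   Context: Let $X_1,\dots,X_n$ be independent, uniformly distributed random points in $[0,1]^d$, and $\mathbf{X}=\{X_1,\dots,X_n\}$. Let $D(x,y)=\big(\sum_{i=1}^d\min(|x_i-y_i|,1-|x_i-y_i|)^2\big)^{1/2}$ be the Euclidean distance on the unit torus. For $r_n>0$, the random geometric graph $G_n(r_n)$ has vertex set $\mathbf{X}$, and distinct $X_i,X_j$ are joined by an edge if and only if $D(X_i,X_j)\le r_n$. Given a positive integer $c$, the random Bluetooth graph $\Gamma_n(r_n,c)$ is the following random subgraph of $G_n(r_n)$: conditionally on $\mathbf{X}$, each vertex $X_i$, independently of the other vertices, selects uniformly at random without replacement $c$ of the edges of $G_n(r_n)$ adjacent to $X_i$ (all of them if its degree in $G_n(r_n)$ is less than $c$). $\Gamma_n(r_n,c)$ is the undirected graph with vertex set $\mathbf{X}$ whose edges are the edges selected by at least one of their endpoints. *)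

(* Defs.v *)
From HB Require Import structures.
From mathcomp Require Import all_boot all_order all_algebra.
From mathcomp Require Import all_classical all_reals all_analysis.

Set Implicit Arguments.
Unset Strict Implicit.
Unset Printing Implicit Defensive.

Import Order.TTheory GRing.Theory Num.Theory.
Import numFieldNormedType.Exports.

Local Open Scope classical_set_scope.
Local Open Scope ring_scope.

(* d-dimensional Lebesgue measure, as the d-fold product of the
   one-dimensional one; the successor case is the formula defining the library
   product measure (\x), transported along R * d.-tuple R = d.+1.-tuple R. *)
Fixpoint lebesgue_tuple (R : realType) (d : nat) :
    set (d.-tuple R) -> \bar R :=
  match d return set (d.-tuple R) -> \bar R with
  | 0%N => fun A => \d_([tuple] : 0.-tuple R) A
  | d'.+1 => fun A => (\int[@lebesgue_measure R]_x
      lebesgue_tuple [set t : d'.-tuple R | A [tuple of x :: t]])%E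
  end.

Definition unit_cube (R : realType) (d : nat) : set (d.-tuple R) :=
  [set x | forall k, 0 <= tnth x k <= 1].

Definition ball_volume (R : realType) (d : nat) : R :=
  fine (lebesgue_tuple
    [set x : d.-tuple R | Num.sqrt (\sum_(k < d) tnth x k ^+ 2) <= 1]).

Definition torus_dist (R : realType) (d : nat) (x y : d.-tuple R) : R :=
  Num.sqrt (\sum_(k < d)
    (Num.min `|tnth x k - tnth y k| (1 - `|tnth x k - tnth y k|)) ^+ 2).

(* The vertex X_i is represented by its index i: the points are almost surely
   distinct. *)
Definition rgg_neighbors (R : realType) (d n : nat) (r : R)
    (x : n.-tuple (d.-tuple R)) (i : 'I_n) : {set 'I_n} :=
  [set j : 'I_n | (j != i) && (torus_dist (tnth x i) (tnth x j) <= r)]%SET.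

(* Probability of drawing the set s when min(c, #|N|) elements of N are
   selected uniformly at random without replacement. *)
Definition select_prob (R : realType) (n c : nat) (N s : {set 'I_n}) : R :=
  if (s \subset N) && (#|s| == minn c #|N|)
  then ('C(#|N|, minn c #|N|)%:R)^-1 else 0.

Definition mutually_independent d0 d1 (Om : measurableType d0)
    (T : measurableType d1) (R : realType) (P : probability Om R) (n : nat)
    (X : 'I_n -> {RV P >-> T}) : Prop :=
  forall (J : {set 'I_n}) (A : 'I_n -> set T),
    (forall i, measurable (A i)) ->
    P [set w | forall i, i \in J -> A i (X i w)] =
    (\prod_(i in J) P [set w | A i (X i w)])%E.

Definition uniform_on_cube d0 (Om : measurableType d0) (R : realType)
    (P : probability Om R) (d : nat) (Y : {RV P >-> d.-tuple R}) : Prop :=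
  forall A : set (d.-tuple R), measurable A ->
    P [set w | A (Y w)] = lebesgue_tuple (A `&` @unit_cube R d).

(* S i w is the set of the neighbours of X_i that are joined to X_i by an edge
   selected by X_i.  The last clause gives the conditional law of (S_i)_i given
   (X_i)_i: a product of uniform laws on sets of min(c, degree) neighbours. *)
Record bluetooth_model d0 (Om : measurableType d0) (R : realType)
    (P : probability Om R) (d n : nat) (r : R) (c : nat)
    (X : 'I_n -> {RV P >-> d.-tuple R}) (S : 'I_n -> Om -> {set 'I_n}) :
    Prop := BluetoothModel {
  points_independent : mutually_independent X ;
  points_uniform : forall i, uniform_on_cube (X i) ;
  selection_measurable :
    forall i (s : {set 'I_n}), measurable [set w | S i w = s] ;
  selection_law :
    forall (B : set (n.-tuple (d.-tuple R))) (s : 'I_n -> {set 'I_n}),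
    measurable B ->
    P [set w | B [tuple X i w | i < n] /\ forall i, S i w = s i] =
    (\int[P]_(w in [set w | B [tuple X i w | i < n]])
       (\prod_(i < n) select_prob R c
          (rgg_neighbors r [tuple X j w | j < n] i) (s i))%:E)%E
}.

Definition bluetooth_edge (n : nat) (S : 'I_n -> {set 'I_n}) : rel 'I_n :=
  [rel i j | (j \in S i) || (i \in S j)].

Definition graph_connected (n : nat) (e : rel 'I_n) : Prop :=
  forall i j, connect e i j.

(* With high probability is a property of the laws for each n separately, so
   each n may come with its own probability space. *)
Definition bluetooth_connected_whp (R : realType) (d : nat) (r : nat -> R)
    (c : nat) : Prop :=
  forall (disp : nat -> measure_display)
    (Om : forall n, measurableType (disp n))
    (P : forall n, probability (Om n) R)
    (X : forall n, 'I_n -> {RV (P n) >-> d.-tuple R})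
    (S : forall n, 'I_n -> Om n -> {set 'I_n}),
  (forall n, bluetooth_model (r n) c (X n) (S n)) ->
  P n [set w | graph_connected (bluetooth_edge (fun i => S n i w))]
    @[n --> \oo] --> 1%E.

Definition natceil (R : realType) (x : R) : nat := `|Num.ceil x|%N.

Definition bt_f (R : realType) (eps x : R) : nat :=
  natceil (Num.sqrt ((1 + x ^+ 2 + 8 * Num.sqrt x + eps) /
                     (x - 2 * x ^+ 2 * (ln (x^-1) / ln 2)))).

Definition bt_k1 (R : realType) (delta eps : R) : nat :=
  if delta <= 5^-1 then bt_f eps delta else bt_f eps 5^-1.

Definition bt_k2 (R : realType) (d : nat) (eps : R) : nat :=
  natceil (8 * (1 + eps) * ball_volume R d * (2 * Num.sqrt d%:R) ^+ d /
           (1 - eps)).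

Definition bt_alpha (R : realType) (d : nat) (eps : R) : R :=
  (1 - eps) / (2 * (2 * Num.sqrt d%:R) ^+ d).

Definition bt_k3 (R : realType) (d : nat) (eps : R) : nat :=
  natceil (Num.sqrt (4 * (1 + eps) * ball_volume R d / bt_alpha d eps)).

(* Main.v *)
(* A union bound over the closed sets of the selected graph.  Cut the torus into
   cells of side about [r / (2 sqrt d)]: points of cells that touch are adjacent
   in the geometric graph, and with high probability every cell holds about the
   expected number of points and no degree exceeds [Dm], slightly above the
   expected degree, where [(c - 1) Nl >= 7 Dm] for the least cell population
   [Nl]; this is what the summand [k_2] of [c] is for.

   Two unions of components cannot coexist when each holds at least half of a
   cell: somewhere half of a cell would send no edge to half of a touching cell,
   which has probability [exp (- 7 Nl / 4)] against at most [4 ^ N] choices.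
   Hence, if the graph is disconnected, some component [B] is a minority in
   every cell.  A walk of length [2 (|B| - 1)] on the cells, with some steps
   flagged, records how many points [B] has in each cell, so that there are
   exponentially many such profiles; and a set with a given profile is closed
   with probability at most [prod_v (a_v / deg v) ^ c], where [a_v] counts the
   neighbours of [v] in [B].  One factor [a_v / deg v] pays for the choice of the
   points of [B] inside the cells, and the other [c - 1] factors are at most
   [exp (- 7 * 3 ^ d / 2)] by minority, which beats the exponential number of
   profiles, or [(|B| / deg v) ^ (c - 1)], which is used for small [B].  As
   [|B| > c], the sum over the small sets is of order
   [n ^ (1 - delta (c - 1) (c + 1))] up to logarithms, and
   [delta (c - 1) (c + 1) > 1] because [delta k_1 ^ 2 >= 1].

   Degrees are bounded by counting the points in balls of radius slightly larger
   than [r] centred at a fine grid, so that only fixed sets have to be dealt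
   with. *)

Require Import Defs.
From HB Require Import structures.
From mathcomp Require Import all_boot all_order all_algebra.
From mathcomp Require Import all_classical all_reals all_analysis.
From mathcomp Require Import measurable_realfun zify ring lra.

Set Implicit Arguments.
Unset Strict Implicit.
Unset Printing Implicit Defensive.

Import Order.TTheory GRing.Theory Num.Theory.
Import numFieldNormedType.Exports.

Local Open Scope classical_set_scope.
Local Open Scope ring_scope.

(** * Numerical estimates *)

Section Numerics.
Variable R : realType.

(** Listing a connected set point by point costs a factor of the order of the degree per point, and
    degrees grow like [n ^ delta]; listing only its cells costs a bounded factor, and a single
    factor [a_v / deg v] then compensates the choice inside the cells. For sets that fill their
    surroundings the ratios [a_v / deg v] may be close to 1 and give no gain; this is why majorities
    are excluded beforehand. Edges may join cells that do not touch, so two relations on cells are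
    used: touching cells for forced adjacency, and cells at distance at most [3 d] for possible
    adjacency, whence at most [K = (6 d + 1) ^ d] cells reachable in one step of a walk. The
    multiple 7 serves both parts: [7 / 4] exceeds [(3 / 2) (9 / 8)], where [4 <= exp (3 / 2)] and
    the populations of cells have ratio at most [9 / 8], and [7 * 3 ^ d / 2] exceeds the logarithm
    of [8 e K ^ 3] in every dimension. It is below the 8 in [k_2], and the gap absorbs rounding and
    concentration errors. *)

Lemma expR_ge_series (x : R) (k : nat) : 0 <= x ->
  \sum_(i < k) x ^+ i / i`!%:R <= expR x.
Proof.
move=> x0; have h : nondecreasing_seq (series (exp_coeff x)).
  by apply/nondecreasing_seqP => j;
    rewrite /series/= big_nat_recr//= lerDl exp_coeff_ge0.
apply: le_trans (nondecreasing_cvgn_le h (is_cvg_series_exp_coeff _) k).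
by rewrite /series/= big_mkord.
Qed.

Lemma expR_ge_coeff (x : R) (b : nat) : 0 <= x -> x ^+ b / b`!%:R <= expR x.
Proof.
move=> x0; apply: le_trans (expR_ge_series b.+1 x0).
by rewrite big_ord_recr lerDr sumr_ge0// => i _; rewrite divr_ge0// exprn_ge0.
Qed.

(** Inverting [1 - t <= exp (- t)] leaves [t ^ 2 (1 - 2 t) >= 0]. Negative [t] is allowed, which the
    lower tail of the Chernoff bound uses. *)
Lemma expR_le_quadratic (t : R) : t <= 2^-1 ->
  expR t <= 1 + t + 2 * t ^+ 2.
Proof.
move=> t1; have h1 : 0 < 1 - t by lra.
have h2 : 1 - t <= expR (- t) by have := expR_ge1Dx (- t); lra.
have : expR t <= (1 - t)^-1.
  by rewrite -[expR t]invrK -expRN lef_pV2 ?posrE ?expR_gt0.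
move/le_trans; apply; rewrite -[(1 - t)^-1]mul1r ler_pdivrMr//.
have : 0 <= t ^+ 2 * (1 - 2 * t) by rewrite mulr_ge0 ?sqr_ge0//; lra.
by rewrite expr2; nra.
Qed.

Lemma seven_le_expR2 : 7 <= expR 2 :> R.
Proof.
have := @expR_ge_series 2 5 (ler0n _ 2).
by rewrite !big_ord_recr big_ord0 /= !factS fact0 !exprS expr0; lra.
Qed.

Lemma four_le_expR : 4 <= expR (3 / 2) :> R.
Proof.
have h : 0 <= 3 / 2 :> R by lra.
have := expR_ge_series 4 h.
by rewrite !big_ord_recr big_ord0 /= !factS fact0 !exprS expr0; lra.
Qed.

Lemma eight_le_expR3 : 8 <= expR 3 :> R.
Proof.
have := @expR_ge_series 3 3 (ler0n _ 3).
by rewrite !big_ord_recr big_ord0 /= !factS fact0 !exprS expr0; lra.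
Qed.

(** Twice the comparison [3 d (d + 1) + 4 <= 7 / 2 * 3 ^ d] of exponents in [animal_constant_le]. It
    is nearly tight for [d = 1], where it reads [20 <= 21]. *)
Lemma quadratic_le_exp3 (d : nat) : (0 < d)%N ->
  (6 * d * d + 6 * d + 8 <= 7 * 3 ^ d)%N.
Proof.
elim: d => // -[|d] IH _ //; have := IH isT; rewrite [X in (_ -> _ <= _ * X)%N]expnS.
by move: (3 ^ d.+1)%N => m; nia.
Qed.

(** With [K = (6 d + 1) ^ d], the factor [4 e K ^ 3] is the cost per point in [sum_coded]. Since
    [6 d + 1 <= 7 d <= exp (d + 1)], one has [K ^ 3 <= exp (3 d (d + 1))], and the remaining
    [4 * 2 = 8] is at most [exp 3]. *)
Lemma animal_constant_le (d : nat) (x : R) : (0 < d)%N -> 7 / 2 * 3 ^+ d <= x ->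
  4 * expR 1 * (((6 * d).+1 ^ d)%N)%:R ^+ 3 * expR (- x) <= 2^-1.
Proof.
move=> d0 hx.
have K1 : ((6 * d).+1)%:R <= expR (d%:R + 1) :> R.
  have h7 : ((6 * d).+1)%:R <= 7 * d%:R :> R by rewrite -natrM ler_nat; lia.
  apply: (le_trans h7); rewrite (_ : d%:R + 1 = 2 + (d%:R - 1)); last by ring.
  rewrite expRD; apply: ler_pM => //; first exact: seven_le_expR2.
  by apply: le_trans (expR_ge1Dx _); lra.
have K2 : (((6 * d).+1 ^ d)%N)%:R ^+ 3 <= expR (3 * d%:R * (d%:R + 1)) :> R.
  rewrite natrX -exprM.
  have -> : 3 * d%:R * (d%:R + 1) = (d%:R + 1) * (d * 3)%:R :> R by rewrite natrM;
    ring.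
  by rewrite expRM_natr; apply: lerXn2r; rewrite ?nnegrE ?expR_ge0.
have h8 := eight_le_expR3.
apply: (@le_trans _ _ (4 * (expR 1 * expR (3 * d%:R * (d%:R + 1)) * expR (- x)))).
  move: (_ ^+ 3) (expR (_ * _)) K2 => a b ab;
    rewrite mulrA ler_wpM2r ?expR_ge0// mulrA.
  by rewrite ler_wpM2l// mulr_ge0// expR_ge0.
rewrite -!expRD.
have : 4 * expR (1 + 3 * d%:R * (d%:R + 1) + - x) * (2 * expR 3) <= expR 3.
  rewrite (_ : 4 * _ * _ = 8 * expR (1 + 3 * d%:R * (d%:R + 1) - x + 3));
    last by rewrite [in RHS]expRD; ring.
  apply: (@le_trans _ _ (expR 3 * expR (1 + 3 * d%:R * (d%:R + 1) - x + 3))).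
    by rewrite ler_wpM2r// expR_ge0.
  rewrite -expRD ler_expR.
  have := quadratic_le_exp3 d0; rewrite -(ler_nat R) !natrD !natrM natrX.
  by move: (3 ^+ d) (d%:R) hx => t e hx; lra.
rewrite mulrA ger_pMl ?expR_gt0//; move: (expR _) => z; lra.
Qed.

(** Inductive step: [(1 + eta) (1 - (k + 1) eta)] falls short of [1 - k eta] by
    [(k + 1) eta ^ 2]. *)
Lemma bernoulli_inv (eta : R) (k : nat) : 0 <= eta -> k%:R * eta <= 1 ->
  (1 + eta) ^+ k * (1 - k%:R * eta) <= 1.
Proof.
move=> e0; elim: k => [|k IH] hk; first by rewrite expr0 mul0r subr0 mul1r.
have hk' : k%:R * eta <= 1 by apply: le_trans hk; rewrite ler_wpM2r// ler_nat.
apply: le_trans (IH hk'); rewrite exprSr -mulrA ler_wpM2l//.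
  by rewrite exprn_ge0// addr_ge0.
rewrite -natr1; have : 0 <= (k%:R + 1) * eta ^+ 2 by rewrite mulr_ge0 ?sqr_ge0//
  addr_ge0.
by rewrite expr2; move: (k%:R) => j; nra.
Qed.

(** The relative error allowed everywhere. It makes [(2 d + 3) eta = 1 / 8], the room between 7 and
    8. *)
Definition grid_eta (d : nat) : R := ((8 * (2 * d + 3))%:R)^-1.

Lemma grid_eta_bounds d : (0 < d)%N -> 0 < grid_eta d /\ grid_eta d <= 40^-1.
Proof.
move=> d0; rewrite /grid_eta invr_gt0 ltr0n; split; first lia.
by rewrite lef_pV2 ?posrE ?ltr0n//; rewrite ?ler_nat; lia.
Qed.

(** On the left, one factor [1 + eta] is for the deviation of the degrees, [d] of them for the
    enlarged balls and [d] for rounding the side of the cells. On the right, one [eta] is for the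
    deviation of the populations of the cells and one for their integer part. *)
Lemma grid_eta_le d : (0 < d)%N ->
  7 * (1 + grid_eta d) ^+ (2 * d + 1) <= 8 * (1 - 2 * grid_eta d).
Proof.
move=> d0; have [e0 e1] := grid_eta_bounds d0.
have e8 : (2 * d + 3)%:R * grid_eta d = 8^-1.
  rewrite /grid_eta natrM; field;
    rewrite -natrM -natrD pnatr_eq0 addn_eq0 muln_eq0 andbF //.
have hk : (2 * d + 1)%:R * grid_eta d = 8^-1 - 2 * grid_eta d.
  by rewrite -e8 !natrD; ring.
have := bernoulli_inv (k := (2 * d + 1)%N) (ltW e0); rewrite hk => /(_ _).
move: (grid_eta d) ((1 + _) ^+ _) e0 e1 => e t e0 e1 /(_ _) h.
have {}h : t * (1 - (8^-1 - 2 * e)) <= 1 by apply: h; lra.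
have : 7 * (t * (1 - (8^-1 - 2 * e))) <= 8 * (1 - 2 * e) * (1 - (8^-1 - 2 * e)).
  apply: (@le_trans _ _ 7); first lra.
  have : 0 <= e ^+ 2 by exact: sqr_ge0.
  by rewrite expr2; nra.
rewrite mulrA ler_pM2r//; lra.
Qed.

End Numerics.

(** * Random selections *)

Section Selection.
Import mathcomp.boot.finset.
Variables (R : realType) (n c : nat).
Implicit Types (N U : {set 'I_n}).

Lemma select_prob_ge0 N s : 0 <= select_prob R c N s.
Proof. by rewrite /select_prob; case: ifP. Qed.

Lemma sum_select_prob_sub N U : (c <= #|N|)%N ->
  \sum_(s : {set 'I_n} | s \subset U) select_prob R c N s =
  'C(#|U :&: N|, c)%:R / 'C(#|N|, c)%:R.
Proof.
move=> cN; rewrite /select_prob (minn_idPl cN) -big_mkcondr /=.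
rewrite (eq_bigl [in [set s : {set 'I_n} | s \subset U :&: N & #|s| == c]]).
  by rewrite sumr_const cards_draws mulr_natl.
by move=> s; rewrite inE subsetI andbA.
Qed.

Lemma sum_select_prob N : (c <= #|N|)%N ->
  \sum_(s : {set 'I_n}) select_prob R c N s = 1.
Proof.
move=> cN; have := sum_select_prob_sub [set: 'I_n]%SET cN.
rewrite setTI divff; last by rewrite pnatr_eq0 -lt0n bin_gt0.
by move=> <-; apply: eq_bigl => s; rewrite subsetT.
Qed.

(** The quotient is the product of [(a - i) / (b - i)] over [i < c], each factor being at most
    [a / b]. *)
Lemma ratio_bin_le (a b : nat) : (a <= b)%N -> (c <= b)%N ->
  ('C(a, c)%:R / 'C(b, c)%:R : R) <= (a%:R / b%:R) ^+ c.
Proof.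
elim: c a b => [|k IH] a b ab kb; first by rewrite !bin0 expr0 divr1.
case: b ab kb => // b ab kb.
case: a ab => [|a] ab; first by rewrite bin0n !mul0r exprn_ge0.
have b0 : (0 : R) < b.+1%:R by rewrite ltr0n.
have k0 : (k.+1%:R : R) != 0 by rewrite pnatr_eq0.
have dd m : ('C(m.+1, k.+1)%:R : R) = m.+1%:R * 'C(m, k)%:R / k.+1%:R.
  apply: (mulIf k0); rewrite divfK// -!natrM mulnC -mul_bin_diag//.
rewrite !dd exprS.
have Cb : ('C(b, k)%:R : R) != 0 by rewrite pnatr_eq0 -lt0n bin_gt0.
have -> : (a.+1%:R * 'C(a, k)%:R / k.+1%:R / (b.+1%:R * 'C(b, k)%:R / k.+1%:R) : R)
  = a.+1%:R / b.+1%:R * ('C(a, k)%:R / 'C(b, k)%:R).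
  move: (lt0r_neq0 b0) k0 Cb; move: (a.+1%:R) (b.+1%:R) (k.+1%:R) => x y z y0 z0 C0.
  by field; rewrite C0 z0 y0.
apply: ler_wpM2l; first by rewrite divr_ge0.
apply: (le_trans (IH a b _ _)) => //.
apply: lerXn2r; rewrite ?nnegrE ?divr_ge0//.
(* For [b = 0] the left side is a division by zero, hence 0. *)
case: b ab kb b0 Cb => [|b] ab kb b0 Cb.
  by rewrite invr0 mulr0 divr_ge0.
rewrite ler_pdivrMr ?ltr0n// mulrAC ler_pdivlMr// -!natrM ler_nat.
by rewrite mulSn mulnS; lia.
Qed.

Lemma sum_select_prob_sub_le N U : (c <= #|N|)%N ->
  \sum_(s : {set 'I_n} | s \subset U) select_prob R c N s <=
  (#|U :&: N|%:R / #|N|%:R) ^+ c.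
Proof.
move=> cN; rewrite sum_select_prob_sub//; apply: ratio_bin_le => //.
exact/subset_leq_card/subsetIr.
Qed.

Variable nb : 'I_n -> {set 'I_n}.
Hypothesis deg_ge : forall v, (c <= #|nb v|)%N.

(** The law of the selections for fixed neighbourhoods, as a finite sum: the combinatorial part
    stays free of measure theory, and [prob_selections_le] links it to [P]. *)
Definition selection_prob (Q : pred {ffun 'I_n -> {set 'I_n}}) : R :=
  \sum_(s : {ffun 'I_n ->
    {set 'I_n}} | Q s) \prod_(v < n) select_prob R c (nb v) (s v).

Lemma selection_prob_le (Q1 Q2 : pred {ffun 'I_n -> {set 'I_n}}) :
  (forall s, Q1 s -> Q2 s) -> selection_prob Q1 <= selection_prob Q2.
Proof.
move=> Q12; rewrite /selection_prob [leRHS](bigID Q1)/=.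
rewrite (eq_bigl Q1 _ (P1 := fun s => Q2 s && Q1 s)); last first.
  by move=> s; case: (boolP (Q1 s)) => [/Q12 ->|]; rewrite ?andbF.
rewrite lerDl; apply: sumr_ge0 => s _; apply: prodr_ge0 => v _.
exact: select_prob_ge0.
Qed.

Lemma selection_prob_union (I : finType) (J : pred I)
    (Q : I -> pred {ffun 'I_n -> {set 'I_n}}) :
  selection_prob (fun s => [exists i, J i && Q i s]) <=
  \sum_(i | J i) selection_prob (Q i).
Proof.
rewrite /selection_prob.
under [leRHS]eq_bigr do rewrite big_mkcond/=.
rewrite exchange_big/= big_mkcond/=; apply: ler_sum => s _.
have p0 : 0 <= \prod_(v < n) select_prob R c (nb v) (s v).
  by apply: prodr_ge0 => v _; exact: select_prob_ge0.
case: ifPn => [/existsP[i /andP[Ji Qi]]|_].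
  rewrite (bigD1 i)//= Qi lerDl sumr_ge0// => j _; by case: ifP.
by apply: sumr_ge0 => j _; case: ifP.
Qed.

Lemma selection_prob_or (Q1 Q2 : pred {ffun 'I_n -> {set 'I_n}}) :
  selection_prob (fun s => Q1 s || Q2 s) <= selection_prob Q1 + selection_prob Q2.
Proof.
have := selection_prob_union xpredT (fun b : bool => if b then Q1 else Q2).
rewrite big_bool /=; apply: le_trans; apply: selection_prob_le => s /orP[h|h].
  by apply/existsP; exists true.
by apply/existsP; exists false.
Qed.

(** Vertices select independently, so the sum over families factors over the vertices, those outside
    [B] contributing 1. It is applied with target [B] for closed sets, and with target [~: T] for
    the absence of edges to [T]. *)
Lemma selection_prob_closed (B : {set 'I_n}) (U : 'I_n -> {set 'I_n}) :
  selection_prob (fun s => [forall v in B, s v \subset U v]) <=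
  \prod_(v in B) (#|U v :&: nb v|%:R / #|nb v|%:R) ^+ c.
Proof.
pose G v (s : {set 'I_n}) : R :=
  if (v \in B) ==> (s \subset U v) then select_prob R c (nb v) s else 0.
rewrite /selection_prob.
have -> : \sum_(s : {ffun 'I_n -> {set 'I_n}} | [forall v in B, s v \subset U v])
    \prod_(v < n) select_prob R c (nb v) (s v) = \sum_(s : {ffun 'I_n ->
      {set 'I_n}}) \prod_(v < n) G v (s v).
  rewrite big_mkcond/=; apply: eq_bigr => s _; case: ifPn => [/forall_inP h|].
    apply: eq_bigr => v _; rewrite /G; case: ifPn => //.
    by rewrite negb_imply => /andP[/h ->].
  rewrite negb_forall => /existsP[v hv]; rewrite (bigD1 v)//= /G.
  by rewrite (negbTE hv) mul0r.
rewrite -(bigA_distr_bigA G) [leRHS]big_mkcond/=.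
apply: ler_prod => v _; apply/andP; split.
  by apply: sumr_ge0 => s _; rewrite /G; case: ifP => // _; exact: select_prob_ge0.
case: ifPn => vB; rewrite /G ?vB ?(negbTE vB)/=.
  rewrite -big_mkcond/=; exact: sum_select_prob_sub_le.
by rewrite sum_select_prob.
Qed.

End Selection.

(** * Walks coding connected sets *)

Section Codes.
Import mathcomp.boot.finset.
Variables (n : nat) (W : finType) (cell : 'I_n -> W) (A : rel W).

Definition occupation (B : {set 'I_n}) (q : W) : nat :=
  #|[set v in B | cell v == q]|.

(* A step of a walk carries a flag; the starting point and the flagged steps
   record the occupied cells with multiplicity. *)
Definition walk_occupation (q0 : W) (t : seq (W * bool)) (q : W) : nat :=
  ((q0 == q) + count_mem (q, true) t)%N.

Hypothesis Asym : symmetric A.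

(* Grow the component one vertex at a time: the new cell is visited by a detour
   of length two from an adjacent cell that the walk already visits. *)
Lemma component_code (e : rel 'I_n) (v0 : 'I_n) (k : nat) :
  (forall v w, e v w -> A (cell v) (cell w)) ->
  (k < #|[set w | connect e v0 w]|)%N ->
  exists Bk : {set 'I_n}, exists t : seq (W * bool),
  [/\ Bk \subset [set w | connect e v0 w], #|Bk| = k.+1, v0 \in Bk,
   (size t = k.*2 /\ path A (cell v0) (unzip1 t)) &
   (forall v, v \in Bk -> cell v \in cell v0 :: unzip1 t) /\
   (forall q, occupation Bk q = walk_occupation (cell v0) t q)].
Proof.
move=> eA; set C := [set w | _]%SET.
have v0C : v0 \in C by rewrite inE connect0.
elim: k => [_|k IH kC].
  exists [set v0]%SET, [::]; split => //.
  - by rewrite sub1set.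
  - by rewrite cards1.
  - by rewrite set11.
  split => [v|q]; first by rewrite !inE => /eqP ->.
  rewrite /occupation /walk_occupation addn0.
  case: eqP => [<-|/eqP qn].
    rewrite (_ : finset _ = [set v0]%SET) ?cards1//.
    by apply/setP => v; rewrite !inE; case: eqP => // ->; rewrite eqxx.
  apply: eq_card0 => v; rewrite !inE; case: eqP => //= ->.
  exact: negbTE.
have [Bk [t [BC cB v0B [st pt] [vt ot]]]] := IH (ltnW kC).
have [u [w [uB wB euw]]] : exists u w, [/\ u \in Bk, w \notin Bk & e u w].
  have : ~~ (C \subset Bk) by apply/negP => /subset_leq_card; rewrite cB leqNgt kC.
  case/subsetPn => x; rewrite inE => /connectP[p];
    elim: p (v0) v0B => /= [|y p IHp] z zB.
    by move=> _ -> /negP.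
  move=> /andP[ezy py] xE xB; case: (boolP (y \in Bk)) => yB; first exact: (IHp y).
  by exists z, y.
have wC : w \in C.
  rewrite inE; apply: connect_trans (connect1 euw).
  by have := fintype.subsetP BC _ uB; rewrite inE.
have := vt u uB; move eqp: (unzip1 t) => p up.
(* Cut the walk at a visit of [cell u] to insert the detour there. Only its outward step is flagged,
   as it adds the single point [w]. *)
case/splitPl: p / up eqp => p1 p2 lp1 eqp.
have e1 : unzip1 (take (size p1) t) = p1 by rewrite /unzip1 map_take -/(unzip1 t)
  eqp take_size_cat.
have e2 : unzip1 (drop (size p1) t) = p2 by rewrite /unzip1 map_drop -/(unzip1 t)
  eqp drop_size_cat.
have et := cat_take_drop (size p1) t.
move: e1 e2 et; set t1 := take _ t; set t2 := drop _ t => e1 e2 et.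
exists (w |: Bk)%SET, (t1 ++ [:: (cell w, true), (cell u, false) & t2]); split.
- by rewrite subUset sub1set wC.
- by rewrite cardsU1 wB cB.
- by rewrite in_setU1 v0B orbT.
- split.
    by move: st; rewrite -et !size_cat/= => /eqP; rewrite doubleS !addnS => /eqP ->.
  rewrite /unzip1 map_cat/= -/(unzip1 t1) -/(unzip1 t2) e1 e2 cat_path/= lp1.
  move: pt; rewrite eqp cat_path lp1 => /andP[-> ->] /=.
  have Auw := eA _ _ euw; have Awu : A (cell w) (cell u) by rewrite Asym.
  by rewrite Auw Awu.
have tE : perm_eq (t1 ++ [:: (cell w, true), (cell u, false) & t2])
   [:: (cell w, true), (cell u, false) & t].
  by apply/permP => a; rewrite -et /= !count_cat /=; lia.
split.
  move=> v; rewrite in_cons (perm_mem (perm_map fst tE)) /= !in_cons.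
  rewrite in_setU1 => /orP[/eqP->|/vt]; first by rewrite eqxx orbT.
  by rewrite in_cons => /orP[->//|->]; rewrite !orbT.
move=> q; rewrite /walk_occupation (permP tE) /= !xpair_eqE/= andbT andbF add0n.
rewrite addnCA -/(walk_occupation _ _ _) -ot /occupation.
case: eqP => [wq|/eqP wq].
  rewrite (_ : finset (fun v => (v \in w |: Bk) && (cell v == q)) =
    w |: finset (fun v => (v \in Bk) && (cell v == q)))%SET.
    by rewrite cardsU1 inE (negbTE wB).
  apply/setP => v; rewrite !inE; case: eqP => //= ->; by rewrite wq eqxx.
rewrite add0n; apply: eq_card => v; rewrite !inE; case: eqP => //= ->.
by rewrite (negbTE wq) andbF.
Qed.

Lemma card_walks (K : nat) (q0 : W) (l : nat) :
  (forall q, (#|[set q' | A q q']| <= K)%N) ->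
  (#|[set t : l.-tuple (W * bool) | path A q0 (unzip1 t)]| <= (2 * K) ^ l)%N.
Proof.
move=> AK; elim: l q0 => [|l IH] q0.
  rewrite expn0; apply: leq_trans (max_card _) _; by rewrite card_tuple expn0.
rewrite -sum1_card.
rewrite (reindex (fun u : (W * bool) * l.-tuple (W * bool) =>
  [tuple of u.1 :: u.2])) /=; last first.
  exists (fun t => (thead t, [tuple of behead t])) => [[x t] _|t _] /=.
    by congr pair; apply/val_inj.
  by rewrite [RHS]tuple_eta; apply/val_inj.
rewrite (eq_bigl (fun u : (W * bool) * l.-tuple (W * bool) =>
   A q0 u.1.1 && path A u.1.1 (unzip1 u.2))); last by move=> u; rewrite inE.
rewrite -(pair_big_dep (fun x : W * bool =>
  A q0 x.1) (fun (x : W * bool) (t : l.-tuple (W * bool)) =>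
    path A x.1 (unzip1 t)) (fun _ _ => 1%N))/=.
apply: (@leq_trans (\sum_(x : W * bool | A q0 x.1) (2 * K) ^ l)%N).
  apply: leq_sum => x _; rewrite sum1_card; apply: leq_trans (IH x.1).
  by rewrite cardsE.
rewrite sum_nat_const expnS leq_mul2r; apply/orP; right.
rewrite (@eq_card _ _ [predX [set q' | A q0 q']%SET & {: bool}]); last first.
  by move=> [x b]; rewrite -!topredE /=; rewrite [X in _ = X && _]inE andbT.
by rewrite cardX card_bool mulnC leq_mul2l AK orbT.
Qed.
End Codes.

(** * Weighing sets by their occupation profile *)

Section Profiles.
Import mathcomp.boot.finset.
Variables (R : realType) (n : nat) (W : finType) (cell : 'I_n -> W) (A : rel W).
Hypothesis Asym : symmetric A.
Variables (K N D : nat).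
Hypothesis AK : forall q, (#|[set q' | A q q']| <= K)%N.
Hypothesis cellN : forall q, (#|[set v | cell v == q]| <= N)%N.
Hypotheses (K0 : (0 < K)%N) (D0 : (0 < D)%N).

(** For a set with profile [b], a bound on the neighbours in the set of a point of the cell [q] that
    depends on the profile only; see [card_nb_le]. *)
Definition nearby (b : W -> nat) (q : W) : nat := (\sum_(q' | A q q') b q')%N.

(** A set is determined by its traces on the cells, so [h] injects these sets into the families of
    [b q]-subsets of the cells. *)
Lemma card_occupation (b : W -> nat) :
  (#|[set B : {set 'I_n} | [forall q, occupation cell B q == b q]]| <=
   \prod_q 'C(N, b q))%N.
Proof.
pose cls q := [set v | cell v == q]%SET.
pose F q : pred {set 'I_n} := [in [set C : {set 'I_n} | C \subset cls q & #|C| == b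
  q]].
pose h (B : {set 'I_n}) : {ffun W -> {set 'I_n}} := [ffun q =>
  [set v in B | cell v == q]%SET].
apply: (@leq_trans (\sum_(f in family F) 1)%N).
  rewrite sum1_card -(card_in_imset (f := h)).
    apply/subset_leq_card/fintype.subsetP => f /imsetP[B];
      rewrite inE => /forallP ob ->.
    apply/familyP => q; rewrite ffunE inE ob andbT.
    by apply/fintype.subsetP => v; rewrite !inE => /andP[].
  move=> B B' _ _ /ffunP hB; apply/setP => v; have := hB (cell v); rewrite !ffunE.
  by move=> /setP/(_ v); rewrite !inE eqxx !andbT.
apply: (@leq_trans (\sum_(f in family F) \prod_(q : W) 1)%N).
  by under [leqRHS]eq_bigr do rewrite big1_eq.
rewrite -(bigA_distr_big_dep F (fun _ _ => 1%N)); apply: leq_prod => q _.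
rewrite sum1_card; apply: (@leq_trans 'C(#|cls q|, b q)); last by apply: leq_bin2l;
  exact: cellN.
rewrite -cards_draws leq_eqVlt; apply/orP; left; apply/eqP; exact: eq_card.
Qed.

Lemma prod_cell_occupation (B : {set 'I_n}) (g : W -> R) :
  \prod_(v in B) g (cell v) = \prod_q g q ^+ occupation cell B q.
Proof.
rewrite (partition_big cell xpredT)//=; apply: eq_bigr => q _.
rewrite /occupation -prodr_const; rewrite (eq_bigr (fun=> g q));
  last by move=> v /andP[_ /eqP ->].
by apply: eq_bigl => v; rewrite inE.
Qed.

Lemma sum_occupation (B : {set 'I_n}) : (\sum_q occupation cell B q)%N = #|B|.
Proof.
rewrite -sum1_card (partition_big cell xpredT)//=; apply: eq_bigr => q _.
by rewrite sum1_card; apply: eq_card => v; rewrite !inE.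
Qed.

Lemma sum_nearby (b : W -> nat) : (\sum_q nearby b q <= K * \sum_q b q)%N.
Proof.
rewrite /nearby (exchange_big_dep xpredT)//= big_distrr/=; apply: leq_sum => q _.
rewrite sum_nat_const; apply: leq_mul => //; apply: leq_trans (AK q).
rewrite cardsE; apply: subset_leq_card; apply/fintype.subsetP => q'.
by rewrite -!topredE/= Asym.
Qed.

(* AM-GM in disguise: [t ^ b / b! <= e ^ t] with [t = nearby b q / K] trades the
   entropy of the cell [q] for the population of its neighbourhood, and the
   exponents add up to at most [\sum_q b q]. *)
Lemma profile_weight (b : W -> nat) :
  (\prod_q 'C(N, b q))%:R * \prod_q ((nearby b q)%:R / D%:R) ^+ b q <=
  (expR 1 * K%:R * N%:R / D%:R) ^+ (\sum_q b q) :> R.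
Proof.
have K0' : (0 : R) < K%:R by rewrite ltr0n.
have D0' : (0 : R) < D%:R by rewrite ltr0n.
have f0 k : (0 : R) < k`!%:R by rewrite ltr0n fact_gt0.
rewrite natr_prod -big_split/=.
apply: (@le_trans _ _ (\prod_q ((K%:R * N%:R / D%:R) ^+ b q * expR ((nearby b q)%:R
  / K%:R)))).
  apply: ler_prod => q _; rewrite mulr_ge0 ?exprn_ge0 ?divr_ge0//=.
  set s := (nearby b q)%:R; set k := b q.
  have s0 : 0 <= s / K%:R by rewrite divr_ge0// /s.
  apply: (@le_trans _ _ ((N%:R ^+ k / k`!%:R) * (s / D%:R) ^+ k)).
    rewrite ler_wpM2r ?exprn_ge0 ?divr_ge0 ?/s//.
    by rewrite ler_pdivlMr// -natrM -natrX ler_nat bin_ffact; elim: k => // k IHk;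
      rewrite ffactnSr expnSr leq_mul// leq_subr.
  have -> : (N%:R ^+ k / k`!%:R) * (s / D%:R) ^+ k =
     (K%:R * N%:R / D%:R) ^+ k * ((s / K%:R) ^+ k / k`!%:R).
    rewrite !exprMn !exprVn; field.
    by rewrite !gt_eqF ?exprn_gt0.
  apply: ler_wpM2l; last exact: expR_ge_coeff.
  by rewrite exprn_ge0// divr_ge0// mulr_ge0.
rewrite big_split/= prodrXr -expR_sum.
have -> : expR 1 * K%:R * N%:R / D%:R = K%:R * N%:R / D%:R * expR 1 :> R by ring.
rewrite [leRHS]exprMn; apply: ler_wpM2l.
  by rewrite exprn_ge0// divr_ge0// mulr_ge0.
rewrite -expRM_natr mul1r ler_expR -mulr_suml ler_pdivrMr// -natr_sum -natrM ler_nat.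
by rewrite mulnC sum_nearby.
Qed.

(** This is all that the union bound retains of the connectedness of a set [B] containing [v0]. *)
Definition coded (v0 : 'I_n) (B : {set 'I_n}) : bool :=
  [exists t : (#|B|.-1).*2.-tuple (W * bool), path A (cell v0) (unzip1 t) &&
    [forall q, occupation cell B q == walk_occupation (cell v0) t q]].

(** Group the sets by walks: there are at most [(2 K) ^ (2 m)] of them, and by [profile_weight] the
    sets with the profile of a given walk weigh at most [(e K N / D) ^ m] together. *)
Lemma sum_coded (v0 : 'I_n) (m : nat) :
  \sum_(B : {set 'I_n} | (#|B| == m) && coded v0 B)
    \prod_(v in B) ((nearby (occupation cell B) (cell v))%:R / D%:R) <=
  (4 * expR 1 * K%:R ^+ 3 * N%:R / D%:R) ^+ m :> R.
Proof.
have K0' : (1 : R) <= K%:R by rewrite ler1n.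
pose T := (m.-1).*2.-tuple (W * bool).
pose w (b : W -> nat) : R := \prod_q ((nearby b q)%:R / D%:R) ^+ b q.
pose z : R := expR 1 * K%:R * N%:R / D%:R.
have z0 : 0 <= z by rewrite /z divr_ge0// !mulr_ge0// expR_ge0.
apply: (@le_trans _ _ (\sum_(t : T | path A (cell v0) (unzip1 t))
   \sum_(B : {set 'I_n} | (#|B| == m) && [forall q,
     occupation cell B q == walk_occupation (cell v0) t q])
     w (occupation cell B))).
  under [leRHS]eq_bigr do rewrite big_mkcond/=.
  rewrite exchange_big/= big_mkcond/=; apply: ler_sum => B _.
  have w0 : 0 <= w (occupation cell B).
    by apply: prodr_ge0 => q _; rewrite exprn_ge0// divr_ge0.
  case: ifPn => [/andP[/eqP Bm /existsP[t]]|_]; last by apply: sumr_ge0 => t _;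
    case: ifP.
  rewrite Bm in t *; move=> /andP[pt ot].
  rewrite (bigD1 t)//= ot /= eqxx /= (prod_cell_occupation _ (fun q =>
    (nearby (occupation cell B) q)%:R / D%:R)) -/(w _) lerDl.
  by apply: sumr_ge0 => t' _; case: ifP.
apply: (@le_trans _ _ (\sum_(t : T | path A (cell v0) (unzip1 t)) z ^+ m)).
  apply: ler_sum => t _; set b := walk_occupation _ _.
  (* A walk whose profile does not have [m] points codes no set of size [m]. *)
  case: (eqVneq (\sum_q b q)%N m) => [bm|bm]; last first.
    rewrite big1 ?exprn_ge0// => B /andP[/eqP Bm /forallP ob].
    by case/eqP: bm; rewrite -Bm -sum_occupation; apply: eq_bigr => q _;
      rewrite (eqP (ob q)).
  rewrite -bm; apply: le_trans (profile_weight b).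
  apply: (@le_trans _ _ (\sum_(B in [set B : {set 'I_n} | [forall q,
    occupation cell B q == b q]]) w b)).
    rewrite [leLHS]big_mkcond [leRHS]big_mkcond/=; apply: ler_sum => B _; rewrite inE.
    have wb0 : 0 <= w b by apply: prodr_ge0 => q _; rewrite exprn_ge0// divr_ge0.
    case: (boolP [forall _, _]) => [/forallP ob|]; last by rewrite andbF.
    case: ifP => // _; rewrite /w /nearby le_eqVlt; apply/orP; left; apply/eqP.
    apply: eq_bigr => q _; rewrite (eqP (ob q)); congr ((_%:R / _) ^+ _).
    by apply: eq_bigr => q' _; rewrite (eqP (ob q')).
  rewrite sumr_const -[X in X <= _]mulr_natl ler_wpM2r ?ler_nat ?card_occupation//.
  by apply: prodr_ge0 => q _; rewrite exprn_ge0// divr_ge0.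
rewrite (eq_bigl [in [set t : T | path A (cell v0) (unzip1 t)]%SET]);
  last by move=> t; rewrite inE.
rewrite sumr_const -[X in X <= _]mulr_natl.
apply: (@le_trans _ _ (((2 * K) ^ (m.*2))%:R * z ^+ m)).
  apply: ler_wpM2r; first exact: exprn_ge0.
  rewrite ler_nat; apply: leq_trans (card_walks _ _ AK) _.
  by apply: leq_pexp2l; lia.
rewrite -mul2n expnM natrX natrM -exprMn le_eqVlt; apply/orP; left; apply/eqP.
by congr (_ ^+ _); rewrite /z natrM; ring.
Qed.
End Profiles.

(** * Probability of disconnection for fixed positions *)

Section Disconnection.
Import mathcomp.boot.finset.
Variables (R : realType) (n c : nat) (nb : 'I_n -> {set 'I_n}).
Variables (W : finType) (cell : 'I_n -> W) (A Mo : rel W).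
Variables (K J Nl N D Dm : nat).
Implicit Types s : {ffun 'I_n -> {set 'I_n}}.
Let cls q := [set v | cell v == q]%SET.

(* [Mo] only relates cells such that every two points in them are adjacent, and
   [A] relates all cells that contain adjacent points. *)
Hypothesis c0 : (0 < c)%N.
Hypothesis nb_irr : forall v, v \notin nb v.
Hypothesis Asym : symmetric A.
Hypothesis AK : forall q, (#|[set q' | A q q']| <= K)%N.
Hypothesis nb_A : forall v w, w \in nb v -> A (cell v) (cell w).
Hypothesis Mo_nb : forall v w, Mo (cell v) (cell w) -> w != v -> w \in nb v.
Hypothesis Mo_connected : forall q q', connect Mo q q'.
Hypothesis Mo_refl : reflexive Mo.
Hypothesis MoJ : forall q, (J <= #|[set q' | Mo q q']|)%N.
Hypothesis cellN : forall q, (Nl <= #|cls q| <= N)%N.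
Hypothesis degD : forall v, (D <= #|nb v| <= Dm)%N.
Hypothesis cD : (c <= D)%N.
Hypothesis K0 : (0 < K)%N.

(** Degrees are at least [c], so exactly [c] neighbours are drawn, and a family that violates this
    at some vertex has a factor 0 there. *)
Lemma selection_prob_le_valid (Q1 Q2 : pred {ffun 'I_n -> {set 'I_n}}) :
  (forall s, (forall v, s v \subset nb v /\ #|s v| = c) -> Q1 s -> Q2 s) ->
  selection_prob R c nb Q1 <= selection_prob R c nb Q2.
Proof.
move=> Q12; apply: (@le_trans _ _ (selection_prob R c nb (fun s => Q1 s && Q2 s)));
  last first.
  by apply: selection_prob_le => s /andP[].
rewrite /selection_prob [leLHS](bigID Q2)/= gerDl sumr_le0// => s /andP[Q1s Q2s].
have [v vP] : exists v, ~~ ((s v \subset nb v) && (#|s v| == c)).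
  apply/existsP; rewrite -negb_forall; apply/negP => /forallP h.
  by case/negP: Q2s; apply: Q12 => // v; have /andP[-> /eqP ->] := h v.
rewrite (bigD1 v)//= /select_prob (minn_idPl _) ?(negbTE vP) ?mul0r//.
by apply: leq_trans cD _; case/andP: (degD v).
Qed.

Let deg_ge v : (c <= #|nb v|)%N.
Proof. by apply: leq_trans cD _; case/andP: (degD v). Qed.

Let D0 : (0 < D)%N. Proof. exact: leq_trans cD. Qed.

Let Dm0 (v : 'I_n) : (0 < Dm)%N.
Proof. by case/andP: (degD v) => h1 h2; apply: leq_trans D0 (leq_trans h1 h2). Qed.

(** The case [q = q'] is allowed, [Mo] being reflexive; disjointness then makes every point of [T] a
    neighbour of every point of [S]. *)
Definition split_pair (q q' : W) (S T : {set 'I_n}) : bool :=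
  [&& Mo q q', S \subset cls q, T \subset cls q', [disjoint S & T],
    (#|cls q| <= 2 * #|S|)%N & (#|cls q'| <= 2 * #|T|)%N].

Definition split_event (s : {ffun 'I_n -> {set 'I_n}}) : bool :=
  [exists p : W * W, true && [exists ST : {set 'I_n} * {set 'I_n},
    split_pair p.1 p.2 ST.1 ST.2 && [forall v in ST.1, s v \subset ~: ST.2]]].

(** All of [T] is adjacent to each [v] in [S], and [v] misses [T] with probability at most [(1 - |T|
    / deg v) ^ c <= exp (- c |T| / Dm)]. Both [S] and [T] have at least [Nl / 2] points, whence the
    4. *)
Lemma prob_no_selection (q q' : W) (S T : {set 'I_n}) : split_pair q q' S T ->
  selection_prob R c nb (fun s => [forall v in S, s v \subset ~: T]) <=
  expR (- (c%:R * Nl%:R ^+ 2 / (4 * Dm%:R))).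
Proof.
case/and5P => Mqq' Sq Tq' ST /andP[hS hT].
apply: (le_trans (selection_prob_closed R deg_ge S (fun=> ~: T)%SET)).
apply: (@le_trans _ _ (\prod_(v in S) expR (- (c%:R * #|T|%:R / Dm%:R)))).
  apply: ler_prod => v vS; rewrite exprn_ge0 ?divr_ge0//=.
  have Tnb : T \subset nb v.
    apply/fintype.subsetP => w wT; apply: Mo_nb.
      have := fintype.subsetP Sq _ vS; have := fintype.subsetP Tq' _ wT.
      by rewrite !inE => /eqP -> /eqP ->.
    apply/eqP => wv; move: ST => /pred0P/(_ v); rewrite /= vS /=.
    by rewrite -wv wT.
  have d0 : (0 : R) < #|nb v|%:R by rewrite ltr0n; apply: leq_trans c0 (deg_ge v).
  have -> : - (c%:R * #|T|%:R / Dm%:R) = - (#|T|%:R / Dm%:R) * c%:R :> R by ring.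
  rewrite expRM_natr; apply: lerXn2r; rewrite ?nnegrE ?divr_ge0 ?expR_ge0//.
  apply: (@le_trans _ _ (1 - #|T|%:R / Dm%:R)); last exact: expR_ge1Dx.
  have -> : #|~: T :&: nb v|%:R = #|nb v|%:R - #|T|%:R :> R.
    rewrite finset.setIC -setDE -natrB ?subset_leq_card//.
    by rewrite cardsD (finset.setIidPr Tnb).
  rewrite mulrBl divff ?gt_eqF// lerD2l lerN2 ler_wpM2l//.
  rewrite lef_pV2 ?posrE ?ltr0n ?(Dm0 v)// ?ler_nat; first by case/andP: (degD v).
  by rewrite -(ltr0n R).
rewrite prodr_const -expRM_natr ler_expR mulNr lerN2.
(* Without vertices [Dm] may be 0; both sides then vanish, the inverse of 0 being 0. *)
case: (posnP Dm) => [->|Dmp]; first by rewrite mulr0 !invr0 !mulr0 mul0r.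
have Dmp' : (0 : R) < Dm%:R by rewrite ltr0n.
rewrite ler_pdivrMr ?mulr_gt0//.
have -> : c%:R * #|T|%:R / Dm%:R * #|S|%:R * (4 * Dm%:R) =
  c%:R * ((2 * #|S|)%:R * (2 * #|T|)%:R) :> R by rewrite !natrM; field;
    rewrite gt_eqF.
rewrite ler_wpM2l// expr2 ler_pM// ler_nat.
  by apply: leq_trans hS; case/andP: (cellN q).
by apply: leq_trans hT; case/andP: (cellN q').
Qed.

Lemma prob_split : selection_prob R c nb split_event <=
  #|W|%:R ^+ 2 * 4 ^+ N * expR (- (c%:R * Nl%:R ^+ 2 / (4 * Dm%:R))).
Proof.
set x := expR _; have x0 : 0 <= x by exact: expR_ge0.
apply: (le_trans (selection_prob_union R c nb xpredT (fun (p : W * W) s =>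
  [exists ST : {set 'I_n} * {set 'I_n},
    split_pair p.1 p.2 ST.1 ST.2 && [forall v in ST.1, s v \subset ~: ST.2]]))).
apply: (@le_trans _ _ (\sum_(p : W * W) 4 ^+ N * x)); last first.
  by rewrite sumr_const card_prod -[leRHS]mulrA -[leLHS]mulr_natl natrM expr2.
apply: ler_sum => -[q q'] _ /=.
apply: (le_trans (selection_prob_union R c nb
  (fun ST : {set 'I_n} * {set 'I_n} => split_pair q q' ST.1 ST.2)
  (fun ST s => [forall v in ST.1, s v \subset ~: ST.2]))).
apply: (@le_trans _ _ (\sum_(ST : {set 'I_n} * {set 'I_n} | split_pair q q' ST.1
  ST.2) x)).
  by apply: ler_sum => -[S T] /= h; exact: prob_no_selection h.
rewrite sumr_const -[leLHS]mulr_natl ler_wpM2r//.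
have -> : 4 ^+ N = (2 ^ N * 2 ^ N)%:R :> R by rewrite natrM natrX -exprMn;
  congr (_ ^+ _); ring.
rewrite ler_nat.
apply: (@leq_trans #|[predX powerset (cls q) & powerset (cls q')]|).
  apply: subset_leq_card; apply/fintype.subsetP => -[S T].
  move=> /and5P[/= _ hS hT _ _]; apply/andP; split => /=; by rewrite powersetE.
rewrite cardX !card_powerset leq_mul// leq_pexp2l//.
  by case/andP: (cellN q).
by case/andP: (cellN q').
Qed.

Definition minority (B : {set 'I_n}) : bool :=
  [forall q, (2 * occupation cell B q < #|cls q|)%N].

(** Sizes start above [c], as a closed set that contains [v] also contains the [c] points that [v]
    selects. *)
Definition closed_event (s : {ffun 'I_n -> {set 'I_n}}) : bool :=
  [exists v0 : 'I_n, true && [exists m : 'I_n.+1, (c < m)%N &&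
    [exists B : {set 'I_n}, [&& (#|B| == m) && coded cell A v0 B & minority B] &&
      [forall v in B, s v \subset B]]]].

(** Outside the split event, a component with half of one cell has more than half of each touching
    cell, hence of every cell, since [Mo] is connected. The components of two unconnected points [i]
    and [j] cannot both do so, and one of them is the required minority. *)
Lemma disconnected_event (s : {ffun 'I_n -> {set 'I_n}}) :
  (forall v, s v \subset nb v /\ #|s v| = c) ->
  ~ graph_connected (bluetooth_edge s) -> split_event s || closed_event s.
Proof.
move=> sP; set e := bluetooth_edge s => nconn.
have esym : symmetric e by move=> v w; rewrite /e/bluetooth_edge/= orbC.
have csym := sym_connect_sym esym.
have eA v w : e v w -> A (cell v) (cell w).
  move=> /orP[h|h]; first by apply: nb_A; apply: (fintype.subsetP (sP v).1).
  by rewrite Asym; apply: nb_A; apply: (fintype.subsetP (sP w).1).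
case: (boolP (split_event s)) => //= nsplit.
have [i [j nij]] : exists i j, ~~ connect e i j.
  move: nconn => /existsNP[i] /existsNP[j] /negP h; by exists i, j.
pose comp v := [set w | connect e v w]%SET.
pose maj v q := (#|cls q| <= 2 * occupation cell (comp v) q)%N.
have majP v q q' : maj v q -> Mo q q' ->
  (#|cls q'| < 2 * occupation cell (comp v) q')%N.
  move=> mvq Mqq'; rewrite ltnNge; apply/negP => hq'.
  case/negP: nsplit; apply/existsP; exists (q, q') => /=; apply/existsP.
  exists ([set w in comp v | cell w == q],
    [set w in cls q' | w \notin comp v])%SET => /=.
  apply/andP; split.
    apply/and5P; split=> //.
    - by apply/fintype.subsetP => w; rewrite !inE => /andP[].
    - by apply/fintype.subsetP => w; rewrite !inE => /andP[].
    - apply/pred0P => w /=; rewrite !inE; by case: (connect e v w); rewrite ?andbF.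
    apply/andP; split; first exact: mvq.
    have : #|cls q'| = (occupation cell (comp v) q' + #|[set w in cls q' | w \notin
      comp v]%SET|)%N.
      rewrite -(cardsID (comp v) (cls q')); congr (_ + _)%N; apply: eq_card => w;
        rewrite !inE//.
        by rewrite andbC.
      by rewrite andbC.
    by move=> hE; move: hq'; rewrite hE !mul2n -!addnn leq_add2l leq_add2r.
  apply/forall_inP => w; rewrite !inE => /andP[vw _]; apply/fintype.subsetP => u uw.
  rewrite !inE negb_and negbK; apply/orP; right; apply: connect_trans vw (connect1 _).
  by rewrite /e/bluetooth_edge/= uw.
have majall v q : maj v q ->
  forall q', (#|cls q'| < 2 * occupation cell (comp v) q')%N.
  move=> mvq q'; have /connectP[p] := Mo_connected q q'.
  (* Along the empty path, reflexivity of [Mo] turns the weak majority in [q] into a strict one. *)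
  elim: p q mvq => /= [|q1 p IH] q mvq; first by move=> _ ->; apply: majP (Mo_refl _).
  by move=> /andP[Mq pq]; apply: IH => //; apply/ltnW/(majP v q).
have [v0 v0m] : exists v0, forall q, (2 * occupation cell (comp v0) q < #|cls q|)%N.
  case: (pselect (exists q, maj i q)) => [[q mi]|/forallNP h]; last first.
    by exists i => q; rewrite ltnNge; apply/negP; exact: h.
  case: (pselect (exists q, maj j q)) => [[q' mj]|/forallNP h]; last first.
    by exists j => q1; rewrite ltnNge; apply/negP; exact: h.
  have hi := majall _ _ mi q; have hj := majall _ _ mj q.
  have : (occupation cell (comp i) q + occupation cell (comp j) q <= #|cls q|)%N.
    rewrite -cardsUI (_ : _ :&: _ = set0)%SET ?cards0 ?addn0.
      by apply/subset_leq_card/fintype.subsetP => w; rewrite !inE => /orP[|] /andP[].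
    apply/setP => w; rewrite !inE;
      apply/negbTE/negP => /andP[/andP[iw _] /andP[jw _]].
    by case/negP: nij; apply: connect_trans iw _; rewrite csym.
  by move: hi hj; lia.
apply/existsP; exists v0 => /=; apply/existsP.
have cn : (#|comp v0| < n.+1)%N by rewrite ltnS -[leqRHS]card_ord max_card.
have closed v : v \in comp v0 -> s v \subset comp v0.
  rewrite inE => v0v; apply/fintype.subsetP => w wv; rewrite inE.
  by apply: connect_trans v0v (connect1 _); rewrite /e/bluetooth_edge/= wv.
have v0c : v0 \in comp v0 by rewrite inE connect0.
have cm : (c < #|comp v0|)%N.
  rewrite -(sP v0).2; apply: proper_card; apply/properP; split; first exact: closed.
  by exists v0 => //; apply: contra (nb_irr v0); apply: (fintype.subsetP (sP v0).1).
exists (Ordinal cn); rewrite /= cm /=; apply/existsP; exists (comp v0);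
  rewrite eqxx /=.
apply/andP; split; last by apply/forall_inP.
apply/andP; split; last by apply/forallP.
have kc : (#|comp v0|.-1 < #|comp v0|)%N by rewrite prednK// (leq_trans _ cm).
(* With [k + 1] the size of the component, the coded set is the whole component. *)
have [Bk [t [BC cB _ [st pt] [_ ot]]]] := component_code Asym eA kc.
have BE : Bk = comp v0.
  apply/eqP; rewrite eqEcard BC/= cB prednK// (leq_trans _ cm)//.
rewrite BE in ot.
have st' : size t == (#|comp v0|.-1).*2 by rewrite st.
apply/existsP; exists (Tuple st') => /=; rewrite pt /=.
by apply/forallP => q; rewrite ot.
Qed.

Lemma card_nb_le (B : {set 'I_n}) v :
  (#|B :&: nb v| <= nearby A (occupation cell B) (cell v))%N.
Proof.
rewrite -(sum_occupation cell) /nearby [leqRHS]big_mkcond/=; apply: leq_sum => q _.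
case: ifPn => Aq.
  by apply/subset_leq_card/fintype.subsetP => w;
    rewrite !inE => /andP[/andP[-> _] ->].
rewrite leqn0; apply/eqP/eq_card0 => w; rewrite !inE.
apply/negP => /andP[/andP[_ wv] /eqP wq].
by case/negP: Aq; rewrite -wq; exact: nb_A.
Qed.

(** Each of the at least [J] cells touching that of [v] has at least half of its points outside [B],
    and as [v] is in [B] these are all neighbours of [v]. *)
Lemma card_nb_minority (B : {set 'I_n}) v : minority B -> v \in B ->
  (J * Nl <= 2 * #|nb v :\: B|)%N.
Proof.
move=> /forallP mB vB.
apply: (@leq_trans (\sum_(q | Mo (cell v) q) Nl)%N).
  rewrite sum_nat_const leq_mul2r; apply/orP; right;
    apply: leq_trans (MoJ (cell v)) _.
  by rewrite cardsE.
rewrite -(sum_occupation cell) big_distrr/= [leqLHS]big_mkcond/=;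
  apply: leq_sum => q _.
case: ifPn => // Mq; apply: (@leq_trans #|cls q|); first by case/andP: (cellN q).
have := mB q; rewrite /occupation.
have -> : #|cls q| = (#|[set w in B | cell w == q]%SET| + #|cls q :\: B|)%N.
  by rewrite -(cardsID B (cls q)); congr (_ + _)%N; apply: eq_card => w;
    rewrite !inE andbC.
have : (#|cls q :\: B| <= #|[set w in nb v :\: B | cell w == q]%SET|)%N.
  apply/subset_leq_card/fintype.subsetP => w; rewrite !inE => /andP[wB /eqP wq].
  rewrite wB wq eqxx /= andbT; apply: Mo_nb; first by rewrite wq.
  by apply: contra wB => /eqP ->.
by rewrite !mul2n -!addnn; move: #|_| #|_| #|_| => *; lia.
Qed.

(** One of the [c] factors becomes the weight in [sum_coded]; the others are bounded by [rho], left
    free because large and small sets call for different bounds. *)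
Lemma sum_closed (v0 : 'I_n) (m : nat) (rho : R) : 0 <= rho ->
  (forall (B : {set 'I_n}) v, minority B -> #|B| = m -> v \in B ->
     #|B :&: nb v|%:R / #|nb v|%:R <= rho) ->
  \sum_(B : {set 'I_n} | [&& (#|B| == m) && coded cell A v0 B & minority B])
     \prod_(v in B) (#|B :&: nb v|%:R / #|nb v|%:R) ^+ c <=
  (4 * expR 1 * K%:R ^+ 3 * N%:R / D%:R * rho ^+ c.-1) ^+ m :> R.
Proof.
move=> rho0 hrho; have cellN' q : (#|[set v | cell v == q]| <= N)%N by case/andP:
  (cellN q).
rewrite exprMn; apply: le_trans (ler_wpM2r _ (sum_coded R Asym AK cellN' K0 D0 v0
  m)); last first.
  by rewrite exprn_ge0// exprn_ge0.
rewrite mulr_suml [leRHS]big_mkcond [leLHS]big_mkcond/=; apply: ler_sum => B _.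
have p0 : 0 <= \prod_(v in B) ((nearby A (occupation cell B) (cell v))%:R / D%:R) *
    (rho ^+ c.-1) ^+ m.
  apply: mulr_ge0; last by rewrite exprn_ge0// exprn_ge0.
  by apply: prodr_ge0 => v _; rewrite divr_ge0.
case: ifPn => [/andP[h mB]|_]; last by case: ifP.
rewrite h; case/andP: h => /eqP Bm _; rewrite -Bm -prodr_const -big_split/=.
apply: ler_prod => v vB; rewrite exprn_ge0 ?divr_ge0//=.
rewrite -{1}(prednK c0) exprS; apply: ler_pM; rewrite ?exprn_ge0 ?divr_ge0//.
  have dv : (0 : R) < #|nb v|%:R by rewrite ltr0n; apply: leq_trans c0 (deg_ge v).
  apply: (@le_trans _ _ (#|B :&: nb v|%:R / D%:R)).
    rewrite ler_wpM2l// lef_pV2 ?posrE// ?ltr0n// ler_nat; by case/andP: (degD v).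
  by rewrite ler_wpM2r ?invr_ge0// ler_nat card_nb_le.
by apply: lerXn2r; rewrite ?nnegrE ?divr_ge0// hrho.
Qed.

Lemma ratio_minority (B : {set 'I_n}) v : minority B -> v \in B ->
  #|B :&: nb v|%:R / #|nb v|%:R <= expR (- (J%:R * Nl%:R / (2 * Dm%:R))) :> R.
Proof.
move=> mB vB; have h := card_nb_minority mB vB.
have dv : (0 : R) < #|nb v|%:R by rewrite ltr0n; apply: leq_trans c0 (deg_ge v).
have Dmp : (0 : R) < Dm%:R by rewrite ltr0n (Dm0 v).
apply: le_trans (expR_ge1Dx _).
have -> : #|B :&: nb v|%:R = #|nb v|%:R - #|nb v :\: B|%:R :> R.
  rewrite -[in X in _ = X - _](cardsID B (nb v)) natrD addrK.
  by rewrite finset.setIC.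
rewrite mulrBl divff ?gt_eqF// lerD2l lerN2.
apply: (@le_trans _ _ (#|nb v :\: B|%:R / Dm%:R)).
  rewrite ler_pdivrMr ?mulr_gt0//.
  have -> : #|nb v :\: B|%:R / Dm%:R * (2 * Dm%:R) = (2 * #|nb v :\: B|)%:R :> R.
    by rewrite natrM; field; rewrite gt_eqF.
  by rewrite -natrM ler_nat.
rewrite ler_wpM2l// lef_pV2 ?posrE// ler_nat; by case/andP: (degD v).
Qed.

Lemma sum_geometric_le (z : R) (k l : nat) : 0 <= z <= 2^-1 ->
  \sum_(m < l | (k <= m)%N) z ^+ m <= 2 * z ^+ k.
Proof.
(* The subtracted tail makes the induction on [l] go through; the maximum covers [l < k], where the
   sum is empty. *)
move=> /andP[z0 z1]; suff : \sum_(m < l | (k <= m)%N) z ^+ m <= 2 * z ^+ k - 2 * z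
  ^+ (maxn k l).
  by move/le_trans; apply; rewrite gerBl mulr_ge0 ?exprn_ge0.
elim: l => [|l IH]; first by rewrite big_ord0 maxn0 subrr.
rewrite big_mkcond big_ord_recr /= -big_mkcond /=.
case: (leqP k l) => kl; last first.
  by rewrite addr0; apply: le_trans IH _;
    rewrite (maxn_idPl (ltnW kl)) (maxn_idPl kl).
move: IH; rewrite (maxn_idPr kl) (maxn_idPr (leqW kl)) => IH.
apply: le_trans (lerD IH (lexx _)) _.
have zl : 0 <= z ^+ l by rewrite exprn_ge0.
have : z ^+ l.+1 <= 2^-1 * z ^+ l by rewrite exprS ler_wpM2r.
by move: (z ^+ l) (z ^+ l.+1) (z ^+ k) zl => a b e *; lra.
Qed.

(** [L] separates two regimes. For [|B| <= L] the ratios are at most [L / D], and the sizes from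
    [c + 1] on give [2 Z ^ (c + 1)]; for [|B| > L] minority makes the contribution of each size [m]
    at most [2 ^ (- m)], and these sum to at most [2 ^ (- L)]. The factor [n] counts the starting
    points [v0]. *)
Lemma prob_closed (L : nat) (C := 4 * expR 1 * K%:R ^+ 3 : R)
    (Z := C * (L%:R / D%:R) ^+ c.-1) :
  (N <= D)%N ->
  C * expR (- (J%:R * Nl%:R / (2 * Dm%:R))) ^+ c.-1 <= 2^-1 ->
  Z <= 2^-1 ->
  selection_prob R c nb closed_event <= n%:R * (2 * Z ^+ c.+1 + 2^-1 ^+ L).
Proof.
move=> ND hC hZ.
have C0 : 0 <= C by rewrite !mulr_ge0 ?exprn_ge0// expR_ge0.
have Z0 : 0 <= Z by rewrite mulr_ge0// exprn_ge0// divr_ge0.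
have ND1 : N%:R / D%:R <= 1 :> R by rewrite ler_pdivrMr ?ltr0n// mul1r ler_nat.
have ND0 : 0 <= N%:R / D%:R :> R by rewrite divr_ge0.
apply: (le_trans (selection_prob_union R c nb xpredT (fun v0 s =>
  [exists m : 'I_n.+1, (c < m)%N &&
    [exists B : {set 'I_n}, [&& (#|B| == m) && coded cell A v0 B & minority B] &&
      [forall v in B, s v \subset B]]]))).
apply: (@le_trans _ _ (\sum_(v0 < n) (2 * Z ^+ c.+1 + 2^-1 ^+ L))); last first.
  by rewrite sumr_const card_ord -[leLHS]mulr_natl.
apply: ler_sum => v0 _.
apply: (le_trans (selection_prob_union R c nb (fun m : 'I_n.+1 =>
  (c < m)%N) (fun m s =>
    [exists B : {set 'I_n}, [&& (#|B| == m) && coded cell A v0 B & minority B] &&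
      [forall v in B, s v \subset B]]))).
apply: (@le_trans _ _ (\sum_(m < n.+1 | (c < m)%N) Z ^+ m + \sum_(m < n.+1 | (L <
  m)%N) 2^-1 ^+ m)); last first.
  apply: lerD; apply: (le_trans (sum_geometric_le _ _ _)).
  - by rewrite Z0 hZ.
  - exact: lexx.
  - by rewrite invr_ge0 ler0n lexx.
  - by rewrite exprS mulrA divff ?mul1r// pnatr_eq0.
rewrite [in X in _ <= _ + X]big_mkcond [in X in _ <= X + _]big_mkcond -big_split/=
  big_mkcond/=.
apply: ler_sum => m _.
have h0 : (0 : R) <= 2^-1 ^+ m by rewrite exprn_ge0// invr_ge0.
have Zm0 : 0 <= Z ^+ m by rewrite exprn_ge0.
case: ifPn => cm; last by rewrite add0r; case: ifP.
apply: (@le_trans _ _ (\sum_(B : {set 'I_n} | [&& (#|B| == m) && coded cell A v0 B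
  & minority B])
     \prod_(v in B) (#|B :&: nb v|%:R / #|nb v|%:R) ^+ c)).
  apply: (le_trans (selection_prob_union R c nb
    (fun B : {set 'I_n} => [&& (#|B| == m) && coded cell A v0 B & minority B])
    (fun B s => [forall v in B, s v \subset B]))).
  apply: ler_sum => B _; exact: (selection_prob_closed R deg_ge B (fun=> B)).
have wk (rho : R) : 0 <= rho ->
    (4 * expR 1 * K%:R ^+ 3 * N%:R / D%:R * rho ^+ c.-1) ^+ m <= (C * rho ^+ c.-1)
      ^+ m.
  move=> rho0; have r0 : 0 <= rho ^+ c.-1 by rewrite exprn_ge0.
  apply: lerXn2r; rewrite ?nnegrE;
    [by rewrite -mulrA !mulr_ge0| by rewrite mulr_ge0|].
  by rewrite ler_wpM2r// -mulrA -/C -[leRHS]mulr1 ler_wpM2l.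
case: ifPn => Lm.
  apply: (@le_trans _ _ (2^-1 ^+ m)); last by rewrite lerDr.
  apply: le_trans (sum_closed (rho := expR (- (J%:R * Nl%:R / (2 * Dm%:R)))) _ _ _) _.
  - exact: expR_ge0.
  - by move=> B v mB _ vB; exact: ratio_minority.
  apply: le_trans (wk _ (expR_ge0 _)) _; apply: lerXn2r => //;
    rewrite ?nnegrE ?invr_ge0//.
  by rewrite mulr_ge0// exprn_ge0// expR_ge0.
rewrite addr0; apply: le_trans (sum_closed (rho := L%:R / D%:R) _ _ _) _.
- by rewrite divr_ge0.
- move=> B v _ Bm vB.
  have dv : (0 : R) < #|nb v|%:R by rewrite ltr0n; apply: leq_trans c0 (deg_ge v).
  apply: (@le_trans _ _ (L%:R / #|nb v|%:R)).
    rewrite ler_wpM2r ?invr_ge0// ler_nat;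
      apply: leq_trans (subset_leq_card (subsetIl _ _)) _.
    by rewrite Bm leqNgt.
  rewrite ler_wpM2l// lef_pV2 ?posrE// ?ltr0n// ler_nat; by case/andP: (degD v).
by apply: wk; rewrite divr_ge0.
Qed.

Theorem prob_disconnected (L : nat) (C := 4 * expR 1 * K%:R ^+ 3 : R)
    (Z := C * (L%:R / D%:R) ^+ c.-1) :
  (N <= D)%N ->
  C * expR (- (J%:R * Nl%:R / (2 * Dm%:R))) ^+ c.-1 <= 2^-1 ->
  Z <= 2^-1 ->
  selection_prob R c nb (fun s => ~~ `[< graph_connected (bluetooth_edge s) >]) <=
  #|W|%:R ^+ 2 * 4 ^+ N * expR (- (c%:R * Nl%:R ^+ 2 / (4 * Dm%:R))) +
  n%:R * (2 * Z ^+ c.+1 + 2^-1 ^+ L).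
Proof.
move=> ND hC hZ; apply: (@le_trans _ _ (selection_prob R c nb (fun s =>
  split_event s || closed_event s))).
  by apply: selection_prob_le_valid => s vs /asboolPn ns; exact: disconnected_event.
apply: le_trans (selection_prob_or _ _ _ _ _) _.
by apply: lerD; [exact: prob_split | exact: prob_closed].
Qed.

End Disconnection.

(** * Cells of the torus *)

Section Grid.
Import mathcomp.boot.finset.
Variable M' : nat.
Local Notation M := M'.+1.

(** The two truncated differences add up to [|i - j|], and the second alternative is
    [M - |i - j| <= o], the way through the end of the circle. *)
Definition cyclic_near (o : nat) (i j : 'I_M) : bool :=
  ((i - j) + (j - i) <= o)%N || (M <= (i - j) + (j - i) + o)%N.

Lemma cyclic_near_sym o : symmetric (cyclic_near o).
Proof. by move=> i j; rewrite /cyclic_near addnC. Qed.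

Lemma cyclic_near_refl o : reflexive (cyclic_near o).
Proof. by move=> i; rewrite /cyclic_near subnn. Qed.

Lemma card_cyclic_near o i : (#|[set j | cyclic_near o i j]| <= 2 * o + 1)%N.
Proof.
(* Values of [k] up to [o] step forward; the others step back by [k - o], written [M' * (k - o)]
   since [M'] is [-1] modulo [M]. *)
pose h (k : 'I_(2 * o + 1)) : 'I_M :=
  if (k <= o)%N then inord ((i + k) %% M) else inord ((i + M' * (k - o)) %% M).
apply: (@leq_trans #|h @: [set: 'I_(2 * o + 1)]%SET|); last first.
  by apply: leq_trans (leq_imset_card _ _) _; rewrite cardsT card_ord.
apply/subset_leq_card/fintype.subsetP => j; rewrite inE => jn.
suff [k [ko kE]] : exists k, (k < 2 * o + 1)%N /\
    nat_of_ord j = if (k <= o)%N then ((i + k) %% M)%N else ((i + M' * (k - o)) %%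
      M)%N.
  apply/imsetP; exists (Ordinal ko) => //; apply/val_inj => /=.
  rewrite /h /=; case: ifP kE => _ kE; by rewrite inordK ?ltn_mod// kE.
have iM := ltn_ord i; have jM := ltn_ord j.
have back k : (k <= o)%N -> (0 < k)%N -> (j + k = i \/ j + k = i + M)%N ->
    exists k, (k < 2 * o + 1)%N /\
    nat_of_ord j = if (k <= o)%N then ((i + k) %% M)%N else ((i + M' * (k - o)) %%
      M)%N.
  move=> ko k0 jk; exists (o + k)%N; split; first lia.
  rewrite ifF; last by apply/negbTE; lia.
  have -> : (o + k - o = k)%N by lia.
  case: jk => jk.
    have -> : (i + M' * k = k * M + j)%N by rewrite -jk; lia.
    by rewrite modnMDl modn_small.
  have -> : (i + M' * k = k.-1 * M + j)%N.
    have : (i + M + M' * k = k * M + j)%N by rewrite -jk; lia.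
    by case: k k0 {ko jk} => // k _; rewrite /= mulSn; lia.
  by rewrite modnMDl modn_small.
have forth k : (k <= o)%N -> (i + k = j \/ i + k = j + M)%N ->
    exists k, (k < 2 * o + 1)%N /\
    nat_of_ord j = if (k <= o)%N then ((i + k) %% M)%N else ((i + M' * (k - o)) %%
      M)%N.
  move=> ko jk; exists k; split; first lia.
  by rewrite ko; case: jk => ->; rewrite ?modnDr modn_small.
move: jn; rewrite /cyclic_near; case: (ltngtP i j) => ij /orP[hn|hn].
- by apply: (forth (j - i)%N); lia.
- by apply: (back (M - (j - i))%N); lia.
- by apply: (back (i - j)%N); lia.
- by apply: (forth (M - (i - j))%N); lia.
- by apply: (forth 0%N); lia.
- by apply: (forth 0%N); lia.
Qed.

(** At least three cells on the circle make [i] and its two neighbours distinct. *)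
Lemma card_cyclic_near1 i : (2 <= M')%N -> (3 <= #|[set j | cyclic_near 1 i j]|)%N.
Proof.
move=> M2; have iM := ltn_ord i.
pose v1 := (if i < M' then i.+1 else 0)%N.
pose v2 := (if i == 0 :> nat then M' else i.-1)%N.
have v1M : (v1 < M)%N by rewrite /v1; case: ifP; lia.
have v2M : (v2 < M)%N by rewrite /v2; case: ifP; lia.
pose j1 := Ordinal v1M; pose j2 := Ordinal v2M.
have us : uniq [:: i; j1; j2].
  rewrite /= !inE !negb_or -!val_eqE andbT -andbA.
  apply/and3P; split; rewrite /= /v1 /v2.
  - by case: ifP; lia.
  - by case: ifP; lia.
  - by case: ifP; case: ifP; lia.
rewrite -[X in (X <= _)%N]/(size [:: i; j1; j2]) -(card_uniqP us).
apply/subset_leq_card/fintype.subsetP => j; rewrite !inE => /or3P[]/eqP ->.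
- exact: cyclic_near_refl.
- rewrite /cyclic_near /= /v1; case: ifP => ?; apply/orP; [left|right]; lia.
- rewrite /cyclic_near /= /v2; case: ifP => ?; apply/orP; [right|left]; lia.
Qed.

Variable d : nat.

Definition grid_near (o : nat) (q q' : {ffun 'I_d -> 'I_M}) : bool :=
  [forall k, cyclic_near o (q k) (q' k)].

Lemma grid_near_sym o : symmetric (grid_near o).
Proof. by move=> q q'; apply: eq_forallb => k; rewrite cyclic_near_sym. Qed.

Lemma grid_near_refl o : reflexive (grid_near o).
Proof. by move=> q; apply/forallP => k; rewrite cyclic_near_refl. Qed.

Lemma card_grid_near o q :
  #|[set q' | grid_near o q q']| = (\prod_(k < d) #|[set j | cyclic_near o (q k)
    j]|)%N.
Proof.
transitivity (\sum_(q' in family (fun k =>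
  [pred j | cyclic_near o (q k) j])) \prod_(k < d) 1)%N.
  by rewrite big1_eq sum1_card; apply: eq_card => q'; rewrite inE.
rewrite -(bigA_distr_big_dep _ (fun _ _ => 1%N)); apply: eq_bigr => k _.
by rewrite sum1_card; apply: eq_card => j; rewrite !inE.
Qed.

Lemma card_grid_near_le o q : (#|[set q' | grid_near o q q']| <= (2 * o + 1) ^ d)%N.
Proof.
rewrite card_grid_near -[X in (_ ^ X)%N](card_ord d) -prod_nat_const.
by apply: leq_prod => k _; exact: card_cyclic_near.
Qed.

Lemma card_grid_near1_ge q : (2 <= M')%N ->
  (3 ^ d <= #|[set q' | grid_near 1 q q']|)%N.
Proof.
move=> M2; rewrite card_grid_near -[X in (_ ^ X)%N](card_ord d) -prod_nat_const.
by apply: leq_prod => k _; exact: card_cyclic_near1.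
Qed.

(** Every coordinate moves one step towards its target at once, as diagonal moves are allowed, and
    the sum of the coordinate distances drops. *)
Lemma grid_near1_connected q q' : connect (grid_near 1) q q'.
Proof.
have [m] := ubnP (\sum_(k < d) ((q k - q' k) + (q' k - q k)))%N.
elim: m q => // m IH q; rewrite ltnS => hm.
pose stp (i j : nat) : nat := if (i < j)%N then i.+1 else if (j < i)%N then i.-1
  else i.
have stpM (i j : 'I_M) : (stp i j < M)%N.
  by rewrite /stp; have := ltn_ord i; have := ltn_ord j; case: ifP => ?;
    last case: ifP; lia.
pose q1 : {ffun 'I_d -> 'I_M} := [ffun k => Ordinal (stpM (q k) (q' k))].
have qq1 : grid_near 1 q q1.
  apply/forallP => k; rewrite ffunE /cyclic_near /= /stp; apply/orP; left.
  by case: ifP => ?; last case: ifP; lia.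
have [qe|[k0 k0P]] : q = q' \/ exists k, q k != q' k.
  case: (boolP [exists k, q k != q' k]) => [/existsP|]; first by right.
  rewrite negb_exists => /forallP h; left; apply/ffunP => k; apply/eqP.
  by have := h k; rewrite negbK.
  by rewrite qe.
apply: connect_trans (connect1 qq1) _; apply: IH; apply: leq_trans hm.
have le1 k : ((q1 k - q' k) + (q' k - q1 k) <= (q k - q' k) + (q' k - q k))%N.
  by rewrite ffunE /= /stp; case: ifP => ?; last case: ifP; lia.
rewrite (bigD1 k0)//= [X in (_ < X)%N](bigD1 k0)//= -addSn; apply: leq_add;
  last first.
  by apply: leq_sum => k _.
rewrite ffunE /= /stp; move: k0P; rewrite -val_eqE /=.
by case: ifP => ?; last case: ifP; lia.
Qed.

Variable R : realType.
Implicit Types (a b : R).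

Definition torus_coord a b : R := Num.min `|a - b| (1 - `|a - b|).

(** The minimum puts the end point [a = 1] into the last cell. *)
Definition grid_index a : 'I_M := inord (minn (Num.truncn (M%:R * a)) M').

Lemma grid_index_bounds a : 0 <= a <= 1 ->
  (grid_index a)%:R <= M%:R * a <= (grid_index a)%:R + 1.
Proof.
move=> /andP[a0 a1]; have Ma : 0 <= M%:R * a by rewrite mulr_ge0.
rewrite /grid_index inordK; last by rewrite ltnS geq_minr.
have /andP[t1 t2] := truncn_itv Ma.
case: (leqP (Num.truncn (M%:R * a)) M') => h.
  by rewrite t1 natr1 ltW.
rewrite natr1; apply/andP; split; last by rewrite ler_piMr.
by apply: le_trans t1; rewrite ler_nat ltnW.
Qed.

Lemma torus_coord_ge0 a b : 0 <= a <= 1 -> 0 <= b <= 1 -> 0 <= torus_coord a b.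
Proof.
move=> /andP[a0 a1] /andP[b0 b1];
  rewrite /torus_coord le_min normr_ge0 subr_ge0 ler_norml.
by apply/andP; split; lra.
Qed.

Lemma torus_coord_le a b : 0 <= a <= 1 -> 0 <= b <= 1 ->
  cyclic_near 1 (grid_index a) (grid_index b) -> torus_coord a b <= 2 / M%:R.
Proof.
move=> ha hb; have := grid_index_bounds ha; have := grid_index_bounds hb.
move: (grid_index a) (grid_index b) => i j.
have M0 : (0 : R) < M%:R by rewrite ltr0n.
move=> /andP[b1 b2] /andP[a1 a2].
have iM : (i%:R : R) + 1 <= M%:R by rewrite natr1 ler_nat.
have jM : (j%:R : R) + 1 <= M%:R by rewrite natr1 ler_nat.
rewrite /torus_coord ge_min => /orP[h|h]; apply/orP; [left|right].
  rewrite ler_pdivlMr// mulrC -[X in X * _](gtr0_norm M0) -normrM ler_norml.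
  have h1 : (i%:R : R) <= j%:R + 1 by rewrite natr1 ler_nat; move: h; clear; lia.
  have h2 : (j%:R : R) <= i%:R + 1 by rewrite natr1 ler_nat; move: h; clear; lia.
  by rewrite mulrBr; apply/andP; split; lra.
have [h1|h1] : (M%:R : R) <= i%:R - j%:R + 1 \/ (M%:R : R) <= j%:R - i%:R + 1.
  have [ij|ij] : (M + j <= i + 1 \/ M + i <= j + 1)%N by move: h; clear; lia.
    by left; rewrite addrAC lerBrDr natr1 -natrD ler_nat; move: ij; clear; lia.
  by right; rewrite addrAC lerBrDr natr1 -natrD ler_nat; move: ij; clear; lia.
  rewrite ler_pdivlMr// mulrBl mul1r lerBlDr -lerBlDl.
  apply: (@le_trans _ _ ((a - b) * M%:R)); last by rewrite ler_wpM2r// ler_norm.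
  by rewrite mulrBl ![_ * M%:R]mulrC; lra.
rewrite ler_pdivlMr// mulrBl mul1r lerBlDr -lerBlDl distrC.
apply: (@le_trans _ _ ((b - a) * M%:R)); last by rewrite ler_wpM2r// ler_norm.
by rewrite mulrBl ![_ * M%:R]mulrC; lra.
Qed.

(** Along one of the two arcs the indices differ by at most [M rho + 1], which is less than [o + 1],
    hence by at most [o]. *)
Lemma torus_coord_near a b (rho : R) (o : nat) : 0 <= a <= 1 -> 0 <= b <= 1 ->
  torus_coord a b <= rho -> M%:R * rho < o%:R ->
  cyclic_near o (grid_index a) (grid_index b).
Proof.
move=> ha hb; have := grid_index_bounds ha; have := grid_index_bounds hb.
move: (grid_index a) (grid_index b) => i j /andP[b1 b2] /andP[a1 a2] hab hM.
have M0 : (0 : R) < M%:R by rewrite ltr0n.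
have natlt (k l : nat) : (k%:R : R) < l%:R + 1 -> (k <= l)%N.
  by rewrite natr1 ltr_nat ltnS.
move: hab; rewrite /torus_coord ge_min /cyclic_near => /orP[|] h; apply/orP;
  [left|right].
  have : M%:R * `|a - b| < o%:R by apply: le_lt_trans hM; rewrite ler_wpM2l// ltW.
  rewrite -[X in X * _](gtr0_norm M0) -normrM ltr_norml mulrBr => /andP[h1 h2].
  have : (i <= j + o)%N by apply: natlt; rewrite natrD; lra.
  have : (j <= i + o)%N by apply: natlt; rewrite natrD; lra.
  by clear; lia.
have : M%:R - M%:R * `|a - b| < o%:R.
  by apply: le_lt_trans hM; rewrite -{1}[M%:R]mulr1 -mulrBr ler_wpM2l// ltW.
case: (ger0P (a - b)) => ab.
  rewrite mulrBr => h1.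
  have : (M + j <= i + o)%N by apply: natlt; rewrite !natrD; lra.
  by clear; lia.
rewrite opprB mulrBr => h1.
have : (M + i <= j + o)%N by apply: natlt; rewrite !natrD; lra.
by clear; lia.
Qed.

Definition grid_cell (x : d.-tuple R) : {ffun 'I_d -> 'I_M} :=
  [ffun k => grid_index (tnth x k)].

Lemma torus_dist_grid_near1 (x y : d.-tuple R) (r : R) :
  unit_cube x -> unit_cube y -> 2 * Num.sqrt d%:R <= M%:R * r ->
  grid_near 1 (grid_cell x) (grid_cell y) -> torus_dist x y <= r.
Proof.
move=> hx hy hr /forallP near.
have M0 : (0 : R) < M%:R by rewrite ltr0n.
apply: (@le_trans _ _ (2 * Num.sqrt d%:R / M%:R));
  last by rewrite ler_pdivrMr// (mulrC r).
rewrite /torus_dist; apply: (@le_trans _ _ (Num.sqrt (d%:R * (2 / M%:R) ^+ 2))).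
  rewrite ler_wsqrtr// -[X in _ <= X%:R * _](card_ord d) mulr_natl -sumr_const.
  apply: ler_sum => k _; have := near k; rewrite !ffunE => /torus_coord_le h.
  by apply: lerXn2r; rewrite ?nnegrE ?divr_ge0//; [exact: torus_coord_ge0|exact: h].
by rewrite sqrtrM// sqrtr_sqr ger0_norm ?divr_ge0// mulrA [X in X / _]mulrC.
Qed.

Lemma torus_dist_grid_near (x y : d.-tuple R) (r : R) (o : nat) : 0 <= r ->
  unit_cube x -> unit_cube y -> M%:R * r < o%:R ->
  torus_dist x y <= r -> grid_near o (grid_cell x) (grid_cell y).
Proof.
move=> r0 hx hy hr hd; apply/forallP => k; rewrite !ffunE.
apply: (torus_coord_near (hx k) (hy k) _ hr); apply: le_trans hd.
have c0 j : 0 <= torus_coord (tnth x j) (tnth y j) by exact: torus_coord_ge0.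
rewrite -[X in X <= _](ger0_norm (c0 k)) -sqrtr_sqr ler_wsqrtr//.
rewrite (bigD1 k)//= lerDl sumr_ge0// => j _; exact: sqr_ge0.
Qed.

End Grid.

(** * Volumes *)

Section Affine.
Local Open Scope ereal_scope.
Variable R : realType.
Local Notation mu := (@lebesgue_measure R).

(* Unlike [ge0_le_integral], no measurability is needed: the integral of a
   nonnegative function is a supremum over the simple functions below it. *)
Lemma le_integral_nonneg d (T : measurableType d) (m : {measure set T -> \bar R})
    (f g : T -> \bar R) :
  (forall x, 0 <= f x) -> (forall x, f x <= g x) ->
  \int[m]_x f x <= \int[m]_x g x.
Proof.
move=> f0 fg; have g0 x : 0 <= g x by exact: le_trans (fg x).
rewrite !ge0_integralTE//; apply: ereal_sup_le => y [h /= hf <-].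
by exists h => //= x; exact: le_trans (fg x).
Qed.

(** [rho] times the image of [mu] under [x -> rho * x + a] agrees with [mu] on half-open intervals,
    hence on all measurable sets. *)
Lemma ge0_integral_affine (f : R -> \bar R) (rho a : R) : (0 < rho)%R ->
  measurable_fun setT f -> (forall x, 0 <= f x) ->
  \int[mu]_x f x = rho%:E * \int[mu]_x f (rho * x + a)%R.
Proof.
move=> rho0 mf f0.
pose phi (x : R) : measurableTypeR R := (rho * x + a)%R.
have mphi : measurable_fun [set: measurableTypeR R] (phi : measurableTypeR R ->
  measurableTypeR R).
  by apply: continuous_measurable_fun => x; apply: cvgD; [apply: cvgMr;
    exact: cvg_id|exact: cvg_cst].
have [pf pfE] : exists m : {measure set (measurableTypeR R) -> \bar R},
    m = pushforward mu phi :> (set (measurableTypeR R) -> \bar R).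
  by unshelve refine (ex_intro _ (pushforward mu phi : {measure set
    (measurableTypeR R) -> \bar R}) _).
pose nu := mscale (NngNum (ltW rho0)) pf.
have E : forall A, measurable A -> mu A = nu A.
  apply: lebesgue_measure_unique => X /ocitvP[->|[[u v] /= uv ->]].
    by rewrite !measure0.
  rewrite /nu /mscale/= pfE /pushforward.
  have -> : phi @^-1` `]u, v] = [set` `](u - a) / rho, (v - a) / rho]%R].
    apply/seteqP; split => x;
      rewrite /phi /= !in_itv/= ltr_pdivrMr// ler_pdivlMr// ltrBlDr lerBrDr mulrC//.
  rewrite !lebesgue_measure_itv/= !lte_fin uv.
  rewrite ltr_pM2r ?invr_gt0// ltrD2r uv -!EFinB -EFinM; congr (_%:E).
  by field; rewrite gt_eqF.
transitivity (\int[nu]_x f x).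
  by apply: eq_measure_integral => A mA _; exact: E.
rewrite ge0_integral_mscale//; congr (_ * _).
by rewrite pfE ge0_integral_pushforward.
Qed.

End Affine.

Section LebesgueTuple.
Local Open Scope ereal_scope.
Variable R : realType.
Local Notation mu := (@lebesgue_measure R).

Lemma lebesgue_tuple_ge0 d (A : set (d.-tuple R)) : 0 <= lebesgue_tuple A.
Proof.
elim: d A => [|d IH] A /=; first by rewrite diracE lee_fin.
by apply: integral_ge0 => x _; exact: IH.
Qed.

(** Valid for arbitrary sets, thanks to [le_integral_nonneg]; volumes can then be compared without
    measurability of sections. *)
Lemma le_lebesgue_tuple d (A B : set (d.-tuple R)) :
  A `<=` B -> lebesgue_tuple A <= lebesgue_tuple B.
Proof.
elim: d A B => [|d IH] A B AB /=.
  rewrite !diracE lee_fin ler_nat; case: (boolP (_ \in A)) => //= /set_mem /AB h.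
  by rewrite mem_set.
apply: le_integral_nonneg => x; first exact: lebesgue_tuple_ge0.
by apply: IH => t /= /AB.
Qed.

Lemma lebesgue_tuple_set0 d : lebesgue_tuple (set0 : set (d.-tuple R)) = 0.
Proof.
elim: d => [|d IH] /=; first by rewrite dirac0.
by under eq_integral do rewrite (_ : [set t | _] = set0)// IH; rewrite integral0.
Qed.

Lemma forall_tnth_cons d (x : R) (t : d.-tuple R) (P : 'I_d.+1 -> R -> Prop) :
  (forall k, P k (tnth [tuple of x :: t] k)) <->
  P ord0 x /\ forall k, P (lift ord0 k) (tnth t k).
Proof.
split=> [h|[h0 h] k].
  by split=> [|k]; [have := h ord0; rewrite tnth0|have := h (lift ord0 k);
    rewrite tnthS].
by case: (unliftP ord0 k) => [j|] ->; rewrite ?tnth0 ?tnthS.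
Qed.

Lemma lebesgue_tuple_box d (I : 'I_d -> set R) : (forall k, measurable (I k)) ->
  lebesgue_tuple [set t : d.-tuple R | forall k, I k (tnth t k)] =
  \prod_(k < d) mu (I k).
Proof.
elim: d I => [|d IH] I mI.
  rewrite big_ord0 /= diracE mem_set//= => k; by case: k.
rewrite big_ord_recl -IH//.
set B := [set t : d.-tuple R | _] in |- *.
transitivity (\int[mu]_(x in I ord0) cst (lebesgue_tuple B) x); last first.
  by rewrite integral_cst; [exact: muleC|exact: mI].
rewrite [RHS]integral_mkcond /=; apply: eq_integral => x _; rewrite patchE.
case: ifPn => [/set_mem Ix|/negP nIx].
  congr lebesgue_tuple; apply/seteqP; split => t /=.
    by move=> /(forall_tnth_cons _ _ I)[].
  by move=> h; apply/(forall_tnth_cons _ _ I).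
rewrite [X in lebesgue_tuple X](_ : _ = set0) ?lebesgue_tuple_set0//.
rewrite -subset0 => t /= /(forall_tnth_cons _ _ I)[h _]; apply: nIx; exact: mem_set.
Qed.

(** Indexed by the squared radius [s], of any sign, so that sections stay in the family: [s] becomes
    [s - x ^ 2]. *)
Definition ball_measure d (s : R) : \bar R :=
  lebesgue_tuple [set t : d.-tuple R | (\sum_(k < d) tnth t k ^+ 2 <= s)%R].

Lemma ball_measureS d s :
  ball_measure d.+1 s = \int[mu]_x ball_measure d (s - x ^+ 2).
Proof.
rewrite /ball_measure /=; apply: eq_integral => x _; congr lebesgue_tuple.
have E (t : d.-tuple R) : (\sum_(k < d.+1) tnth [tuple of x :: t] k ^+ 2 = x ^+ 2 +
  \sum_(k < d) tnth t k ^+ 2)%R.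
  by rewrite big_ord_recl tnth0; congr (_ + _)%R; apply: eq_bigr => k _;
    rewrite tnthS.
by apply/seteqP; split => t /=; rewrite E lerBrDl.
Qed.

Lemma ball_measure_ge0 d s : 0 <= ball_measure d s.
Proof. exact: lebesgue_tuple_ge0. Qed.

Lemma le_ball_measure d s s' : (s <= s')%R -> ball_measure d s <= ball_measure d s'.
Proof. by move=> ss'; apply: le_lebesgue_tuple => t /= /le_trans; apply. Qed.

Lemma ball_measure_fin_num d s : ball_measure d s \is a fin_num.
Proof.
rewrite ge0_fin_numE ?ball_measure_ge0//.
(* As [m >= 1], this gives [s <= m <= m ^ 2]. *)
pose m := (1 + `|s|)%R.

apply: (@le_lt_trans _ _ (lebesgue_tuple [set t : d.-tuple R | forall k,
  [set` `[(- m)%R, m]] (tnth t k)])).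
  apply: le_lebesgue_tuple => t /= ts k; rewrite /= in_itv/= -ler_norml.
  have m1 : (1 <= m)%R by rewrite lerDl.
  have : (tnth t k ^+ 2 <= m ^+ 2)%R.
    apply: (@le_trans _ _ m); last by rewrite expr2 ler_peMl// (le_trans _ m1).
    apply: (@le_trans _ _ s); last by rewrite (le_trans (ler_norm s))// lerDr.
    apply: le_trans ts; rewrite (bigD1 k)//= lerDl sumr_ge0// => j _; exact: sqr_ge0.
  by rewrite -ler_sqrt ?sqr_ge0// !sqrtr_sqr [X in (_ <= X)%R ->
    _]ger0_norm// (le_trans _ m1).
rewrite (lebesgue_tuple_box (I := fun=> [set` `[(- m)%R, m]]))//.
rewrite ltey_eq; apply/orP; left; elim/big_ind: _ => //=; first exact: fin_numM.
by move=> k _; rewrite lebesgue_measure_itv/= lte_fin; case: ifP.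
Qed.

(** The measure is monotone in the squared radius, hence measurable. *)
Lemma measurable_ball_measure d (g : R -> R) : measurable_fun setT g ->
  measurable_fun setT (fun x => ball_measure d (g x)).
Proof.
move=> mg; rewrite (_ : (fun x => _) = EFin \o ((fun s =>
  fine (ball_measure d s)) \o g)); last first.
  by apply/funext => x /=; rewrite fineK// ball_measure_fin_num.
apply/measurable_EFinP; apply: measurableT_comp mg.
apply: nondecreasing_measurable => // s s' ss'.
by rewrite fine_le ?ball_measure_fin_num// le_ball_measure.
Qed.

(** By sections, the substitution [x -> rho * x] in the first coordinate supplying one factor
    [rho]. *)
Lemma ball_measureZ d (rho s : R) : (0 < rho)%R ->
  ball_measure d (rho ^+ 2 * s) = (rho ^+ d)%:E * ball_measure d s.
Proof.
move=> rho0; elim: d s => [|d IH] s.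
  rewrite mul1e /ball_measure /=; congr (\d_ _ _); apply/seteqP; split => t /=;
  by rewrite !big_ord0 pmulr_rge0// exprn_gt0.
rewrite !ball_measureS (ge0_integral_affine 0 rho0); last 2 first.
- apply: measurable_ball_measure; apply: measurable_funB => //;
  exact: measurable_funX.
- by move=> x; exact: ball_measure_ge0.
rewrite (exprS rho d) EFinM -muleA; congr (_ * _).
rewrite -ge0_integralZl//.
- apply: eq_integral => x _; rewrite -IH; congr ball_measure.
  by rewrite addr0 exprMn mulrBr.
- apply: measurable_ball_measure; apply: measurable_funB => //;
  exact: measurable_funX.
- by move=> x _; exact: ball_measure_ge0.
- by rewrite lee_fin exprn_ge0// ltW.
Qed.

Lemma ball_measure1 d : ball_measure d 1 = (ball_volume R d)%:E.
Proof.
rewrite /ball_volume (_ : [set x | _] = [set t : d.-tuple R | (\sum_(k < d) tnth t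
  k ^+ 2 <= 1)%R]).
  by rewrite fineK// -/(ball_measure d 1) ball_measure_fin_num.
apply/seteqP; split => t /= h; first by rewrite -ler_sqrt// sqrtr1.
by rewrite -sqrtr1 ler_sqrt.
Qed.

Lemma ball_volume_gt0 d : (0 < ball_volume R d)%R.
Proof.
(* The cube [[0, a] ^ d] lies in the ball: [x ^ 2 <= a] for each coordinate, and [d a <= 1]. *)
rewrite -lte_fin -ball_measure1; pose a : R := (d.+1%:R^-1)%R.
have a0 : (0 < a)%R by rewrite invr_gt0.
apply: (@lt_le_trans _ _ (lebesgue_tuple [set t : d.-tuple R | forall k,
  [set` `[0%R, a]] (tnth t k)])).
  rewrite (lebesgue_tuple_box (I := fun=> [set` `[0%R, a]]))// (eq_bigr (fun=> a%:E)).
    by elim/big_ind: _ => // x y x0 y0; exact: mule_gt0.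
  by move=> k _; rewrite lebesgue_measure_itv/= lte_fin a0 sube0.
apply: le_lebesgue_tuple => t /= ts.
apply: (@le_trans _ _ (\sum_(k < d) a)%R).
  apply: ler_sum => k _; have := ts k; rewrite /= in_itv/= => /andP[t0 ta].
  have a1 : (a <= 1)%R by rewrite invf_le1// ler1n.
  by rewrite expr2 -[leRHS]mulr1 ler_pM// (le_trans ta).
by rewrite sumr_const card_ord -[leLHS]mulr_natl ler_pdivrMr// mul1r ler_nat.
Qed.

End LebesgueTuple.

(** * Balls of the torus compared with Euclidean balls *)

Section TorusBall.
Local Open Scope ereal_scope.
Variable R : realType.
Local Notation mu := (@lebesgue_measure R).

Lemma ge0_integral_translation (f : R -> \bar R) (a : R) :
  measurable_fun setT f -> (forall x, 0 <= f x) ->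
  \int[mu]_x f (x + a)%R = \int[mu]_x f x.
Proof.
move=> mf f0; rewrite (ge0_integral_affine a ltr01 mf f0) mul1e.
by apply: eq_integral => x _; rewrite mul1r.
Qed.

Lemma measurable_torus_coord (z : R) : measurable_fun setT (torus_coord z).
Proof.
have m1 : measurable_fun setT (fun x : R => `|z - x|%R).
  by apply: measurableT_comp => //; exact: measurable_funB.
by apply: measurable_minr => //; exact: measurable_funB.
Qed.

(** Up to sign [torus_coord z x] is one of [x - z], [x - z - 1] and [x - z + 1], so by evenness the
    integrand is at most the sum of three values of [f]. For [x] in [[0, 1)] the three arguments
    fall into [D1], [D2] and [D3], which partition the line; after translation the three integrals
    add up to that of [f]. *)
Lemma torus_coord_integral_le (f : R -> \bar R) (z : R) :
  measurable_fun setT f -> (forall x, 0 <= f x) -> (forall x, f (- x)%R = f x) ->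
  (0 <= z <= 1)%R ->
  \int[mu]_(x in `[0%R, 1%R]) f (torus_coord z x) <= \int[mu]_x f x.
Proof.
move=> mf f0 feven /andP[z0 z1].
have mft : measurable_fun setT (fun x => f (torus_coord z x)).
  by apply: measurableT_comp mf _; exact: measurable_torus_coord.
rewrite -integral_itv_bndo_bndc; last exact: measurable_funTS.
rewrite integral_mkcond /=.
pose g (D : set R) := f \_ D.
have mg D : measurable D -> measurable_fun setT (g D).
  by move=> mD; apply/(measurable_restrictT _ mD); exact: measurable_funTS.
have g0 D x : 0 <= g D x by rewrite /g patchE; case: ifP.
pose D1 := [set` `[(- z)%R, (1 - z)%R[]; pose D2 := [set` `]-oo, (- z)%R[].
pose D3 := [set` `[(1 - z)%R, +oo[].
have gt D (a : R) : measurable D -> measurable_fun setT (fun x : R => g D (x + a)%R).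
  move=> mD; apply: (measurableT_comp (mg D mD)); exact: measurable_funD.
have [mD1 mD2 mD3] : [/\ measurable D1, measurable D2 & measurable D3] by split;
  exact: measurable_itv.
pose s x := g D1 (x + (- z))%R + (g D2 (x + (- z - 1))%R + g D3 (x + (1 - z))%R).
apply: (@le_trans _ _ (\int[mu]_x s x)).
  have s0 x : 0 <= s x by rewrite !adde_ge0.
  apply: le_integral_nonneg => x; rewrite patchE; case: ifPn => //.
  rewrite inE /= in_itv/= => /andP[x0 x1].
  have e1 : g D1 (x + (- z))%R = f (x - z)%R.
    by rewrite /g patchE ifT// inE /D1 /= in_itv/=; apply/andP; split; lra.
  have e2 : g D2 (x + (- z - 1))%R = f (x - z - 1)%R.
    by rewrite /g patchE ifT ?addrA// inE /D2 /= in_itv/=; lra.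
  have e3 : g D3 (x + (1 - z))%R = f (x - z + 1)%R.
    rewrite /g patchE ifT; last by rewrite inE /D3 /= in_itv/= andbT; lra.
    by congr f; lra.
  rewrite /s e1 e2 e3 /torus_coord.
  have h1 : f (x - z)%R <= f (x - z)%R + (f (x - z - 1)%R + f (x - z + 1)%R).
    by rewrite leeDl// adde_ge0.
  have h2 : f (x - z - 1)%R <= f (x - z)%R + (f (x - z - 1)%R + f (x - z + 1)%R).
    by rewrite addeCA leeDl// adde_ge0.
  have h3 : f (x - z + 1)%R <= f (x - z)%R + (f (x - z - 1)%R + f (x - z + 1)%R).
    by rewrite addeA leeDr// adde_ge0.
  rewrite minElt; case: ifP => _; case: (ger0P (z - x)) => _.
  - by rewrite -(feven (z - x)%R) opprB.
  - by rewrite opprB.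
  - by rewrite (_ : 1 - (z - x) = x - z + 1)%R//; lra.
  - by rewrite (_ : 1 - - (z - x) = - (x - z - 1))%R ?feven//; lra.
have m1 := gt D1 (- z)%R mD1; have m2 := gt D2 (- z - 1)%R mD2.
have m3 := gt D3 (1 - z)%R mD3; have m23 := emeasurable_funD m2 m3.
have n1 := mg D1 mD1; have n2 := mg D2 mD2; have n3 := mg D3 mD3.
have n23 := emeasurable_funD n2 n3.
have m0 D (a x : R) : [set: R] x -> 0 <= g D (x + a)%R by [].
have n0 D (x : R) : [set: R] x -> 0 <= g D x by [].
have c0 : forall x : R, [set: R] x ->
  0 <= g D2 (x + (- z - 1))%R + g D3 (x + (1 - z))%R.
  by move=> x _; rewrite adde_ge0.
have k0 : forall x : R, [set: R] x -> 0 <= g D2 x + g D3 x.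
  by move=> x _; rewrite adde_ge0.
have -> : \int[mu]_x s x = \int[mu]_x g D1 x + (\int[mu]_x g D2 x + \int[mu]_x g D3
  x).
  rewrite -(ge0_integral_translation (- z) n1)//.
  rewrite -(ge0_integral_translation (- z - 1) n2)//.
  rewrite -(ge0_integral_translation (1 - z) n3)//.
  transitivity (\int[mu]_x g D1 (x + - z)%R + \int[mu]_x (g D2 (x + (- z - 1))%R +
    g D3 (x + (1 - z))%R)).
    exact: (ge0_integralD mu measurableT (m0 D1 _) m1 c0 m23).
  congr (_ + _); exact: (ge0_integralD mu measurableT (m0 D2 _) m2 (m0 D3 _) m3).
have <- : \int[mu]_x (g D1 x + (g D2 x + g D3 x)) = \int[mu]_x g D1 x + (\int[mu]_x
  g D2 x + \int[mu]_x g D3 x).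
  transitivity (\int[mu]_x g D1 x + \int[mu]_x (g D2 x + g D3 x)).
    exact: (ge0_integralD mu measurableT (n0 D1) n1 k0 n23).
  congr (_ + _); exact: (ge0_integralD mu measurableT (n0 D2) n2 (n0 D3) n3).
apply: le_integral_nonneg => x; first by rewrite !adde_ge0.
rewrite /g !patchE /D1 /D2 /D3 !mem_setE /= !in_itv/= andbT.
case: (ltrP x (- z)%R) => h1 /=.
  rewrite (_ : (1 - z <= x)%R = false) ?add0e ?adde0//; apply/negbTE;
    rewrite -ltNge; lra.
case: (ltrP x (1 - z)%R) => h2 /=; first by rewrite !adde0.
by rewrite !add0e.
Qed.

(** The torus is unwrapped one coordinate at a time: the induction bounds the sections, and
    [torus_coord_integral_le] their integral. Large balls overlap themselves, whence only an
    inequality. *)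
Lemma torus_ball_measure_le d (z : d.-tuple R) (s : R) : unit_cube z ->
  lebesgue_tuple ([set y : d.-tuple R |
    (\sum_(k < d) torus_coord (tnth z k) (tnth y k) ^+ 2 <= s)%R] `&` @unit_cube R d)
  <= ball_measure d s.
Proof.
elim: d z s => [|d IH] z s hz.
  by apply: le_lebesgue_tuple => y /= []; rewrite !big_ord0.
case/tupleP: z hz => z0 z hz.
have [hz0 hz'] := (forall_tnth_cons z0 z (fun _ a => is_true (0 <= a <= 1)%R)).1 hz.
rewrite ball_measureS.
pose f (u : R) := ball_measure d (s - u ^+ 2).
have mf : measurable_fun setT f.
  by apply: measurable_ball_measure; apply: measurable_funB => //;
    exact: measurable_funX.
apply: (@le_trans _ _ (\int[mu]_(x in `[0%R, 1%R]) f (torus_coord z0 x))); last first.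
  apply: torus_coord_integral_le => // [x|x]; first exact: ball_measure_ge0.
  by rewrite /f sqrrN.
rewrite [leRHS]integral_mkcond /=; apply: le_integral_nonneg => x.
  exact: lebesgue_tuple_ge0.
rewrite patchE; case: ifPn => [_|/negP hx].
  apply: le_trans (IH z (s - torus_coord z0 x ^+ 2)%R hz').
  apply: le_lebesgue_tuple => t /= [hs hc].
  have [hx ht] := (forall_tnth_cons x t (fun _ a => is_true (0 <= a <= 1)%R)).1 hc.
  split => //; move: hs; rewrite big_ord_recl !tnth0 lerBrDl.
  by congr (is_true (_ + _ <= _)%R); apply: eq_bigr => k _; rewrite !tnthS.
rewrite (_ : [set t | _] = set0) ?lebesgue_tuple_set0//.
rewrite -subset0 => t /= [_ hc]; apply: hx.
have [hx _] := (forall_tnth_cons x t (fun _ a => is_true (0 <= a <= 1)%R)).1 hc.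
by rewrite inE /= in_itv.
Qed.

End TorusBall.

(** * Concentration *)

Section FiniteValued.
Variables (d0 : measure_display) (Om : measurableType d0) (T : finType) (Y : Om -> T).
Hypothesis mY : forall t, measurable [set w | Y w = t].

Lemma finite_valued_setE (Q : pred T) :
  [set w | Q (Y w)] = \big[setU/set0]_(t | Q t) [set w | Y w = t].
Proof.
apply/seteqP; split => [w /= Qw|w].
  by rewrite -bigcup_seq_cond /=; exists (Y w) => //=; rewrite Qw mem_index_enum.
by rewrite -bigcup_seq_cond => -[t /= /andP[_ Qt] yt]; rewrite yt.
Qed.

Lemma measurable_finite_valued (Q : pred T) : measurable [set w | Q (Y w)].
Proof. by rewrite finite_valued_setE; apply: bigsetU_measurable. Qed.

Lemma prob_finite_valued (R : realType) (P : probability Om R) (Q : pred T) :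
  P [set w | Q (Y w)] = (\sum_(t | Q t) P [set w | Y w = t])%E.
Proof.
rewrite finite_valued_setE -big_filter -[in RHS]big_filter.
have : uniq [seq t <- index_enum T | Q t] by rewrite filter_uniq// index_enum_uniq.
elim: [seq _ <- _ | _] => [|t s IH] /=; first by rewrite !big_nil measure0.
move=> /andP[ts us]; rewrite !big_cons measureU//; last 2 first.
- exact: bigsetU_measurable.
- rewrite -subset0 => w [/= wt]; rewrite -bigcup_seq => -[t' /= t's wt'].
  have tt' : t = t' by transitivity (Y w).
  by move: ts; rewrite tt' t's.
by congr (_ + _)%E; exact: IH.
Qed.

End FiniteValued.

Lemma measurable_index_set d0 (T : measurableType d0) n (B : 'I_n ->
  set T) (J : {set 'I_n}) :
  (forall i, measurable (B i)) ->
  measurable [set x | [set i | `[< B i x >]]%SET = J].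
Proof.
move=> mB; have -> : [set x | [set i | `[< B i x >]]%SET = J] =
    \big[setI/setT]_(i < n) (if i \in J then B i else ~` B i).
  apply/seteqP; split => x; rewrite -bigcap_seq /=.
    by move=> <- i _ /=; rewrite inE; case: asboolP.
  move=> h; apply/setP => i; rewrite inE; have := h i (mem_index_enum i) => /=.
  by case: ifP => _ hi; apply/asboolP.
by apply: bigsetI_measurable => i _; case: ifP => _ //; exact: measurableC.
Qed.

Lemma measurable_ffun_fiber d0 (T : measurableType d0) (I S : finType) (f : T ->
  {ffun I -> S}) (g : {ffun I -> S}) :
  (forall i, measurable [set x | f x i = g i]) -> measurable [set x | f x = g].
Proof.
move=> h; have -> : [set x | f x = g] = \big[setI/setT]_(i : I) [set x | f x i = g i].
  apply/seteqP; split => x; rewrite -bigcap_seq /=; first by move=> fx i _ /=;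
    rewrite fx.
  by move=> hx; apply/ffunP => i; apply: hx; exact: mem_index_enum.
by apply: bigsetI_measurable => i _.
Qed.

Lemma prob_exists_le d0 (T : measurableType d0) (R : realType) (P : probability T R)
    (I : finType) (F : I -> set T) (b : R) : (forall i, measurable (F i)) ->
  (forall i, P (F i) <= b%:E)%E ->
  measurable [set x | exists i, F i x] /\
    (P [set x | exists i, F i x] <= (#|I|%:R * b)%:E)%E.
Proof.
move=> mF hF.
have -> : [set x | exists i, F i x] = \big[setU/set0]_(i <- index_enum I) F i.
  apply/seteqP; split => x; rewrite -bigcup_seq /=.
    by move=> [i Fi]; exists i => //=; exact: mem_index_enum.
  by move=> [i _ Fi]; exists i.
split; first exact: bigsetU_measurable.
have -> : #|I| = size (index_enum I) by rewrite cardT enumT.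
elim: (index_enum I) => [|i s IH]; first by rewrite big_nil measure0 mul0r.
rewrite big_cons; apply: (le_trans (measureU2 _ (mF i) _));
  first exact: bigsetU_measurable.
by rewrite /= -add1n natrD mulrDl mul1r EFinD; apply: leeD.
Qed.

Section Chernoff.
Variables (d0 d1 : measure_display) (Om : measurableType d0) (T : measurableType d1).
Variables (R : realType) (P : probability Om R) (n : nat) (X : 'I_n -> {RV P >-> T}).
Hypothesis indep : mutually_independent X.
Variables (A : set T) (p : R).
Hypothesis mA : measurable A.
Hypothesis pA : forall i, P [set w | A (X i w)] = p%:E.

(** The set is kept rather than its size because its law is a plain product, which turns exponential
    moments into finite sums. *)
Definition hits (w : Om) : {set 'I_n} := [set i | `[< A (X i w) >]]%SET.

Lemma measurable_hits (J : {set 'I_n}) : measurable [set w | hits w = J].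
Proof.
apply: (measurable_index_set (B := fun i w => A (X i w))) => i.
by rewrite -[X in measurable X]setTI; apply: (measurable_funP (X i)).
Qed.

Lemma prob_hits (J : {set 'I_n}) :
  P [set w | hits w = J] = (\prod_(i < n) (if i \in J then p else 1 - p))%:E.
Proof.
have := indep [set: 'I_n]%SET (A := fun i => if i \in J then A else ~` A).
have -> : [set w | forall i, i \in [set: 'I_n]%SET ->
  (if i \in J then A else ~` A) (X i w)] =
  [set w | hits w = J].
  apply/seteqP; split => w /=.
    move=> h; apply/setP => i; rewrite inE; have := h i (finset.in_setT _).
    by case: ifP => _ hi; apply/asboolP.
  by move=> <- i _; rewrite inE; case: asboolP.
move=> ->; last by move=> i; case: ifP => _ //; exact: measurableC.
rewrite -prodEFin; apply: eq_big => [i|i _]; first by rewrite finset.in_setT.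
case: ifP => _ //.
have -> : [set w | (~` A) (X i w)] = ~` [set w | A (X i w)] by [].
rewrite probability_setC ?pA//.
by rewrite -[X in measurable X]setTI; apply: (measurable_funP (X i)).
Qed.

(** Markov's inequality for [exp (t |hits|)], whose expectation is [(1 - p + p exp t) ^ n]. The sign
    of [t] selects the tail, so both tails share this proof. *)
Lemma chernoff (t a : R) : t <= 2^-1 ->
  (P [set w | (t * a <= t * #|hits w|%:R)%R] <=
   (expR (n%:R * p * (t + 2 * t ^+ 2) - t * a))%:E)%E.
Proof.
move=> t1.
(* Without indices nothing constrains [p], so this is stated under an index. *)
have p01 (i : 'I_n) : 0 <= p <= 1.
  by rewrite -2!lee_fin -(pA i) probability_le1 ?andbT//
    -[X in measurable X]setTI; apply: (measurable_funP (X i)).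
pose w (J : {set 'I_n}) : R := \prod_(i < n) (if i \in J then p else 1 - p).
have w0 J : 0 <= w J.
  by apply: prodr_ge0 => i _; case/andP: (p01 i) => p0 p1; case: ifP => _ //;
    rewrite subr_ge0.
rewrite (prob_finite_valued measurable_hits P (fun J : {set 'I_n} =>
  t * a <= t * #|J|%:R)).
under eq_bigr do rewrite prob_hits -/(w _).
rewrite sumEFin lee_fin.
apply: (@le_trans _ _ (\sum_(J : {set 'I_n}) expR (- (t * a)) *
    \prod_(i < n) (if i \in J then p * expR t else 1 - p))).
  rewrite big_mkcond/=; apply: ler_sum => J _.
  have -> : expR (- (t * a)) * \prod_(i < n) (if i \in J then p * expR t else 1 - p) =
      expR (t * #|J|%:R - t * a) * w J.
    have e1 : expR (t * #|J|%:R) = \prod_(i < n) (if i \in J then expR t else 1).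
      by rewrite expRM_natr -prodr_const -big_mkcond.
    rewrite expRD e1 [X in _ = X * _]mulrC -mulrA; congr (_ * _).
    by rewrite /w -big_split/=; apply: eq_bigr => i _; case: ifP => _;
      rewrite ?mul1r// mulrC.
  case: ifPn => h; last by rewrite mulr_ge0 ?expR_ge0.
  by apply: ler_peMl => //; rewrite -[leLHS]expR0 ler_expR subr_ge0.
rewrite -mulr_sumr -(bigA_distr _ _ (fun _ : 'I_n => p * expR t) (fun _ => 1 - p)).
rewrite [X in _ <= expR X]addrC expRD; apply: ler_wpM2l; first exact: expR_ge0.
rewrite -mulrA expRM_natl -[X in _ <= _ ^+ X](card_ord n) -prodr_const.
apply: ler_prod => i _; have /andP[p0 p1] := p01 i.
have e0 := expR_ge0 t.
apply/andP; split; first by rewrite addr_ge0 ?mulr_ge0 ?subr_ge0.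
apply: (@le_trans _ _ (1 + p * (t + 2 * t ^+ 2))); last exact: expR_ge1Dx.
have := expR_le_quadratic t1; move: (expR t) (t ^+ 2) => u v h; clear p01.
rewrite /= .
have -> : p * u + (1 - p) = 1 + p * (u - 1) by ring.
by rewrite lerD2l ler_wpM2l//; lra.
Qed.

(** The choice [t = eta / 4] minimises [2 t ^ 2 - eta t], with value [- eta ^ 2 / 8]. An upper bound
    [m] for the mean suits the balls, whose volume is only bounded from above. *)
Lemma chernoff_upper (eta m : R) : 0 <= eta <= 1 -> n%:R * p <= m ->
  (P [set w | ((1 + eta) * m <= #|hits w|%:R)%R] <= (expR (- (eta ^+ 2 / 8 *
    m)))%:E)%E.
Proof.
move=> /andP[e0 e1] npm; have [->|en0] := eqVneq eta 0.
  by rewrite expr0n/= mul0r mul0r oppr0 expR0; apply: probability_le1;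
    exact: (measurable_finite_valued measurable_hits (fun J : {set 'I_n} =>
      (1 + 0) * m <= #|J|%:R)).
have ep : 0 < eta by rewrite lt_neqAle eq_sym en0 e0.
have t1 : eta / 4 <= 2^-1 by lra.
have := chernoff ((1 + eta) * m) t1.
rewrite (_ : [set w | eta / 4 * ((1 + eta) * m) <= eta / 4 * #|hits w|%:R] =
   [set w | (1 + eta) * m <= #|hits w|%:R]); last first.
  by apply/seteqP; split => w /=; rewrite ler_pM2l ?divr_gt0.
move/le_trans; apply; rewrite lee_fin ler_expR.
have : n%:R * p * (eta / 4 + 2 * (eta / 4) ^+ 2) <= m * (eta / 4 + 2 * (eta / 4) ^+
  2).
  by rewrite ler_wpM2r// addr_ge0 ?mulr_ge0 ?divr_ge0 ?sqr_ge0.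
move/(lerB)/(_ (lexx (eta / 4 * ((1 + eta) * m)))).
move/le_trans; apply; rewrite le_eqVlt; apply/orP; left; apply/eqP; by field.
Qed.

Lemma chernoff_lower (eta m : R) : 0 <= eta <= 1 -> n%:R * p = m ->
  (P [set w | (#|hits w|%:R <= (1 - eta) * m)%R] <= (expR (- (eta ^+ 2 / 8 *
    m)))%:E)%E.
Proof.
move=> /andP[e0 e1] npm; have [->|en0] := eqVneq eta 0.
  by rewrite expr0n/= mul0r mul0r oppr0 expR0; apply: probability_le1;
    exact: (measurable_finite_valued measurable_hits (fun J : {set 'I_n} =>
      #|J|%:R <= (1 + 0) * m)).
have ep : 0 < eta by rewrite lt_neqAle eq_sym en0 e0.
have t1 : - (eta / 4) <= 2^-1 by lra.
have := chernoff ((1 - eta) * m) t1.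
rewrite (_ : [set w | - (eta / 4) * ((1 - eta) * m) <= - (eta / 4) * #|hits w|%:R] =
   [set w | #|hits w|%:R <= (1 - eta) * m]); last first.
  by apply/seteqP; split => w /=; rewrite ler_nM2l// oppr_lt0 divr_gt0.
move/le_trans; apply; rewrite lee_fin ler_expR npm.
rewrite le_eqVlt; apply/orP; left; apply/eqP; by field.
Qed.

End Chernoff.

(** * Conditioning on the positions *)

Section Conditioning.
Variables (d0 : measure_display) (Om : measurableType d0) (R : realType).
Variables (P : probability Om R) (d n : nat) (r : R) (c : nat).
Variables (X : 'I_n -> {RV P >-> d.-tuple R}) (S : 'I_n -> Om -> {set 'I_n}).
Hypothesis model : bluetooth_model r c X S.

Definition positions (w : Om) : n.-tuple (d.-tuple R) := [tuple X i w | i < n].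
Definition selections (w : Om) : {ffun 'I_n -> {set 'I_n}} := [ffun i => S i w].

Lemma measurable_positions (B : set (n.-tuple (d.-tuple R))) :
  measurable B -> measurable [set w | B (positions w)].
Proof.
have mp : measurable_fun setT positions.
  apply/measurable_fun_tnthP => i; rewrite (_ : _ \o _ = X i); last first.
    by apply/funext => w; rewrite /= tnth_mktuple.
  exact: measurable_funP.
by move=> mB; rewrite -[X in measurable X]setTI; apply: mp.
Qed.

Lemma measurable_selections s : measurable [set w | selections w = s].
Proof.
have -> : [set w | selections w = s] = \big[setI/setT]_(i < n) [set w | S i w = s i].
  apply/seteqP; split => w; rewrite -bigcap_seq /=.
    by move=> <- i _ /=; rewrite ffunE.
  by move=> h; apply/ffunP => i; rewrite ffunE; apply: h; exact: mem_index_enum.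
by apply: bigsetI_measurable => i _; exact: (selection_measurable model).
Qed.

Variables (T : finType) (Y : n.-tuple (d.-tuple R) -> T).
Variable g : T -> 'I_n -> {set 'I_n}.
Hypothesis mY : forall t, measurable [set x | Y x = t].
Hypothesis Yg : forall x, rgg_neighbors r x = g (Y x).

(** [Y] takes finitely many values and determines the neighbourhoods. On a fibre of [Y] the
    integrand of the selection law is constant, so conditioning on the positions becomes
    elementary. *)
Lemma prob_positions_selections t s :
  P [set w | (Y (positions w), selections w) = (t, s)] =
  (P [set w | Y (positions w) = t] *
   (\prod_(i < n) select_prob R c (g t i) (s i))%:E)%E.
Proof.
have mB := mY t.
rewrite (_ : [set w | _] = [set w | [set x | Y x = t] [tuple X i w | i < n] /\
  forall i, S i w = s i]).
  rewrite (selection_law model)// muleC -integral_cst;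
    last exact: (measurable_positions mB).
  apply: eq_integral => w /set_mem /= Yw; congr EFin; apply: eq_bigr => i _.
  by rewrite Yg Yw.
apply/seteqP; split => w /=.
  by move=> [<- <-]; split => // i; rewrite ffunE.
by move=> [Yw Sw]; congr pair => //; apply/ffunP => i; rewrite ffunE.
Qed.

Lemma prob_selections_le (Q : pred T) (bad : pred {ffun 'I_n ->
  {set 'I_n}}) (err : R) :
  0 <= err ->
  (forall x, Q (Y x) -> selection_prob R c (rgg_neighbors r x) bad <= err) ->
  (P [set w | bad (selections w)] <= P [set w | ~~ Q (Y (positions w))] + err%:E)%E.
Proof.
move=> err0 hQ; pose Z w := (Y (positions w), selections w).
have mYp t : measurable [set w | Y (positions w) = t].
  by apply: (measurable_positions (mY t)).
have mZ u : measurable [set w | Z w = u].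
  case: u => t s; rewrite (_ : [set w | _] = [set w | Y (positions w) = t] `&` [set
    w | selections w = s]).
    by apply: measurableI => //; exact: measurable_selections.
  by apply/seteqP; split => w /=; rewrite /Z; [case=> e1 e2|case=> e1 e2;
    rewrite e1 e2].
have mb : measurable [set w | Q (Y (positions w)) && bad (selections w)].
  exact: (measurable_finite_valued mZ (fun u => Q u.1 && bad u.2)).
have mq : measurable [set w | ~~ Q (Y (positions w))].
  exact: (measurable_finite_valued mYp (fun u => ~~ Q u)).
apply: (@le_trans _ _ (P ([set w | ~~ Q (Y (positions w))] `|` [set w | Q (Y
  (positions w)) && bad (selections w)]))).
  apply: le_measure; rewrite ?inE.
  - exact: (measurable_finite_valued measurable_selections bad).
  - exact: measurableU.
  - by move=> w /= bw; rewrite bw andbT; case: (Q _); [right|left].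
apply: (le_trans (measureU2 _ mq mb)); apply: leeD => //.
apply: (@le_trans _ _ (\sum_(u | Q u.1 && bad u.2) P [set w | Z w = u])%E).
  by rewrite -(prob_finite_valued mZ P (fun u => Q u.1 && bad u.2)).
rewrite (eq_bigr (fun u => P [set w | Z w = (u.1, u.2)])); last by case.
rewrite -(pair_big_dep Q (fun t s => bad s) (fun t s => P [set w | Z w = (t, s)]))/=.
apply: (@le_trans _ _ (\sum_(t | Q t) P [set w | Y (positions w) = t] * err%:E)%E).
  apply: lee_sum => t Qt.
  apply: (@le_trans _ _ (\sum_(s : {ffun 'I_n -> {set 'I_n}} | bad s)
      P [set w | Y (positions w) = t] * (\prod_(i < n) select_prob R c (g t i) (s
        i))%:E)%E).
    by apply: lee_sum => s _; rewrite -prob_positions_selections.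
  rewrite -ge0_sume_distrr; last first.
    by move=> s _; rewrite lee_fin prodr_ge0// => i _; exact: select_prob_ge0.
  (* The bound is available at actual positions only; a fibre that is never attained has probability
     0. *)
  have [[w0 w0t]|nw] := pselect (exists w, Y (positions w) = t); last first.
    rewrite (_ : [set w | _] = set0) ?measure0 ?mul0e//.
    by rewrite -subset0 => w /= Yw; apply: nw; exists w.
  apply: lee_wpmul2l; first exact: measure_ge0.
  rewrite sumEFin lee_fin; have := hQ (positions w0); rewrite w0t => /(_ Qt).
  by rewrite Yg w0t.
rewrite -ge0_sume_distrl//.
rewrite -[leRHS]mul1e; apply: lee_wpmul2r; first by rewrite lee_fin.
have <- := prob_finite_valued mYp P Q.
by apply: probability_le1; exact: (measurable_finite_valued mYp Q).
Qed.

End Conditioning.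

(** * Cells and balls as measurable sets, and their volumes *)

Section Boxes.
Variables (R : realType) (d : nat).

Lemma measurable_box (I : 'I_d -> set R) : (forall k, measurable (I k)) ->
  measurable [set t : d.-tuple R | forall k, I k (tnth t k)].
Proof.
move=> mI; have -> : [set t : d.-tuple R | forall k, I k (tnth t k)] =
    \big[setI/setT]_(k < d) [set t | I k (tnth t k)].
  apply/seteqP; split => t; rewrite -bigcap_seq /= => h k.
    by move=> _; exact: h.
  by apply: h; exact: mem_index_enum.
apply: bigsetI_measurable => k _; rewrite -[X in measurable X]setTI.
exact: (measurable_tnth k).
Qed.

Variable M' : nat.
Local Notation M := M'.+1.

(** The last interval is closed, so that these partition [[0, 1]] in agreement with [grid_index]. *)
Definition cell_itv (j : 'I_M) : set R :=
  if (j < M')%N then [set` `[j%:R / M%:R,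
    j.+1%:R / M%:R[] else [set` `[j%:R / M%:R, 1]].

Lemma measurable_cell_itv j : measurable (cell_itv j).
Proof. by rewrite /cell_itv; case: ifP => _; exact: measurable_itv. Qed.

Lemma cell_itv_sub j a : cell_itv j a -> 0 <= a <= 1.
Proof.
have M0 : (0 : R) < M%:R by rewrite ltr0n.
have j0 : (0 : R) <= j%:R / M%:R by rewrite divr_ge0.
rewrite /cell_itv; case: ifP => jM; rewrite /= in_itv/= => /andP[h1 h2].
  rewrite (le_trans j0 h1) /= ltW// (lt_le_trans h2)// ler_pdivrMr// mul1r ler_nat;
    lia.
by rewrite (le_trans j0 h1).
Qed.

Lemma lebesgue_cell_itv j : lebesgue_measure (cell_itv j) = (M%:R^-1)%:E.
Proof.
have M0 : (0 : R) < M%:R by rewrite ltr0n.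
rewrite /cell_itv; case: ifP => jM; rewrite lebesgue_measure_itv/= lte_fin.
  rewrite ltr_pM2r ?invr_gt0// ltr_nat ltnSn -EFinB -mulrBl -natrB// subSnn mul1r//.
have -> : nat_of_ord j = M' by have := ltn_ord j; lia.
rewrite ltr_pdivrMr// mul1r ltr_nat ltnSn -EFinB; congr EFin.
rewrite -[X in X - _](@divff _ (M%:R : R)) ?gt_eqF// -mulrBl -natrB// subSnn mul1r//.
Qed.

Lemma grid_index_cell_itv a : 0 <= a <= 1 -> cell_itv (grid_index M' a) a.
Proof.
move=> /andP[a0 a1]; have M0 : (0 : R) < M%:R by rewrite ltr0n.
have Ma : 0 <= M%:R * a by rewrite mulr_ge0.
have /andP[t1 t2] := truncn_itv Ma.
have gE : nat_of_ord (grid_index M' a) = minn (Num.truncn (M%:R * a)) M'.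
  by rewrite /grid_index inordK// ltnS geq_minr.
rewrite /cell_itv gE; case: (leqP (Num.truncn (M%:R * a)) M') => h.
  by case: ifP => h'; rewrite /= in_itv/= ler_pdivrMr// (mulrC a) t1 //=
    ltr_pdivlMr// (mulrC a).
rewrite ltnn /= in_itv/= a1 andbT ler_pdivrMr// (mulrC a); apply: le_trans t1.
by rewrite ler_nat ltnW.
Qed.

Lemma cell_itv_inj j j' a : cell_itv j a -> cell_itv j' a -> j = j'.
Proof.
have M0 : (0 : R) < M%:R by rewrite ltr0n.
wlog : j j' / (j <= j')%N => [H|jj'] h h'.
  by case: (leqP j j') => [|/ltnW] /H; [exact|move=> /(_ h' h)].
apply/val_inj/eqP; rewrite eqn_leq jj' leqNgt /=; apply/negP => jlt.
have jM : (j < M')%N by have := ltn_ord j'; move: jlt; clear; lia.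
have : a < j.+1%:R / M%:R by move: h; rewrite /cell_itv jM /= in_itv/= => /andP[].
have : j'%:R / M%:R <= a by move: h'; rewrite /cell_itv; case: ifP => _;
  rewrite /= in_itv/= => /andP[].
move=> h1 h2; have := le_lt_trans h1 h2; rewrite ltr_pM2r ?invr_gt0// ltr_nat.
by move: jlt; clear; lia.
Qed.

Definition cell_box (q : {ffun 'I_d -> 'I_M}) : set (d.-tuple R) :=
  [set x | forall k, cell_itv (q k) (tnth x k)].

Lemma measurable_cell_box q : measurable (cell_box q).
Proof. exact: (measurable_box (fun k => measurable_cell_itv (q k))). Qed.

Lemma lebesgue_cell_box q :
  lebesgue_tuple (cell_box q `&` @unit_cube R d) = ((M%:R ^+ d)^-1)%:E.
Proof.
have -> : cell_box q `&` @unit_cube R d = cell_box q.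
  by apply/setIidPl => x /= h k; exact: cell_itv_sub (h k).
rewrite (lebesgue_tuple_box (fun k => measurable_cell_itv (q k))).
rewrite (eq_bigr (fun=> (M%:R^-1)%:E)); last by move=> k _; exact: lebesgue_cell_itv.
by rewrite prodEFin prodr_const card_ord exprVn.
Qed.

Lemma cell_boxE (x : d.-tuple R) q : unit_cube x ->
  cell_box q x <-> grid_cell M' x = q.
Proof.
move=> hx; split=> [h|<- k]; last by rewrite ffunE; exact: grid_index_cell_itv.
apply/ffunP => k; rewrite ffunE; apply: (@cell_itv_inj _ _ (tnth x k)); last exact: h.
exact: grid_index_cell_itv.
Qed.

Definition torus_ball (z : d.-tuple R) (s : R) : set (d.-tuple R) :=
  [set y | \sum_(k < d) torus_coord (tnth z k) (tnth y k) ^+ 2 <= s].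

Lemma measurable_torus_ball z s : measurable (torus_ball z s).
Proof.
have m : measurable_fun setT (fun y : d.-tuple R =>
  \sum_(k < d) torus_coord (tnth z k) (tnth y k) ^+ 2).
  apply: measurable_sum => k; apply: measurable_funX.
  by apply: (measurableT_comp (measurable_torus_coord (tnth z k)));
    exact: measurable_tnth.
rewrite -[X in measurable X]setTI (_ : _ `&` _ = setT `&` (fun y : d.-tuple R =>
  \sum_(k < d) torus_coord (tnth z k) (tnth y k) ^+ 2) @^-1` [set` `]-oo, s]]).
  by apply: m => //; exact: measurable_itv.
by rewrite !setTI; apply/seteqP; split => y; rewrite /torus_ball /preimage /= ?in_itv.
Qed.

Lemma lebesgue_torus_ball_le z (rho : R) : unit_cube z -> 0 < rho ->
  (lebesgue_tuple (torus_ball z (rho ^+ 2) `&` @unit_cube R d) <=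
   (rho ^+ d * ball_volume R d)%:E)%E.
Proof.
move=> hz rho0; apply: (le_trans (torus_ball_measure_le _ hz)).
by rewrite -[X in ball_measure d X]mulr1 ball_measureZ// ball_measure1 EFinM.
Qed.

End Boxes.

Section TorusCoord.
Variable R : realType.

Lemma torus_coord_lip (a b z : R) : torus_coord z b <= torus_coord a b + `|a - z|.
Proof.
have h : `|z - b| <= `|a - b| + `|a - z|.
  by rewrite (_ : z - b = (a - b) - (a - z)) ?ler_normB//; ring.
have h' : `|a - b| <= `|z - b| + `|a - z|.
  by rewrite (_ : a - b = (z - b) + (a - z)) ?ler_normD//; ring.
rewrite /torus_coord; case: (leP `|a - b|) => _; rewrite ge_min; apply/orP;
  [left|right]; lra.
Qed.

(* Weighted AM-GM, [2 t a <= eta t ^ 2 + a ^ 2 / eta], stands in for the triangle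
   inequality of the torus distance. *)
Lemma torus_ball_dist d (x y z : d.-tuple R) (r eta a : R) : 0 < eta -> 0 <= r ->
  unit_cube x -> unit_cube y -> unit_cube z ->
  (forall k, `|tnth x k - tnth z k| <= a) ->
  d%:R * (a ^+ 2 * (1 + eta^-1)) <= eta * r ^+ 2 ->
  torus_dist x y <= r -> torus_ball z (((1 + eta) * r) ^+ 2) y.
Proof.
move=> e0 r0 hx hy hz ha hd hxy; rewrite /torus_ball /=.
have sr : \sum_(k < d) torus_coord (tnth x k) (tnth y k) ^+ 2 <= r ^+ 2.
  rewrite -ler_sqrt ?exprn_even_ge0// sqrtr_sqr (ger0_norm r0).
  exact: hxy.
apply: (@le_trans _ _ (\sum_(k < d) ((1 + eta) * torus_coord (tnth x k) (tnth y k)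
  ^+ 2
    + a ^+ 2 * (1 + eta^-1)))).
  apply: ler_sum => k _.
  have t0 : 0 <= torus_coord (tnth x k) (tnth y k) by exact: torus_coord_ge0.
  have z0 : 0 <= torus_coord (tnth z k) (tnth y k) by exact: torus_coord_ge0.
  have := torus_coord_lip (tnth x k) (tnth y k) (tnth z k); have := ha k.
  have a0 : 0 <= a by exact: le_trans (ha k).
  move: (torus_coord (tnth x k) _) (torus_coord (tnth z k) _) `|_| t0 z0 =>
    t u b t0 u0 ba ub.
  have uta : u <= t + a by lra.
  apply: (@le_trans _ _ ((t + a) ^+ 2)); first by apply: lerXn2r;
    rewrite ?nnegrE// addr_ge0.
  have : 0 <= eta^-1 * (eta * t - a) ^+ 2 by rewrite mulr_ge0 ?sqr_ge0// invr_ge0 ltW.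
  have -> : eta^-1 * (eta * t - a) ^+ 2 = eta * t ^+ 2 - 2 * t * a + eta^-1 * a ^+ 2.
    by field; rewrite gt_eqF.
  move=> h; rewrite -subr_ge0; apply: le_trans h _; rewrite le_eqVlt; apply/orP;
    left; apply/eqP; ring.
rewrite big_split/= -mulr_sumr sumr_const card_ord -[X in _ + X]mulr_natl.
apply: (le_trans (lerD (ler_wpM2l _ sr) hd)); first by rewrite addr_ge0// ltW.
have -> : (1 + eta) * r ^+ 2 + eta * r ^+ 2 = (1 + 2 * eta) * r ^+ 2 by ring.
rewrite exprMn ler_wpM2r ?sqr_ge0//.
have := sqr_ge0 eta; have -> : (1 + eta) ^+ 2 = 1 + 2 * eta + eta ^+ 2 by ring.
by move: (eta ^+ 2) => w ?; lra.
Qed.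
End TorusCoord.

(** * From populations of cells and balls to degrees *)

Section GoodPositions.
Variables (R : realType) (d n c : nat) (r eta : R) (M' M2' : nat).
Variables (lo hi hb : R).
Hypotheses (d0 : (0 < d)%N) (r0 : 0 < r) (eta0 : 0 < eta).
Local Notation M := M'.+1.
Local Notation M2 := M2'.+1.
Hypothesis M2le : (2 <= M')%N.
Hypothesis Mr_ge : 2 * Num.sqrt d%:R <= M%:R * r.
Hypothesis Mr_lt : M%:R * r < (3 * d)%:R.
Hypothesis fine_grid : d%:R * (M2%:R^-1 ^+ 2 * (1 + eta^-1)) <= eta * r ^+ 2.

Definition grid_point (q : {ffun 'I_d -> 'I_M2}) : d.-tuple R :=
  [tuple (q k)%:R / M2%:R | k < d].

Lemma grid_point_cube q : unit_cube (grid_point q).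
Proof.
move=> k; rewrite tnth_mktuple divr_ge0//= ler_pdivrMr ?ltr0n// mul1r ler_nat ltnW//.
Qed.

Lemma grid_point_near (x : d.-tuple R) k : unit_cube x ->
  `|tnth x k - tnth (grid_point (grid_cell M2' x)) k| <= M2%:R^-1.
Proof.
move=> hx; rewrite tnth_mktuple ffunE.
have /andP[h1 h2] := grid_index_bounds M2' (hx k).
have M20 : (0 : R) < M2%:R by rewrite ltr0n.
rewrite ger0_norm; last by rewrite subr_ge0 ler_pdivrMr// (mulrC (tnth x k)).
by rewrite lerBlDl -[X in _ + X]mul1r -mulrDl ler_pdivlMr// (mulrC (tnth x k)).
Qed.

Definition hitset (A : set (d.-tuple R)) (x : n.-tuple (d.-tuple R)) : {set 'I_n} :=
  [set i | `[< A (tnth x i) >]]%SET.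

Definition good_positions (x : n.-tuple (d.-tuple R)) : Prop :=
  [/\ forall i, unit_cube (tnth x i),
      forall q, lo <= #|hitset (cell_box (M' := M') q) x|%:R <= hi &
      forall q, #|hitset (torus_ball (grid_point q) (((1 + eta) * r) ^+ 2)) x|%:R
        <= hb].

Let Nl := Num.truncn lo.
Let N := Num.truncn hi.
Let Dm := Num.truncn hb.
Let K := ((6 * d).+1 ^ d)%N.
Hypothesis lo0 : 0 <= lo.
Hypothesis Nl0 : (0 < Nl)%N.
Hypothesis NNl : (N <= 2 * Nl)%N.
Hypothesis c0 : (0 < c)%N.
Hypothesis cNl : (c <= 2 * Nl)%N.

(** [prob_disconnected] with touching cells for [Mo], cells at distance at most [3 d] for [A],
    whence [K = (2 (3 d) + 1) ^ d], and with [D = 2 Nl]. *)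
Lemma good_selection_prob (L : nat) (x : n.-tuple (d.-tuple R))
    (C := 4 * expR 1 * K%:R ^+ 3 : R)
    (Z := C * (L%:R / (2 * Nl)%:R) ^+ c.-1) :
  good_positions x ->
  C * expR (- ((3 ^ d)%:R * Nl%:R / (2 * Dm%:R))) ^+ c.-1 <= 2^-1 ->
  Z <= 2^-1 ->
  selection_prob R c (rgg_neighbors r x) (fun s =>
    ~~ `[< graph_connected (bluetooth_edge s) >]) <=
  (M ^ d)%:R ^+ 2 * 4 ^+ N * expR (- (c%:R * Nl%:R ^+ 2 / (4 * Dm%:R))) +
  n%:R * (2 * Z ^+ c.+1 + 2^-1 ^+ L).
Proof.
move=> [hc hcell hball] hC hZ.
have nbE i j : (j \in rgg_neighbors r x i) = (j != i) && (torus_dist (tnth x i)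
  (tnth x j) <= r).
  by rewrite inE.
pose cell i := grid_cell M' (tnth x i).
have clsE q : [set v | cell v == q]%SET = hitset (cell_box q) x.
  apply/setP => v; rewrite !inE; apply/eqP/asboolP.
    by move=> h; apply/cell_boxE.
  by move/cell_boxE; apply.
have trE (m : nat) (a b : R) : 0 <= a -> a <= m%:R <= b ->
  (Num.truncn a <= m <= Num.truncn b)%N.
  move=> a0 /andP[am mb]; rewrite truncn_le_nat truncn_ge_nat;
    last by rewrite (le_trans _ mb).
  by rewrite mb andbT (le_lt_trans am)// ltr_nat.
have cellN q : (Nl <= #|[set v | cell v == q]%SET| <= N)%N.
  by rewrite clsE; apply: trE.
have nbM v w : grid_near 1 (cell v) (cell w) -> w != v -> w \in rgg_neighbors r x v.
  move=> vw wv; rewrite nbE wv /=; apply: (torus_dist_grid_near1 (M' := M')) => //.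
(* The cell of [v] and those touching it are at least three and hold at least [3 Nl] points; without
   [v] itself at least [2 Nl] remain. *)
have degl v : (2 * Nl <= #|rgg_neighbors r x v|)%N.
  have : (\sum_(q | grid_near 1 (cell v) q) Nl <= #|v |: rgg_neighbors r x v|)%N.
    rewrite -(sum_occupation cell) [leqLHS]big_mkcond/=; apply: leq_sum => q _.
    case: ifP => // vq; apply: (@leq_trans #|[set w | cell w == q]%SET|).
      by case/andP: (cellN q).
    rewrite /occupation; apply/subset_leq_card/fintype.subsetP => w;
      rewrite inE => /eqP wq.
    rewrite !inE wq eqxx andbT; case: eqVneq => //= wv.
    by have := nbM v w; rewrite wq nbE wv => /(_ vq isT).
  rewrite sum_nat_const cardsU1; have := card_grid_near1_ge (d := d) (cell v) M2le.
  have h3 : (3 <= 3 ^ d)%N by rewrite -[X in (X <= _)%N]expn1 leq_pexp2l.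
  have vv : v \notin rgg_neighbors r x v by rewrite nbE eqxx.
  rewrite vv cardsE => h1 h2.
  have h4 : (3 * Nl <= 1 + #|rgg_neighbors r x v|)%N.
    by apply: leq_trans h2; rewrite leq_mul2r; apply/orP; right; apply: leq_trans h1.
  by move: h4 Nl0; clear; move: #|_| => m; lia.
have degu v : (#|rgg_neighbors r x v| <= Dm)%N.
  have hb0 : 0 <= hb by apply: le_trans (hball (grid_cell M2' (tnth x v))).
  rewrite truncn_ge_nat//; apply: le_trans (hball (grid_cell M2' (tnth x v))).
  rewrite ler_nat; apply/subset_leq_card/fintype.subsetP => w;
    rewrite nbE inE => /andP[_ hvw].
  apply/asboolP; apply: (torus_ball_dist eta0 (ltW r0) (hc v) (hc w)
    (grid_point_cube _) _ fine_grid hvw).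
  by move=> k; exact: grid_point_near.
rewrite (_ : (M ^ d)%:R = #|{ffun 'I_d -> 'I_M}|%:R);
  last by rewrite card_ffun !card_ord.
have key := @prob_disconnected R n c (rgg_neighbors r x) _ cell (@grid_near M' d (3
  * d)) (@grid_near M' d 1)
  K (3 ^ d)%N Nl N (2 * Nl)%N Dm c0.
apply: key => //.
- by move=> v; rewrite nbE eqxx.
- exact: grid_near_sym.
- move=> q; rewrite /K (_ : (6 * d).+1 = 2 * (3 * d) + 1)%N; last by clear; lia.
  exact: card_grid_near_le.
- move=> v w; rewrite nbE => /andP[_ h];
  exact: (torus_dist_grid_near (ltW r0) (hc v) (hc w) Mr_lt h).
- exact: grid_near1_connected.
- exact: grid_near_refl.
- by move=> q; exact: card_grid_near1_ge.
- by move=> v; rewrite degl degu.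
- by rewrite expn_gt0.
Qed.
End GoodPositions.

(** * Probability of good positions *)

Section ProbGood.
Variables (R : realType) (d n c : nat) (r eta : R) (M' M2' : nat).
Hypotheses (r0 : 0 < r) (eta01 : 0 < eta < 1).
Local Notation M := M'.+1.
Local Notation M2 := M2'.+1.
Variables (d0 : measure_display) (Om : measurableType d0).
Variables (P : probability Om R).
Variables (X : 'I_n -> {RV P >-> d.-tuple R}) (S : 'I_n -> Om -> {set 'I_n}).
Hypothesis model : bluetooth_model r c X S.

Local Notation W := {ffun 'I_d -> 'I_M}.
Local Notation W2 := {ffun 'I_d -> 'I_M2}.
Let rho := (1 + eta) * r.
Let mcell : R := n%:R / M%:R ^+ d.
Let mball : R := n%:R * (rho ^+ d * ball_volume R d).

Let rho0 : 0 < rho.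
Proof. by rewrite mulr_gt0// addr_gt0//; case/andP: eta01. Qed.

(** All sets whose populations matter, indexed by one finite type, so that the data of the positions
    take finitely many values. *)
Definition test_set (a : option (W + W2)) : set (d.-tuple R) :=
  match a with
  | None => @unit_cube R d
  | Some (inl q) => cell_box q
  | Some (inr q) => torus_ball (grid_point R q) (rho ^+ 2)
  end.

Lemma unit_cubeE : @unit_cube R d = [set x | forall k, [set` `[0, 1]] (tnth x k)].
Proof. by apply/seteqP; split => x /= h k; have := h k; rewrite /= in_itv. Qed.

Lemma measurable_test_set a : measurable (test_set a).
Proof.
case: a => [[q|q]|] /=.
- exact: measurable_cell_box.
- exact: measurable_torus_ball.
- by rewrite unit_cubeE; apply: (measurable_box (I := fun=> [set` `[0, 1]])) => k;
  exact: measurable_itv.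
Qed.

Lemma prob_cube i : P [set w | test_set None (X i w)] = 1%:E.
Proof.
rewrite (points_uniform model i (measurable_test_set None)) /= setIid unit_cubeE.
rewrite (lebesgue_tuple_box (I := fun=> [set` `[0, 1]])); last by move=> k;
  exact: measurable_itv.
rewrite (eq_bigr (fun=> 1%:E)); first by rewrite prodEFin big1_eq.
by move=> k _; rewrite lebesgue_measure_itv/= lte_fin ltr01 sube0.
Qed.

Lemma prob_cell i q : P [set w | test_set (Some (inl q)) (X i w)] = ((M%:R ^+
  d)^-1)%:E.
Proof.
rewrite (points_uniform model i (measurable_test_set (Some (inl q)))).
exact: lebesgue_cell_box.
Qed.

Let ball_prob q : R :=
  fine (lebesgue_tuple (test_set (Some (inr q)) `&` @unit_cube R d)).

Lemma prob_ball q : (forall i,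
  P [set w | test_set (Some (inr q)) (X i w)] = (ball_prob q)%:E) /\
  ball_prob q <= rho ^+ d * ball_volume R d.
Proof.
have h := lebesgue_torus_ball_le (grid_point_cube R q) rho0.
have hf : lebesgue_tuple (test_set (Some (inr q)) `&` @unit_cube R d) \is a fin_num.
  rewrite ge0_fin_numE ?lebesgue_tuple_ge0//; apply: le_lt_trans h _; exact: ltry.
split; last by rewrite -lee_fin fineK.
by move=> i; rewrite (points_uniform model i (measurable_test_set (Some (inr q))))
  fineK.
Qed.

(** The neighbourhoods are recorded too, since the selection law depends on them. *)
Definition position_data (x : n.-tuple (d.-tuple R)) :
  {ffun option (W + W2) -> {set 'I_n}} * {ffun 'I_n -> {set 'I_n}} :=
  ([ffun a => hitset (test_set a) x], [ffun i => rgg_neighbors r x i]).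

Lemma measurable_position_data t : measurable [set x | position_data x = t].
Proof.
case: t => f g; rewrite (_ : [set x | _] = [set x | [ffun a =>
  hitset (test_set a) x] = f] `&`
    [set x | [ffun i => rgg_neighbors r x i] = g]); last first.
  by apply/seteqP; split => x /=; rewrite /position_data => -[e1 e2]; rewrite ?e1 ?e2.
apply: measurableI; apply: measurable_ffun_fiber => a.
  under eq_set do rewrite ffunE.
  apply: (measurable_index_set (B := fun i (x : n.-tuple (d.-tuple R)) =>
    test_set a (tnth x i))) => i.
  rewrite -[X in measurable X]setTI; apply: (measurable_tnth i) => //.
  exact: measurable_test_set.
under eq_set do rewrite ffunE.
pose B j (x : n.-tuple (d.-tuple R)) := (j != a) && (torus_dist (tnth x a) (tnth x
  j) <= r).
rewrite (_ : [set x | _] = [set x | [set j | `[< B j x >]]%SET = g a]); last first.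
  apply/seteqP; split => x /= <-; apply/setP => j; rewrite !inE;
    apply/idP/idP => [h|h];
    by [apply/asboolP|move/asboolP: h].
apply: measurable_index_set => j; rewrite /B; case: (j != a) => /=; last first.
  by rewrite (_ : (fun=> _) = set0)//; apply/seteqP; split.
pose h (x : n.-tuple (d.-tuple R)) := \sum_(k < d) torus_coord (tnth (tnth x a) k)
  (tnth (tnth x j) k) ^+ 2.
have mh : measurable_fun setT h.
  apply: measurable_sum => k; apply: measurable_funX.
  have m1 i : measurable_fun setT (fun x : n.-tuple (d.-tuple R) =>
    tnth (tnth x i) k).
    exact: (measurableT_comp (measurable_tnth k) (measurable_tnth i)).
  have m2 : measurable_fun setT (fun x : n.-tuple (d.-tuple R) =>
    `|tnth (tnth x a) k - tnth (tnth x j) k|).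
    by apply: measurableT_comp => //; exact: measurable_funB.
  by apply: measurable_minr => //; exact: measurable_funB.
rewrite -[X in measurable X]setTI (_ : _ `&` _ = setT `&` h @^-1` [set` `]-oo,
  r ^+ 2]]).
  by apply: mh => //; exact: measurable_itv.
rewrite !setTI; apply/seteqP; split => x; rewrite /preimage /= in_itv/= => hx.
  rewrite -ler_sqrt ?sqr_ge0// sqrtr_sqr (gtr0_norm r0); exact: hx.
rewrite -(gtr0_norm r0) -sqrtr_sqr; exact: ler_wsqrtr.
Qed.

Let lo := (1 - eta) * mcell.
Let hi := (1 + eta) * mcell.
Let hb := (1 + eta) * mball.

Definition good_data (y : {ffun option (W + W2) -> {set 'I_n}} * {ffun 'I_n ->
  {set 'I_n}}) : bool :=
  [&& y.1 None == [set: 'I_n]%SET,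
      [forall q, lo <= #|y.1 (Some (inl q))|%:R <= hi] &
      [forall q, #|y.1 (Some (inr q))|%:R <= hb]].

Lemma good_dataP x : good_data (position_data x) ->
  good_positions (n := n) r eta M' M2' lo hi hb x.
Proof.
case/and3P => /= /eqP; rewrite ffunE => h1 /forallP h2 /forallP h3; split.
- move=> i; have : i \in hitset (test_set None) x by rewrite h1 finset.in_setT.
  by rewrite inE => /asboolP.
- by move=> q; have := h2 q; rewrite ffunE.
- by move=> q; have := h3 q; rewrite ffunE.
Qed.

Lemma hitset_hits a w : hitset (test_set a) (positions X w) = hits X (test_set a) w.
Proof. by apply/setP => i; rewrite !inE tnth_mktuple. Qed.

Lemma prob_not_good :
  (P [set w | ~~ good_data (position_data (positions X w))] <=
  (M%:R ^+ d * (2 * expR (- (eta ^+ 2 / 8 * mcell))) +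
   M2%:R ^+ d * expR (- (eta ^+ 2 / 8 * mball)))%:E)%E.
Proof.
case/andP: (eta01) => e0 e1.
have e01 : 0 <= eta <= 1 by rewrite !ltW.
have indep := points_independent model.
have mhf a J : measurable [set w | hits X (test_set a) w = J].
  by apply: measurable_hits; exact: measurable_test_set.
have mh a (Q : pred {set 'I_n}) : measurable [set w | Q (hits X (test_set a) w)].
  exact: (measurable_finite_valued (mhf a) Q).
pose F1 := [set w | hits X (test_set None) w != [set: 'I_n]%SET].
pose F2 q := [set w | ~~ (lo <= #|hits X (test_set (Some (inl q))) w|%:R <= hi)].
pose F3 q := [set w | ~~ (#|hits X (test_set (Some (inr q))) w|%:R <= hb)].
(* A point lies in the cube with probability 1, so an incomplete set of hits has a factor
   [1 - 1]. *)
have P1 : (P F1 <= 0)%E.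
  rewrite /F1 (prob_finite_valued (mhf None) P (fun J => J != [set: 'I_n]%SET)).
  rewrite big1// => J JT.
  rewrite (prob_hits indep (measurable_test_set None) prob_cube J).
  have [i iJ] : exists i, i \notin J.
    apply/existsP; rewrite -negb_forall; apply: contra JT => /forallP h.
    by apply/eqP/setP => i; rewrite h finset.in_setT.
  by rewrite (bigD1 i)//= (negbTE iJ) subrr mul0r.
have P2 q : (P (F2 q) <= (2 * expR (- (eta ^+ 2 / 8 * mcell)))%:E)%E.
  have pc i := prob_cell i q.
  have mt := measurable_test_set (Some (inl q)).
  apply: (@le_trans _ _ (P ([set w | #|hits X (test_set (Some (inl q))) w|%:R <= (1
    - eta) * mcell] `|`
      [set w | (1 + eta) * mcell <= #|hits X (test_set (Some (inl q))) w|%:R]))).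
    apply: le_measure; rewrite ?inE.
    - exact: (mh _ (fun J => ~~ (lo <= #|J|%:R <= hi))).
    - apply: measurableU.
        exact: (mh _ (fun J => #|J|%:R <= (1 - eta) * mcell)).
      exact: (mh _ (fun J => (1 + eta) * mcell <= #|J|%:R)).
    - by move=> w; rewrite /F2 /= negb_and -!ltNge => /orP[] /ltW; [left|right].
  apply: (le_trans (measureU2 _ _ _)).
  - exact: (mh _ (fun J => #|J|%:R <= (1 - eta) * mcell)).
  - exact: (mh _ (fun J => (1 + eta) * mcell <= #|J|%:R)).
  rewrite mulr_natl mulr2n EFinD; apply: leeD.
    exact: (chernoff_lower indep mt pc e01).
  exact: (chernoff_upper indep mt pc e01).
have P3 q : (P (F3 q) <= (expR (- (eta ^+ 2 / 8 * mball)))%:E)%E.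
  have [pc pb] := prob_ball q.
  have mt := measurable_test_set (Some (inr q)).
  apply: (@le_trans _ _ (P [set w | (1 + eta) * mball <= #|hits X (test_set (Some
    (inr q))) w|%:R])).
    apply: le_measure; rewrite ?inE.
    - exact: (mh _ (fun J => ~~ (#|J|%:R <= hb))).
    - exact: (mh _ (fun J => (1 + eta) * mball <= #|J|%:R)).
    - by move=> w; rewrite /F3 /= -ltNge => /ltW.
  by apply: (chernoff_upper indep mt pc e01); rewrite ler_wpM2l.
have mF1 : measurable F1 by exact: (mh _ (fun J => J != [set: 'I_n]%SET)).
have mF2 q : measurable (F2 q) by exact: (mh _ (fun J => ~~ (lo <= #|J|%:R <= hi))).
have mF3 q : measurable (F3 q) by exact: (mh _ (fun J => ~~ (#|J|%:R <= hb))).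
have [mU2 PU2] := prob_exists_le mF2 P2.
have [mU3 PU3] := prob_exists_le mF3 P3.
apply: (@le_trans _ _ (P (F1 `|` ([set w | exists q, F2 q w] `|` [set w | exists q,
  F3 q w])))).
  apply: le_measure; rewrite ?inE.
  - have := measurable_finite_valued (fun t =>
    measurable_positions X (measurable_position_data t)) (fun y => ~~ good_data y).
    exact.
  - by apply: measurableU => //; exact: measurableU.
  - move=> w; rewrite /= /good_data !negb_and => /or3P[h|h|h].
    + by left; move: h; rewrite /= ffunE hitset_hits.
    + right; left; move: h; rewrite negb_forall => /existsP[q h]; exists q.
      by move: h; rewrite /F2 /= ffunE hitset_hits.
    + right; right; move: h; rewrite negb_forall => /existsP[q h]; exists q.
      by move: h; rewrite /F3 /= ffunE hitset_hits.
apply: (le_trans (measureU2 _ _ _)) => //; first exact: measurableU.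
rewrite -[leRHS]add0e; apply: leeD; first exact: P1.
apply: (le_trans (measureU2 _ _ _)) => //.
rewrite EFinD; apply: leeD.
  by move: PU2; rewrite card_ffun !card_ord natrX.
by move: PU3; rewrite card_ffun !card_ord natrX.
Qed.

End ProbGood.

(** * Bound for a fixed number of points *)

Section FiniteBound.
Variables (R : realType) (d n c : nat) (r : R).
Hypotheses (d_gt0 : (0 < d)%N) (r0 : 0 < r).
Variables (d0 : measure_display) (Om : measurableType d0).
Variables (P : probability Om R).
Variables (X : 'I_n -> {RV P >-> d.-tuple R}) (S : 'I_n -> Om -> {set 'I_n}).
Hypothesis model : bluetooth_model r c X S.

Lemma measurable_connected :
  measurable [set w | graph_connected (bluetooth_edge (fun i => S i w))].
Proof.
pose Q (s : {ffun 'I_n -> {set 'I_n}}) := `[< graph_connected (bluetooth_edge s) >].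
rewrite (_ : [set w | _] = [set w | Q (selections S w)]).
  exact: (measurable_finite_valued (measurable_selections model) Q).
apply/seteqP; split => w /=;
  rewrite /Q (_ : bluetooth_edge _ = bluetooth_edge (fun i => S i w)).
- by move=> h; apply/asboolP.
- by apply/funext => i; apply/funext => j; rewrite /bluetooth_edge /= !ffunE.
- by move/asboolP.
- by apply/funext => i; apply/funext => j; rewrite /bluetooth_edge /= !ffunE.
Qed.

Lemma prob_connected_ge (err : R) :
  (P [set w | ~~ `[< graph_connected (bluetooth_edge (selections S w)) >]] <=
    err%:E)%E ->
  ((1 - err)%:E <= P [set w | graph_connected (bluetooth_edge (fun i => S i w))])%E.
Proof.
have -> : [set w | ~~ `[< graph_connected (bluetooth_edge (selections S w)) >]] =
    ~` [set w | graph_connected (bluetooth_edge (fun i => S i w))].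
  have E w : bluetooth_edge (selections S w) = bluetooth_edge (fun i => S i w).
    by apply/funext => i; apply/funext => j; rewrite /bluetooth_edge /= !ffunE.
  by apply/seteqP; split => w /=; rewrite E => /asboolPn.
have key (p q : \bar R) : q \is a fin_num -> p = (1 - q)%E -> (p <= err%:E)%E ->
  ((1 - err)%:E <= q)%E.
  by case: q => [q| |] // _ ->; rewrite -EFinB !lee_fin => h; lra.
exact: (key _ _ (fin_num_measure P _ measurable_connected) (probability_setC P
  measurable_connected)).
Qed.

(* [m0] bounds the expected population of a cell from below, and the cells of
   the fine grid have side at most [r / kappa]. *)
Let v := ball_volume R d.
Let a : R := (2 * Num.sqrt d%:R) ^+ d.
Let eta : R := grid_eta R d.
Let u := n%:R * r ^+ d.
Let m0 := u / (a * (1 + eta) ^+ d).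
Let kappa := Num.sqrt (d%:R * (1 + eta^-1) / eta).
Let C : R := 4 * expR 1 * ((6 * d).+1 ^ d)%N%:R ^+ 3.

Hypothesis c_ge : 8 * v * a <= c.-1%:R.
Hypothesis c0 : (0 < c)%N.
Hypothesis r_le1 : r < 1.
Hypothesis r_le : r <= 2 * Num.sqrt d%:R * eta.
Hypothesis m0_eta : 1 <= eta * m0.
Hypothesis c_le : c%:R <= m0.
Hypothesis u1 : 1 <= v * u.
Variable L : nat.
Hypothesis ZL : C * (L%:R / m0) ^+ c.-1 <= 2^-1.

Let M' := Num.truncn (2 * Num.sqrt d%:R / r).
Let M2' := Num.truncn (kappa / r).
Local Notation M := M'.+1.
Local Notation M2 := M2'.+1.
Let mcell : R := n%:R / M%:R ^+ d.
Let mball : R := n%:R * (((1 + eta) * r) ^+ d * v).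

Let sd1 : 1 <= Num.sqrt d%:R :> R.
Proof. by rewrite -[leLHS]sqrtr1 ler_sqrt// ler1n. Qed.

Let sdd : Num.sqrt d%:R <= d%:R :> R.
Proof.
rewrite -[leRHS]ger0_norm// -sqrtr_sqr ler_sqrt ?sqr_ge0//.
by rewrite expr2 -natrM ler_nat leq_pmulr.
Qed.

Let e0 : 0 < eta. Proof. exact: (grid_eta_bounds R d_gt0).1. Qed.
Let e1 : eta <= 40^-1. Proof. exact: (grid_eta_bounds R d_gt0).2. Qed.
Let v0 : 0 < v. Proof. exact: ball_volume_gt0. Qed.
Let a0 : 0 < a. Proof. by rewrite exprn_gt0// mulr_gt0// (lt_le_trans _ sd1). Qed.
Let he0 k : 0 < (1 + eta) ^+ k. Proof. by rewrite exprn_gt0// addr_gt0. Qed.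
Let n0 : 0 < n%:R :> R.
Proof.
rewrite ltr0n lt0n; apply/eqP => nE; move: u1.
by rewrite /u nE mul0r mulr0 ler10.
Qed.
Let u0 : 0 < u. Proof. by rewrite mulr_gt0// exprn_gt0. Qed.
Let m00 : 0 < m0. Proof. by rewrite divr_gt0// mulr_gt0. Qed.

Let M_bounds : 2 * Num.sqrt d%:R <= M%:R * r /\ M%:R * r <= 2 * Num.sqrt d%:R + r.
Proof.
have h : 0 <= 2 * Num.sqrt d%:R / r by rewrite divr_ge0 ?mulr_ge0 ?sqrtr_ge0// ltW.
have /andP[h1 h2] := truncn_itv h; split.
  by rewrite -ler_pdivrMr// ltW.
rewrite -natr1 mulrDl mul1r lerD2r.
by rewrite -ler_pdivlMr.
Qed.

Let mcell_bounds : m0 <= mcell /\ mcell <= n%:R.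
Proof.
have [h1 h2] := M_bounds.
have Mr0 : 0 < M%:R * r by rewrite mulr_gt0.
have mE : mcell = u / (M%:R * r) ^+ d.
  rewrite /mcell /u exprMn; field.
  by rewrite expf_neq0 ?gt_eqF ?expf_neq0 ?gt_eqF.
split.
  rewrite mE /m0 ler_pM2l// lef_pV2 ?posrE ?exprn_gt0// ?mulr_gt0//.
  rewrite /a -exprMn; apply: lerXn2r; rewrite ?nnegrE ?(ltW Mr0)//.
    by rewrite !mulr_ge0 ?sqrtr_ge0// addr_ge0// ltW.
  by apply: (le_trans h2); rewrite mulrDr mulr1 lerD2l.
rewrite /mcell ler_pdivrMr ?exprn_gt0//; apply: ler_peMr => //.
by apply: exprn_ege1; rewrite ler1n.
Qed.

(** The four error terms come from the cells, at most [n] in number, from the balls at the points of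
    the fine grid, from the split event and from the closed sets. *)
Lemma finite_bound :
  ((1 - (2 * n%:R * expR (- (eta ^+ 2 / 8 * m0)) +
    (kappa + 1) ^+ d * (n%:R / u) * expR (- (eta ^+ 2 / 8 * (v * u))) +
    n%:R ^+ 2 * expR (- (m0 / 32)) +
    n%:R * (2 * (C * (L%:R / m0) ^+ c.-1) ^+ c.+1 + 2^-1 ^+ L)))%:E <=
   P [set w | graph_connected (bluetooth_edge (fun i => S i w))])%E.
Proof.
apply: prob_connected_ge.
have [m0cell cell_n] := mcell_bounds; have [Mr1 Mr2] := M_bounds.
have cell0 : 0 < mcell by exact: lt_le_trans m0cell.
pose lo := (1 - eta) * mcell; pose hi := (1 + eta) * mcell;
  pose hb := (1 + eta) * mball.
pose Nl := Num.truncn lo; pose N := Num.truncn hi; pose Dm := Num.truncn hb.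
have lo0 : 0 <= lo by rewrite mulr_ge0 ?ltW// subr_gt0 (le_lt_trans e1)//
  invf_lt1// ltr1n.
have hi0 : 0 <= hi by rewrite mulr_ge0 ?ltW// addr_gt0.
have ballE : mball = v * u * (1 + eta) ^+ d by rewrite /mball /u exprMn; ring.
have ball1 : v * u <= mball.
  by rewrite ballE; apply: ler_peMr;
    [rewrite mulr_ge0// ltW|rewrite exprn_ege1// lerDl ltW].
have hb0 : mball <= hb.
  by apply: ler_peMl; [exact: (le_trans ler01 (le_trans u1 ball1))|rewrite lerDl ltW].
have Nl_ge : (1 - 2 * eta) * mcell <= Nl%:R.
  have /andP[_ h] := truncn_itv lo0; rewrite -natr1 in h.
  have : 1 <= eta * mcell by apply: (le_trans m0_eta); rewrite ler_wpM2l// ltW.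
  by move: h; rewrite /lo -/Nl; move: (Nl%:R) (eta) (mcell) => x y z; lra.
have Nl_half : mcell / 2 <= Nl%:R.
  apply: le_trans Nl_ge; rewrite mulrC ler_wpM2r ?ltW//; move: e1; lra.
have m0Nl : m0 <= (2 * Nl)%:R.
  by rewrite natrM; apply: (le_trans m0cell); move: Nl_half; lra.
have cNl : (c <= 2 * Nl)%N by rewrite -(ler_nat R) (le_trans c_le).
have Nl0 : (0 < Nl)%N by move: c0 cNl; clear; lia.
have Nl0' : 0 < Nl%:R :> R by rewrite ltr0n.
(* This rests on [8 (1 + eta) <= 9 (1 - 2 eta)], true since [eta <= 1 / 40]. *)
have N_le : 8 * N%:R <= 9 * Nl%:R :> R.
  have h : N%:R <= hi by rewrite truncn_le.
  apply: (@le_trans _ _ (9 * ((1 - 2 * eta) * mcell))); last by rewrite ler_wpM2l.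
  apply: (@le_trans _ _ (8 * hi)); first by rewrite ler_wpM2l.
  rewrite (mulrA 8) (mulrA 9); apply: ler_wpM2r; [exact: ltW|]; move: e1; lra.
have NNl : (N <= 2 * Nl)%N by rewrite -(ler_nat R) natrM; move: N_le Nl0'; lra.
have Dm0 : 0 < Dm%:R :> R by rewrite ltr0n truncn_gt0 (le_trans u1)// (le_trans
  ball1).
(* The lower bound on [c - 1] enters here: its 8 becomes 7 after the losses collected in
   [grid_eta_le]. *)
have DmNl : 7 * Dm%:R <= c.-1%:R * Nl%:R :> R.
  have h : Dm%:R <= hb by rewrite truncn_le; apply: le_trans hb0;
    apply: le_trans ball1; exact: (le_trans ler01).
  pose t := (1 + eta) ^+ d; have t0 : 0 < t by exact: he0.
  have ht : 7 * ((1 + eta) * t * t) <= 8 * (1 - 2 * eta).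
    have := grid_eta_le R d_gt0; rewrite -/eta addn1 exprS mul2n -addnn exprD -/t.
    by rewrite (mulrA (1 + eta)).
  have e2 : 0 <= 1 - 2 * eta by move: e1; lra.
  apply: (@le_trans _ _ (8 * v * a * ((1 - 2 * eta) * m0))); last first.
    apply: ler_pM => //; first by rewrite !mulr_ge0// ltW.
      by rewrite mulr_ge0// ltW.
    by apply: le_trans Nl_ge; rewrite ler_wpM2l.
  apply: (@le_trans _ _ (7 * hb)); first by rewrite ler_wpM2l.
  have -> : 8 * v * a * ((1 - 2 * eta) * m0) = (v * u / t) * (8 * (1 - 2 * eta)).
    by rewrite /m0 -/t; field; rewrite !gt_eqF.
  have -> : 7 * hb = (v * u / t) * (7 * ((1 + eta) * t * t)).
    by rewrite /hb ballE -/t; field; rewrite gt_eqF.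
  apply: ler_wpM2l => //; apply: divr_ge0; last exact: ltW.
  by apply: mulr_ge0; exact: ltW.
have hC : C * expR (- ((3 ^ d)%N%:R * Nl%:R / (2 * Dm%:R))) ^+ c.-1 <= 2^-1.
  rewrite -expRM_natr mulNr; apply: animal_constant_le => //.
  have -> : (3 ^ d)%N%:R * Nl%:R / (2 * Dm%:R) * c.-1%:R =
     (c.-1%:R * Nl%:R) / Dm%:R * (2^-1 * 3 ^+ d) :> R.
    by rewrite natrX; field; rewrite gt_eqF.
  rewrite -mulrA; apply: ler_wpM2r; last by rewrite ler_pdivlMr.
  by rewrite mulr_ge0 ?exprn_ge0 ?invr_ge0.
have C0 : 0 <= C by rewrite !mulr_ge0 ?expR_ge0// exprn_ge0.
have Zle : C * (L%:R / (2 * Nl)%:R) ^+ c.-1 <= C * (L%:R / m0) ^+ c.-1.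
  apply: ler_wpM2l => //; apply: lerXn2r.
  - by rewrite nnegrE divr_ge0.
  - by rewrite nnegrE divr_ge0// ltW.
  - by apply: ler_wpM2l => //; rewrite lef_pV2 ?posrE// (lt_le_trans m00).
have hZ := le_trans Zle ZL.
pose err : R := (M ^ d)%:R ^+ 2 * 4 ^+ N * expR (- (c%:R * Nl%:R ^+ 2 / (4 *
  Dm%:R))) +
  n%:R * (2 * (C * (L%:R / (2 * Nl)%:R) ^+ c.-1) ^+ c.+1 + 2^-1 ^+ L).
have Z0 : 0 <= C * (L%:R / (2 * Nl)%:R) ^+ c.-1 by rewrite mulr_ge0// exprn_ge0//
  divr_ge0.
have err0 : 0 <= err.
  rewrite addr_ge0// ?mulr_ge0 ?expR_ge0 ?exprn_ge0//.
  by rewrite addr_ge0 ?mulr_ge0 ?exprn_ge0// invr_ge0.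
have M'2 : (2 <= M')%N.
  rewrite truncn_ge_nat; last by rewrite divr_ge0 ?mulr_ge0 ?sqrtr_ge0// ltW.
  rewrite ler_pdivlMr//; apply: ler_pM => //; first exact: ltW.
  by apply: le_trans sd1; exact: ltW.
(* Origin of [3 d]: [2 sqrt d + r < 2 d + 1 <= 3 d]. *)
have Mr_lt : M%:R * r < (3 * d)%:R.
  apply: (le_lt_trans Mr2); rewrite natrM.
  have : 1 <= d%:R :> R by rewrite ler1n.
  by move: sdd r_le1; lra.
have k0 : 0 <= d%:R * (1 + eta^-1) / eta.
  by rewrite divr_ge0 ?mulr_ge0 ?addr_ge0 ?invr_ge0// ltW.
have kr0 : 0 <= kappa / r by rewrite divr_ge0 ?sqrtr_ge0// ltW.
have fine : d%:R * (M2%:R^-1 ^+ 2 * (1 + eta^-1)) <= eta * r ^+ 2.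
  have /andP[_ h] := truncn_itv kr0; have M20 : 0 < M2%:R :> R by rewrite ltr0n.
  have kM : kappa <= M2%:R * r by rewrite -ler_pdivrMr// ltW.
  have : kappa ^+ 2 <= (M2%:R * r) ^+ 2.
    by apply: lerXn2r; rewrite ?nnegrE ?sqrtr_ge0// mulr_ge0// ltW.
  rewrite sqr_sqrtr// ler_pdivrMr// exprMn => hk.
  rewrite mulrCA exprVn mulrC ler_pdivrMr ?exprn_gt0//.
  by apply: (le_trans hk); rewrite le_eqVlt; apply/orP; left; apply/eqP; ring.
have eta01 : 0 < eta < 1 by rewrite e0 (le_lt_trans e1)// invf_lt1// ltr1n.
pose graph_of (t : {ffun option ({ffun 'I_d -> 'I_M} + {ffun 'I_d -> 'I_M2}) ->
  {set 'I_n}} *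
    {ffun 'I_n -> {set 'I_n}}) (i : 'I_n) := t.2 i.
pose pd (x : n.-tuple (d.-tuple R)) := position_data r eta M' M2' x.
have mpd t : measurable [set x | pd x = t] by exact: measurable_position_data.
have pdg x : rgg_neighbors r x = graph_of (pd x).
  by apply/funext => i; rewrite /graph_of /pd /= ffunE.
have good_err x : good_data r eta (pd x) ->
    selection_prob R c (rgg_neighbors r x) (fun s =>
      ~~ `[< graph_connected (bluetooth_edge s) >]) <= err.
  move=> /good_dataP h.
  exact: (good_selection_prob d_gt0 r0 e0 M'2 Mr1 Mr_lt fine lo0 Nl0 NNl c0 cNl (L
    := L) h hC hZ).
have hp := prob_selections_le model (g := graph_of) mpd pdg err0 good_err.
apply: (le_trans hp).
pose X1 : R := M%:R ^+ d * (2 * expR (- (eta ^+ 2 / 8 * mcell))) +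
   M2%:R ^+ d * expR (- (eta ^+ 2 / 8 * mball)).
apply: (@le_trans _ _ (X1%:E + err%:E)%E).
  by apply: leeD => //; exact: (prob_not_good M' M2' r0 eta01 model).
(* The expected population of a cell is at least 1. *)
have Mn : M%:R ^+ d <= n%:R :> R.
  have : 1 <= mcell by apply: le_trans m0cell; apply: le_trans c_le; rewrite ler1n.
  by rewrite /mcell ler_pdivlMr ?exprn_gt0// mul1r.
have eta8 : 0 <= eta ^+ 2 / 8 by rewrite divr_ge0 ?sqr_ge0.
rewrite -EFinD lee_fin /X1 /err !addrA.
apply: lerD; last first.
  apply: ler_wpM2l => //; apply: lerD => //; apply: ler_wpM2l => //.
  by apply: lerXn2r => //; rewrite nnegrE ?(le_trans Z0).
apply: lerD; [apply: lerD|].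
- rewrite mulrCA -[X in _ <= X]mulrA; apply: ler_wpM2l => //.
  apply: ler_pM; [by rewrite exprn_ge0|exact: expR_ge0|exact: Mn|].
  by rewrite ler_expR lerN2; apply: ler_wpM2l.
- apply: ler_pM; [by rewrite exprn_ge0|exact: expR_ge0| |].
    have M2le : M2%:R <= (kappa + 1) / r.
      have /andP[h _] := truncn_itv kr0; rewrite -natr1 mulrDl mul1r;
        apply: lerD => //.
      by rewrite invf_ge1// ltW.
    apply: (@le_trans _ _ (((kappa + 1) / r) ^+ d)).
      apply: lerXn2r; [by rewrite nnegrE| |exact: M2le].
      by rewrite nnegrE divr_ge0 ?(ltW r0)// addr_ge0// sqrtr_ge0.
    rewrite exprMn exprVn /u; apply: ler_wpM2l;
      first by rewrite exprn_ge0// addr_ge0// sqrtr_ge0.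
    by rewrite invfM mulrA divff ?mul1r// gt_eqF.
  by rewrite ler_expR lerN2; apply: ler_wpM2l.
- rewrite -mulrA; apply: ler_pM.
  + by rewrite exprn_ge0.
  + by rewrite mulr_ge0 ?exprn_ge0// expR_ge0.
  + by apply: lerXn2r; rewrite ?nnegrE// natrX.
  (* The exponent is [3 N / 2 - 7 Nl / 4 <= (27 / 16 - 28 / 16) Nl = - Nl / 16 <= - m0 / 32]. *)
  apply: (@le_trans _ _ (expR (3 / 2 * N%:R) * expR (- (7 / 4 * Nl%:R)))).
    apply: ler_pM; [by rewrite exprn_ge0|exact: expR_ge0| |].
      rewrite expRM_natr; apply: lerXn2r; rewrite ?nnegrE ?expR_ge0//.
      exact: four_le_expR.
    rewrite ler_expR lerN2 ler_pdivlMr ?mulr_gt0//.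
    have h : 7 * Dm%:R <= c%:R * Nl%:R :> R.
      by apply: (le_trans DmNl); rewrite ler_wpM2r// ler_nat leq_pred.
    have -> : 7 / 4 * Nl%:R * (4 * Dm%:R) = Nl%:R * (7 * Dm%:R) :> R by field.
    have -> : c%:R * Nl%:R ^+ 2 = Nl%:R * (c%:R * Nl%:R) :> R by ring.
    by rewrite ler_wpM2l.
  rewrite -expRD ler_expR; move: N_le Nl_half m0cell.
  move: (N%:R) (Nl%:R) (mcell) (m0) => x y z t; lra.
Qed.

End FiniteBound.

(** * Limit *)

Section Asymptotics.
Variable R : realType.

Lemma near_powR_ge (s A : R) : 0 < s -> \forall n \near \oo, A <= n%:R `^ s.
Proof.
move=> s0; pose B := Num.max A 1; have B0 : 0 < B by rewrite lt_max ltr01 orbT.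
near=> n; apply: (@le_trans _ _ B); first by rewrite le_max lexx.
have -> : B = (B `^ s^-1) `^ s.
  by rewrite -powRrM mulVf ?gt_eqF// powRr1// ltW.
apply: ge0_ler_powR; rewrite ?nnegrE ?powR_ge0 ?(ltW s0)//.
near: n; exact: nbhs_infty_ger.
Unshelve. all: by end_near. Qed.

Lemma cvg_powRN (s : R) : 0 < s -> n%:R `^ (- s) @[n --> \oo] --> (0 : R).
Proof.
move=> s0; apply/cvgrPdist_le => e e0; near=> n.
rewrite sub0r normrN ger0_norm ?powR_ge0// powRN.
have h : e^-1 <= n%:R `^ s by near: n; exact: near_powR_ge.
by rewrite -[leRHS]invrK lef_pV2 ?posrE ?invr_gt0// (lt_le_trans _ h)// invr_gt0.
Unshelve. all: by end_near. Qed.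

(** In [exp y >= y ^ k / k!], any [k >= 3 / t] makes [y ^ k] at least of order [n ^ 3]. The power
    [n ^ 2] covers the pairs of cells in the split event. *)
Lemma exp_powR_bound (b t : R) : 0 < b -> 0 < t ->
  exists2 K : R, 0 <= K & forall n : nat, (0 < n)%N ->
    n%:R ^+ 2 * expR (- (b * n%:R `^ t)) <= K * n%:R `^ (- 1).
Proof.
move=> b0 t0; pose k := (Num.truncn (3 / t)).+1.
have kt : 3 <= t * k%:R.
  have /andP[_ h] := truncn_itv (divr_ge0 (ler0n R 3) (ltW t0)).
  by rewrite mulrC -ler_pdivrMr// ltW.
exists (k`!%:R / b ^+ k); first by rewrite divr_ge0 ?exprn_ge0 ?ltW.
move=> n n0; have n1 : 1 <= n%:R :> R by rewrite ler1n.
have np : 0 < n%:R :> R by rewrite ltr0n.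
set y := b * n%:R `^ t; have y0 : 0 < y by rewrite mulr_gt0// powR_gt0.
have fp : 0 < k`!%:R :> R by rewrite ltr0n fact_gt0.
have h : b ^+ k * n%:R ^+ 3 / k`!%:R <= expR y.
  apply: le_trans (expR_ge_coeff k (ltW y0)).
  apply: ler_wpM2r; first by rewrite invr_ge0 ltW.
  rewrite /y exprMn; apply: ler_wpM2l; first by rewrite exprn_ge0 ?(ltW b0).
  rewrite -[in leRHS]powR_mulrn ?powR_ge0// -powRrM -powR_mulrn ?(ltW np)//.
  by apply: ler_powR.
have -> : n%:R `^ (-1) = n%:R^-1 :> R by rewrite powRN powRr1// ltW.
rewrite expRN ler_pdivrMr ?expR_gt0//.
apply: le_trans (ler_wpM2l _ h); last first.
  by rewrite !mulr_ge0 ?invr_ge0 ?exprn_ge0 ?ltW.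
rewrite le_eqVlt; apply/orP; left; apply/eqP; field.
by rewrite !gt_eqF ?exprn_gt0.
Qed.

Lemma half_exp_le (L : nat) (x : R) : x <= L%:R -> 2^-1 ^+ L <= expR (- (2^-1 * x)).
Proof.
move=> xL; apply: (@le_trans _ _ (expR (- 2^-1) ^+ L)).
  apply: lerXn2r; rewrite ?nnegrE ?expR_ge0 ?invr_ge0//.
  by apply: le_trans (expR_ge1Dx _); lra.
by rewrite -expRM_natr ler_expR mulNr lerN2 ler_wpM2l ?invr_ge0.
Qed.

Lemma inv_le_mul (p x : R) : 0 < p -> p^-1 <= x -> 1 <= p * x.
Proof. by move=> p0 px; rewrite -[leLHS](@divff _ p) ?gt_eqF// ler_pM2l. Qed.

Lemma dist_ratio_bounds (gam gn : R) : 0 < gam -> `|1 - gn / gam| <= 2^-1 ->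
  gam / 2 <= gn /\ gn <= 2 * gam.
Proof.
move=> gam0; have gE : gn = gam * (gn / gam) by field; rewrite gt_eqF.
rewrite ler_norml => /andP[h1 h2]; rewrite gE; move: (gn / gam) h1 h2 => z h1 h2.
by split; [rewrite ler_pM2l//|rewrite mulrC ler_pM2r//]; lra.
Qed.

(* The condition [1 < delta * (c.-1 * c.+1)] makes the expected number of closed
   sets with [c + 1] points vanish. *)
Lemma connected_whp (d c : nat) (delta gamma : R) (gamma_ r : nat -> R) :
  (0 < d)%N -> 0 < delta < 1 ->
  8 * ball_volume R d * (2 * Num.sqrt d%:R) ^+ d <= c.-1%:R ->
  1 < delta * (c.-1 * c.+1)%:R ->
  0 < gamma -> gamma_ n / gamma @[n --> \oo] --> (1 : R) ->
  (forall n, (0 < n)%N -> 0 < r n) ->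
  (forall n, (0 < n)%N -> r n = gamma_ n * n%:R `^ (- ((1 - delta) / d%:R))) ->
  bluetooth_connected_whp d r c.
Proof.
move=> d0 /andP[del0 del1] hc hdc gam0 hgam r0 rE.
move=> disp Om P X S model.
pose v := ball_volume R d; pose a : R := (2 * Num.sqrt d%:R) ^+ d.
have v0 : 0 < v by exact: ball_volume_gt0.
have dR : 0 < d%:R :> R by rewrite ltr0n.
have a0 : 0 < a by rewrite exprn_gt0// mulr_gt0// sqrtr_gt0.
have c1 : (0 < c.-1)%N.
  by rewrite -(ltr0n R); apply: lt_le_trans hc; rewrite !mulr_gt0.
have c0 : (0 < c)%N by move: c1; clear; lia.
have [e0 e1] := grid_eta_bounds R d0; set eta := grid_eta R d in e0 e1.
pose q := (c.-1 * c.+1)%N.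
have q0 : 0 < q%:R :> R by rewrite ltr0n muln_gt0 c1.
(* [L] will be of order [n ^ theta]: [theta > 0] makes [n 2 ^ (- L)] vanish, and with this choice
   [s = (delta - theta) q - 1] is half of [delta q - 1], so that the small sets contribute a
   multiple of [n ^ (- s)] with [s > 0]. *)
pose theta := (delta - q%:R^-1) / 2.
have dq : q%:R^-1 < delta by rewrite -div1r ltr_pdivrMr.
have th0 : 0 < theta by rewrite divr_gt0// subr_gt0.
pose s := (delta - theta) * q%:R - 1.
have s0 : 0 < s.
  have -> : s = (delta * q%:R - 1) / 2.
    by rewrite /s /theta; field; rewrite gt_eqF.
  by rewrite divr_gt0// subr_gt0.
have dth : 0 < delta - theta.
  have : 0 < q%:R^-1 :> R by rewrite invr_gt0.
  by rewrite /theta; move: (q%:R^-1) => z; lra.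
(* Eventually [gamma_ n >= gamma / 2], so that [u >= g n ^ delta] and, with [h] below,
   [m0 >= h n ^ delta]. *)
pose g := (gamma / 2) ^+ d; have g0 : 0 < g by rewrite exprn_gt0// divr_gt0.
pose t := (1 - delta) / d%:R; have t0 : 0 < t by rewrite divr_gt0// subr_gt0.
pose den := a * (1 + eta) ^+ d.
have den0 : 0 < den by rewrite mulr_gt0// exprn_gt0// addr_gt0.
pose h := g / den; have h0 : 0 < h by rewrite divr_gt0.
pose C : R := 4 * expR 1 * ((6 * d).+1 ^ d)%N%:R ^+ 3.
have C0 : 0 < C by rewrite !mulr_gt0 ?expR_gt0// exprn_gt0// ltr0n expn_gt0.
pose kappa := Num.sqrt (d%:R * (1 + eta^-1) / eta).
have eta8 : 0 < eta ^+ 2 / 8 by rewrite divr_gt0// exprn_gt0.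
have [K1 K10 hK1] := exp_powR_bound (mulr_gt0 eta8 h0) del0.
have [K2 K20 hK2] := exp_powR_bound (mulr_gt0 eta8 (mulr_gt0 v0 g0)) del0.
have h32 : 0 < h / 32 by rewrite divr_gt0.
have [K3 K30 hK3] := exp_powR_bound h32 del0.
have half0 : (0 : R) < 2^-1 by rewrite invr_gt0.
have [K4 K40 hK4] := exp_powR_bound half0 th0.
pose Z := C * (2 / h) ^+ c.-1.
pose b n : R := (2 * K1 + (kappa + 1) ^+ d * v * K2 + K3 + K4) * n%:R `^ (- 1) +
   2 * Z ^+ c.+1 * n%:R `^ (- s).
have b_cvg : b n @[n --> \oo] --> (0 : R).
  rewrite -[X in _ --> X]addr0 -[in X in _ --> X + _](mulr0 (2 * K1 + (kappa + 1)
    ^+ d * v * K2 + K3 + K4)).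
  rewrite -[in X in _ --> _ + X](mulr0 (2 * Z ^+ c.+1)).
  by apply: cvgD; apply: cvgMr; exact: cvg_powRN.
suff lower : \forall n \near \oo,
  ((1 - b n)%:E <= P n [set w | graph_connected (bluetooth_edge (fun i =>
    S n i w))])%E.
  apply: (@squeeze_cvge _ _ _ _ (fun n => (1 - b n)%:E) _ (fun=> 1%E)).
  - near=> n; apply/andP; split; first by near: n.
    by apply: probability_le1; exact: (measurable_connected (model n)).
  - apply: cvg_EFin; first by near=> n.
    rewrite -[X in _ --> X]subr0; apply: cvgB => //; exact: cvg_cst.
  - exact: cvg_cst.
near=> n.
have n0 : (0 < n)%N by near: n; exact: nbhs_infty_gt.
have z1 : 1 <= n%:R `^ theta by near: n; exact: near_powR_ge.
have w1 : Num.max (2 / h) (2 * C * (2 / h)) <= n%:R `^ (delta - theta).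
  by near: n; exact: near_powR_ge.
have x1 : (eta * h)^-1 <= n%:R `^ delta by near: n; exact: near_powR_ge.
have x2 : c%:R / h <= n%:R `^ delta by near: n; exact: near_powR_ge.
have x3 : (v * g)^-1 <= n%:R `^ delta by near: n; exact: near_powR_ge.
have y1 : 4 * gamma <= n%:R `^ t by near: n; exact: near_powR_ge.
have y2 : 2 * gamma / (2 * Num.sqrt d%:R * eta) <= n%:R `^ t.
  by near: n; exact: near_powR_ge.
have n1 : 1 <= n%:R :> R by rewrite ler1n.
have np : 0 < n%:R :> R by rewrite ltr0n.
have hg : `|1 - gamma_ n / gamma| <= 2^-1.
  by near: n; move/cvgrPdist_le : hgam; apply.
have [hg1 hg2] := dist_ratio_bounds gam0 hg.
have gn0 : 0 < gamma_ n by apply: lt_le_trans hg1; rewrite divr_gt0.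
pose x : R := n%:R `^ delta; have x0 : 0 < x by exact: powR_gt0.
pose y : R := n%:R `^ t; have y0 : 0 < y by exact: powR_gt0.
pose z : R := n%:R `^ theta; have z0 : 0 < z by exact: powR_gt0.
pose w : R := n%:R `^ (delta - theta); have w0 : 0 < w by exact: powR_gt0.
have rn : r n = gamma_ n / y by rewrite rE// powRN.
pose u := n%:R * r n ^+ d.
have uE : u = gamma_ n ^+ d * x.
  rewrite /u rn exprMn exprVn mulrCA; congr (_ * _).
  rewrite /x /y -powR_mulrn ?powR_ge0// -powRrM -{1}[n%:R](@powRr1 R) ?ltW// -powRN
    -powRD; last first.
    by apply/implyP => _; rewrite gt_eqF.
  by congr (_ `^ _); rewrite /t; field; rewrite gt_eqF.
have u_ge : g * x <= u.
  rewrite uE ler_wpM2r ?(ltW x0)//; apply: lerXn2r; rewrite ?nnegrE ?(ltW gn0)//.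
  by rewrite divr_ge0 ?ltW.
pose m0 := u / den.
have m0_ge : h * x <= m0.
  by rewrite /h /m0 mulrAC ler_wpM2r ?invr_ge0 ?(ltW den0).
have m00 : 0 < m0 by apply: lt_le_trans m0_ge; rewrite mulr_gt0.
pose L := (Num.truncn z).+1.
have /andP[L1 L2] := truncn_itv (ltW z0).
have zL : z <= L%:R by exact: ltW.
rewrite -/z in z1; rewrite -/w in w1; rewrite -/x in x1 x2 x3; rewrite -/y in y1 y2.
have Lz : L%:R <= 2 * z by rewrite /L -natr1 [leRHS]mulr_natl mulr2n lerD.
have Lm0 : L%:R / m0 <= 2 / h * w^-1.
  rewrite ler_pdivrMr//.
  apply: (le_trans Lz); apply: (@le_trans _ _ (2 / h / w * (h * x))); last first.
    by apply: ler_wpM2l => //; rewrite !divr_ge0 ?ltW.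
  have -> : x = w * z.
    rewrite /x /w /z -powRD ?subrK//; by apply/implyP => _; rewrite gt_eqF.
  by rewrite le_eqVlt; apply/orP; left; apply/eqP; field; rewrite !gt_eqF.
have Lm00 : 0 <= L%:R / m0 by rewrite divr_ge0// ltW.
have Zle : C * (L%:R / m0) ^+ c.-1 <= C * (2 / h * w^-1) ^+ c.-1.
  apply: ler_wpM2l; first exact: ltW.
  by apply: lerXn2r; rewrite ?nnegrE// (le_trans Lm00).
have hZ : C * (L%:R / m0) ^+ c.-1 <= 2^-1.
  apply: (le_trans Zle).
  move: w1; rewrite ge_max => /andP[w1 w2].
  have h1 : 2 / h * w^-1 <= 1 by rewrite ler_pdivrMr// mul1r.
  have h2 : 2 / h * w^-1 <= (2 * C)^-1.
    by rewrite ler_pdivrMr// [leRHS]mulrC ler_pdivlMr ?mulr_gt0// [leLHS]mulrC.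
  have p0 : 0 <= 2 / h * w^-1 by rewrite (le_trans Lm00).
  apply: (@le_trans _ _ (C * (2 * C)^-1)).
    apply: ler_wpM2l; first exact: ltW.
    apply: le_trans h2; rewrite -(prednK c1) exprS; apply: ler_piMr => //;
      exact: exprn_ile1.
  by rewrite invfM mulrCA divff ?mulr1// gt_eqF.
have sd0 : 0 < 2 * Num.sqrt d%:R * eta by rewrite !mulr_gt0// sqrtr_gt0.
have r_lt1 : r n < 1 by rewrite rn ltr_pdivrMr// mul1r (le_lt_trans hg2)//
  (lt_le_trans _ y1)// ltr_pM2r// ltr_nat.
have r_le : r n <= 2 * Num.sqrt d%:R * eta.
  rewrite rn ler_pdivrMr//; apply: (le_trans hg2).
  by move: y2; rewrite ler_pdivrMr// (mulrC y).
have em0 : 1 <= eta * m0.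
  apply: (@le_trans _ _ (eta * (h * x))); last by rewrite ler_wpM2l// ltW.
  by rewrite mulrA; apply: inv_le_mul => //; rewrite mulr_gt0.
have cm0 : c%:R <= m0 by apply: le_trans m0_ge; move: x2;
  rewrite ler_pdivrMr// (mulrC x).
have vu : 1 <= v * u.
  apply: (@le_trans _ _ (v * (g * x))); last by rewrite ler_wpM2l// ltW.
  by rewrite mulrA; apply: inv_le_mul => //; rewrite mulr_gt0.
have u0 : 0 < u by apply: lt_le_trans u_ge; rewrite mulr_gt0.
apply: le_trans (finite_bound d0 (r0 n n0) (model n) hc c0 r_lt1 r_le em0 cm0 vu hZ).
rewrite lee_fin lerD2l lerN2 -/v -/a -/eta -/u -/C -/den -/m0 -/kappa.
have nexp (A B : R) : B <= A -> n%:R * expR (- A) <= n%:R ^+ 2 * expR (- B).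
  move=> BA; apply: ler_pM; rewrite ?expR_ge0//.
    by rewrite expr2 ler_peMr.
  by rewrite ler_expR lerN2.
have T1 : 2 * n%:R * expR (- (eta ^+ 2 / 8 * m0)) <= 2 * K1 * n%:R `^ (-1).
  rewrite -(mulrA 2 n%:R) -(mulrA 2 K1); apply: ler_wpM2l => //.
  apply: le_trans (hK1 n n0); apply: nexp; rewrite -(mulrA (eta ^+ 2 / 8)).
  by apply: ler_wpM2l => //; exact: ltW.
have kap0 : 0 <= (kappa + 1) ^+ d by rewrite exprn_ge0// addr_ge0// sqrtr_ge0.
have T2 : (kappa + 1) ^+ d * (n%:R / u) * expR (- (eta ^+ 2 / 8 * (v * u))) <=
    (kappa + 1) ^+ d * v * K2 * n%:R `^ (-1).
  rewrite -!(mulrA ((kappa + 1) ^+ d)); apply: ler_wpM2l => //.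
  (* From [1 <= v u] one gets [n / u <= v n]. *)
  apply: (@le_trans _ _ (v * (n%:R * expR (- (eta ^+ 2 / 8 * (v * u)))))).
    rewrite [leRHS]mulrA; apply: ler_wpM2r; first exact: expR_ge0.
    by rewrite (mulrC v); apply: ler_wpM2l => //; rewrite -div1r ler_pdivrMr.
  rewrite -!(mulrA v); apply: ler_wpM2l; first exact: ltW.
  apply: le_trans (hK2 n n0); apply: nexp.
  rewrite -(mulrA (eta ^+ 2 / 8)); apply: ler_wpM2l; first exact: ltW.
  by rewrite -(mulrA v); apply: ler_wpM2l => //; exact: ltW.
have T3 : n%:R ^+ 2 * expR (- (m0 / 32)) <= K3 * n%:R `^ (-1).
  apply: le_trans (hK3 n n0); apply: ler_wpM2l; first by rewrite exprn_ge0.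
  by rewrite ler_expR lerN2 mulrAC ler_wpM2r// invr_ge0.
have T5 : n%:R * 2^-1 ^+ L <= K4 * n%:R `^ (-1).
  apply: le_trans (hK4 n n0); apply: (@le_trans _ _ (n%:R * expR (- (2^-1 * z)))).
    by apply: ler_wpM2l => //; exact: half_exp_le.
  exact: nexp.
have T4 : n%:R * (2 * (C * (L%:R / m0) ^+ c.-1) ^+ c.+1) <= 2 * Z ^+ c.+1 * n%:R `^
  (- s).
  have nE : n%:R `^ (- s) = n%:R * (w^-1 ^+ c.-1) ^+ c.+1.
    rewrite -exprM -/q exprVn /w -powR_mulrn ?powR_ge0// -powRrM -powRN.
    rewrite -{2}[n%:R](@powRr1 R) ?(ltW np)// -powRD; last by apply/implyP => _;
      rewrite gt_eqF.
    by congr (_ `^ _); rewrite /s; ring.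
  apply: (@le_trans _ _ (n%:R * (2 * (C * (2 / h * w^-1) ^+ c.-1) ^+ c.+1))).
    apply: ler_wpM2l => //; apply: ler_wpM2l => //; apply: lerXn2r => //;
    by rewrite nnegrE mulr_ge0 ?exprn_ge0 ?(ltW C0)// (le_trans Lm00).
  have eZ : C * (2 / h * w^-1) ^+ c.-1 = Z * w^-1 ^+ c.-1 by rewrite exprMn mulrA.
  rewrite nE eZ exprMn le_eqVlt; apply/orP; left; apply/eqP.
  by move: (Z ^+ _) ((w^-1 ^+ _) ^+ _) (n%:R) => f1 f2 f3; ring.
rewrite mulrDr; apply: (le_trans (lerD (lerD (lerD T1 T2) T3) (lerD T4 T5))).
rewrite /b le_eqVlt; apply/orP; left; apply/eqP.
move: (Z ^+ _) ((kappa + 1) ^+ _) (n%:R `^ (-1)) (n%:R `^ (- s)) => f1 f2 f3 f4; ring.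
Unshelve. all: by end_near. Qed.

End Asymptotics.

(** * Lower bounds for the constant [c] *)

Section Constants.
Variable R : realType.

Lemma le_natceil (x : R) : 0 <= x -> x <= (natceil x)%:R.
Proof.
move=> x0; apply: (le_trans (ceil_ge x)); rewrite /natceil.
by rewrite natr_absz ger0_norm// ceil_ge0 (lt_le_trans _ x0)// ltrN10.
Qed.

Lemma ln2_bounds : 2^-1 <= ln 2 :> R.
Proof.
have := @le_ln1Dx R (2^-1 - 1); rewrite addrCA subrr addr0 lnV ?posrE// => /(_ _) h.
by rewrite -lerN2; apply: (le_trans (h _)); lra.
Qed.

(* Since [25 < 2 ^ 5], [ln 5 < 5 / 2 * ln 2], and [ln] grows by less than
   [ln 2 / 2] per unit beyond 5. *)
Lemma ln_lt_half_ln2 (t : R) : 5 <= t -> 2 * ln t < t * ln 2.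
Proof.
move=> t5; have t0 : 0 < t by apply: lt_le_trans t5.
have l5 : 2 * ln 5 < 5 * ln 2 :> R.
  have h1 : ln (5 ^+ 2) = ln 5 *+ 2 :> R by rewrite lnXn.
  have h2 : ln (2 ^+ 5) = ln 2 *+ 5 :> R by rewrite lnXn.
  have : ln (5 ^+ 2) < ln (2 ^+ 5) :> R.
    by rewrite ltr_ln ?posrE ?exprn_gt0// -!natrX ltr_nat.
  by rewrite h1 h2 -(mulr_natl (ln 5)) -(mulr_natl (ln 2)).
have e : ln t = ln 5 + ln (t / 5) by rewrite -lnM ?posrE ?divr_gt0// mulrCA divff
  ?mulr1.
have h : ln (t / 5) <= t / 5 - 1.
  rewrite -[X in ln X](subrK 1) [X in ln X]addrC; apply: le_ln1Dx.
  by rewrite ltrBrDl addrN divr_gt0.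
have := ln2_bounds; rewrite e; move: (ln 5) (ln 2) (ln (t / 5)) h l5 => a b z h l5 hb.
have : 0 <= (t - 5) * (b - 2^-1) by rewrite mulr_ge0; lra.
nra.
Qed.

(** The quotient under the root is at least [1 / x]: its numerator is at least 1, and its
    denominator [x (1 - 2 x log_2 (1 / x))] lies between 0 and [x], being positive for [x <= 1 / 5]
    by [ln_lt_half_ln2] at [1 / x]. *)
Lemma bt_f_ge (eps x : R) : 0 < eps -> 0 < x <= 5^-1 -> 1 <= x * (bt_f eps x)%:R ^+ 2.
Proof.
move=> eps0 /andP[x0 x5].
pose q := ln x^-1 / ln 2.
have l2 : 0 < ln 2 :> R by apply: lt_le_trans ln2_bounds; rewrite invr_gt0.
have xi : 5 <= x^-1 by rewrite -[leLHS]invrK lef_pV2 ?posrE ?invr_gt0.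
have q0 : 0 < q by rewrite divr_gt0// ln_gt0// (lt_le_trans _ xi)// ltr1n.
have hx : 2 * x * q < 1.
  have h := ln_lt_half_ln2 xi.
  have -> : 2 * x * q = (2 * ln x^-1) * (x / ln 2) by rewrite /q; ring.
  rewrite -ltr_pdivlMr ?divr_gt0//; apply: (lt_le_trans h).
  by rewrite div1r invf_div mulrC.
set num := 1 + x ^+ 2 + 8 * Num.sqrt x + eps.
set den := x - 2 * x ^+ 2 * (ln x^-1 / ln 2).
have denE : den = x * (1 - 2 * x * q) by rewrite /den -/q; ring.
have den0 : 0 < den by rewrite denE mulr_gt0// subr_gt0.
have den_le : den <= x.
  rewrite denE ger_pMr// gerBl; apply: mulr_ge0; last exact: ltW.
  by apply: mulr_ge0 => //; exact: ltW.
have num1 : 1 <= num.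
  by rewrite /num -!addrA lerDl !addr_ge0 ?sqr_ge0 ?mulr_ge0 ?sqrtr_ge0// ltW.
have nd0 : 0 <= num / den by rewrite divr_ge0 ?ltW// (lt_le_trans _ num1).
have fE : num / den <= (bt_f eps x)%:R ^+ 2.
  rewrite -[leLHS](sqr_sqrtr nd0); apply: lerXn2r; rewrite ?nnegrE ?sqrtr_ge0//.
  exact: le_natceil (sqrtr_ge0 _).
apply: (@le_trans _ _ (x * (num / den))); last by rewrite ler_wpM2l// ltW.
rewrite mulrA ler_pdivlMr// mul1r; apply: (le_trans den_le).
by rewrite ler_peMr// ltW.
Qed.

Lemma bt_k1_ge (eps delta : R) : 0 < eps -> 0 < delta ->
  1 <= delta * (bt_k1 delta eps)%:R ^+ 2.
Proof.
move=> eps0 del0; rewrite /bt_k1; case: ifP => [d5|/negbT];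
  first by apply: bt_f_ge; rewrite ?del0.
rewrite -ltNge => d5.
have h5 : 0 < (5^-1 : R) <= 5^-1 by rewrite invr_gt0 ltr0n lexx.
apply: (le_trans (bt_f_ge eps0 h5)).
by rewrite ler_wpM2r ?sqr_ge0// ltW.
Qed.

Lemma bt_k2_ge (d : nat) (eps : R) : (0 < d)%N -> 0 < eps < 1 ->
  8 * ball_volume R d * (2 * Num.sqrt d%:R) ^+ d <= (bt_k2 d eps)%:R.
Proof.
move=> d0 /andP[e0 e1].
have v0 := ball_volume_gt0 R d.
have s0 : 0 <= (2 * Num.sqrt d%:R) ^+ d :> R by rewrite exprn_ge0 ?mulr_ge0
  ?sqrtr_ge0.
have p0 : 0 <= 8 * ball_volume R d * (2 * Num.sqrt d%:R) ^+ d.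
  by rewrite !mulr_ge0// ltW.
have e1' : 0 < 1 - eps by rewrite subr_gt0.
set y := 8 * (1 + eps) * ball_volume R d * (2 * Num.sqrt d%:R) ^+ d / (1 - eps).
have -> : (bt_k2 d eps)%:R = (natceil y)%:R :> R by [].
have hy : 8 * ball_volume R d * (2 * Num.sqrt d%:R) ^+ d <= y.
  rewrite /y ler_pdivlMr//.
  have -> : 8 * (1 + eps) * ball_volume R d * (2 * Num.sqrt d%:R) ^+ d =
    8 * ball_volume R d * (2 * Num.sqrt d%:R) ^+ d * (1 + eps) by ring.
  by rewrite ler_wpM2l//; lra.
by apply: (le_trans hy); apply: le_natceil; exact: le_trans p0 hy.
Qed.

(** [c - 1] is at least [k_2], which gives the first bound, and at least [k_1 + k_2] with [k_2 > 0],
    so that [(c - 1) (c + 1)] exceeds [k_1 ^ 2]. *)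
Lemma bluetooth_constant (d : nat) (delta eps : R)
    (c := (bt_k1 delta eps + bt_k2 d eps + bt_k3 d eps + 1)%N) :
  (0 < d)%N -> 0 < delta -> 0 < eps < 1 ->
  8 * ball_volume R d * (2 * Num.sqrt d%:R) ^+ d <= c.-1%:R /\
  1 < delta * (c.-1 * c.+1)%:R.
Proof.
move=> d0 del0 e01; have k2 := bt_k2_ge d0 e01.
have k1 : 1 <= delta * (bt_k1 delta eps)%:R ^+ 2 by apply: bt_k1_ge => //;
  case/andP: e01.
have k20 : (0 < bt_k2 d eps)%N.
  rewrite -(ltr0n R); apply: lt_le_trans k2; rewrite !mulr_gt0 ?ball_volume_gt0//.
  by rewrite exprn_gt0// mulr_gt0// sqrtr_gt0 ltr0n.
split; first by apply: (le_trans k2); rewrite ler_nat /c addn1 /=; lia.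
apply: (le_lt_trans k1); rewrite ltr_pM2l// -natrX ltr_nat /c addn1 /=.
move: k20; clear; move: (bt_k1 _ _) (bt_k2 _ _) (bt_k3 _ _) => x y z; nia.
Qed.

End Constants.

Theorem theorem1 (R : realType) (d : nat) (delta : R)
    (hd : (1 <= d)%N) (hdelta : 0 < delta < 1) :
  (exists2 c : nat, (0 < c)%N &
     forall (gamma : R) (gamma_ r : nat -> R),
       0 < gamma ->
       gamma_ n / gamma @[n --> \oo] --> (1 : R) ->
       (forall n, (0 < n)%N -> 0 < r n) ->
       (forall n, (0 < n)%N ->
          r n = gamma_ n * n%:R `^ (- ((1 - delta) / d%:R))) ->
       bluetooth_connected_whp d r c) /\
  (forall (gamma eps : R) (gamma_ r : nat -> R),
     0 < gamma -> 0 < eps < 1 ->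
     gamma_ n / gamma @[n --> \oo] --> (1 : R) ->
     (forall n, (0 < n)%N -> 0 < r n) ->
     (forall n, (0 < n)%N ->
        r n = gamma_ n * n%:R `^ (- ((1 - delta) / d%:R))) ->
     bluetooth_connected_whp d r
       (bt_k1 delta eps + bt_k2 d eps + bt_k3 d eps + 1)%N).
Proof.
have main eps : 0 < eps < 1 -> forall (gamma : R) (gamma_ r : nat -> R),
    0 < gamma -> gamma_ n / gamma @[n --> \oo] --> (1 : R) ->
    (forall n, (0 < n)%N -> 0 < r n) ->
    (forall n, (0 < n)%N -> r n = gamma_ n * n%:R `^ (- ((1 - delta) / d%:R))) ->
    bluetooth_connected_whp d r (bt_k1 delta eps + bt_k2 d eps + bt_k3 d eps + 1)%N.
  move=> e01 gamma gamma_ r gam0 hgam r0 rE; have /andP[del0 _] := hdelta.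
  have [h1 h2] := bluetooth_constant hd del0 e01.
  exact: (connected_whp hd hdelta h1 h2 gam0 hgam r0 rE).
split; last by move=> gamma eps gamma_ r gam0 e01; exact: main.
have half : 0 < (2^-1 : R) < 1 by rewrite invr_gt0 ltr0n invf_lt1 ?ltr1n.
(* Any fixed [eps] gives a constant that depends on [delta] and [d] only. *)
exists (bt_k1 delta 2^-1 + bt_k2 d (2^-1 : R)%R + bt_k3 d (2^-1 : R)%R + 1)%N;
  first by rewrite addn1.
exact: main.
Qed.
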